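(* Let $H$ be a solvable subgroup of Thompson's group $F$ of derived length $n$. Then the following assertions hold. (1) The action of $H$ on the set of finite dyadic fractions $\mathcal D=\mathbb{Z}[\frac12]\cap(0,1)$ has infinitely many orbits. (2) $\mathrm{Cl}(H)$ is solvable of derived length $n$. (3) If $H$ is finitely generated then $\mathrm{Cl}(H)$ is finitely generated.
   Context: Thompson's group $F$ is the group of all piecewise-linear increasing homeomorphisms of $[0,1]$ with finitely many breakpoints, all in $\mathbb{Z}[\frac12]\cap(0,1)$, and all slopes integer powers of $2$. Diagrams. For a finite binary word $u$, $[u]$ is the dyadic interval $[.u,.u1^{\mathbb N}]$ (binary expansions). Each $f\in F$ has a unique reduced pair $(T_+,T_-)$ of finite rooted full binary trees with the same number $n$ of leaves such that, if $u_1,\dots,u_n$ and $v_1,\dots,v_n$ are the leaf addresses ($0$ = left, $1$ = right) from left to right of $T_+$ and $T_-$, then $f$ maps $[u_i]$ linearly onto $[v_i]$ for all $i$ (reduced: for no $i$ are leaves $i,i+1$ the two children of one node in both trees). The reduced diagram $\Delta$ of $f$ is the following directed $2$-complex. Its edges are the nodes of $T_+$ and of $T_-$, the $i$-th leaf of $T_+$ being identified with the $i$-th leaf of $T_-$. It has vertices $0,\dots,n$, and a node whose descendant leaves are the $i$-th through $j$-th is an edge directed from vertex $i-1$ to vertex $j$. For each non-leaf node $e$ of either tree there is a positive cell with top edge $e$, left bottom edge the left child of $e$ and right bottom edge the right child of $e$ (together with its formal inverse, a negative cell). The top edge of $\Delta$ is the root of $T_+$, the bottom edge of $\Delta$ is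 the root of $T_-$. (For the identity, $\Delta$ is a single edge.) Core. Let $H\le F$ be generated by elements with reduced diagrams $\Delta_i$, $i\in\mathcal I$. Identify all top edges and all bottom edges of all $\Delta_i$ into one distinguished edge $p$ (with corresponding identification of endpoints). Then apply foldings as long as possible: whenever two positive cells have the same top edge, identify their left bottom edges, their right bottom edges and the cells; whenever two positive cells have the same left bottom edge and the same right bottom edge, identify their top edges and the cells (identifying edges also identifies their initial vertices and their terminal vertices). The resulting complex (a limit if infinitely many foldings are needed) with distinguished edge $p$ is the core $\mathcal L(H)$; it does not depend on the generating set or on the order of foldings. Closure. $\mathcal L(H)$ accepts a diagram $\Delta$ if there is a map from $\Delta$ to $\mathcal L(H)$ taking vertices to vertices, edges to edges, positive cells to positive cells, preserving initial and terminal vertices of edges and top, left bottom and right bottom edges of cells, and sending both the top and the bottom edge of $\Delta$ to $p$. The closure $\mathrm{Cl}(H)$ is the subgroup of all $f\in F$ whose reduced diagram is accepted by $\mathcal L(H)$. *)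

(* Defs.v *)
From HB Require Import structures.
From mathcomp Require Import all_boot all_order all_algebra.
From mathcomp Require Import all_classical all_reals all_analysis.
From mathcomp Require Import lra ring.

Set Implicit Arguments.
Unset Strict Implicit.
Unset Printing Implicit Defensive.

Import Order.TTheory GRing.Theory Num.Theory.
Import numFieldNormedType.Exports.
Local Open Scope classical_set_scope.
Local Open Scope ring_scope.

Section ThompsonGroup.
Variable R : realType.
Implicit Types (f g : R -> R) (x y a b : R).

Definition dyadic x := exists (m : int) (k : nat), x = m%:~R / 2 ^+ k.

Definition dyadic01 : set R := [set x | dyadic x /\ 0 < x < 1].

Definition homeo01 f := exists g : R -> R,
  [/\ set_fun `[0, 1] `[0, 1] f /\ set_fun `[0, 1] `[0, 1] g,
      {in `[0, 1], cancel f g} /\ {in `[0, 1], cancel g f},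
      {within `[0, 1], continuous f} & {within `[0, 1], continuous g}].

(* [s] lists the breakpoints; [f] is affine, of slope a power of 2, on each
   closed subinterval of [0, 1] with no breakpoint in its interior. *)
Definition piecewise_linear2 f := exists s : seq R,
  (forall x, x \in s -> dyadic01 x) /\
  forall a b, 0 <= a -> a <= b -> b <= 1 ->
    (forall x, x \in s -> ~~ (a < x < b)) ->
    exists k : int, forall x, a <= x <= b -> f x = f a + 2 ^ k * (x - a).

(* A homeomorphism of [0, 1] is represented by its extension to R by the
   identity, so that equality in F is equality of functions. *)
Definition thompson_spec f :=
  [/\ homeo01 f,
      {in `[0, 1] &, {homo f : x y / x < y}},
      piecewise_linear2 f
    & forall x, x \notin `[0, 1] -> f x = x].

Lemma dyadic0 : dyadic 0.
Proof. by exists 0, 0%N; rewrite mul0r. Qed.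

Lemma dyadic1 : dyadic 1.
Proof. by exists 1, 0%N; rewrite expr0 divr1. Qed.

Lemma dyadicD x y : dyadic x -> dyadic y -> dyadic (x + y).
Proof.
move=> [m [k ->]] [m' [k' ->]].
exists (m * 2 ^+ k' + m' * 2 ^+ k), (k + k')%N.
rewrite intrD !intrM !rmorphXn /= exprD.
by field; rewrite !expf_neq0// pnatr_eq0.
Qed.

Lemma dyadicN x : dyadic x -> dyadic (- x).
Proof. by move=> [m [k ->]]; exists (- m), k; rewrite mulrNz mulNr. Qed.

Lemma dyadicMX x (k : int) : dyadic x -> dyadic (2 ^ k * x).
Proof.
move=> [m [j ->]]; case: k => k.
  exists (m * 2 ^+ k), j; rewrite intrM rmorphXn /= -exprnP.
  by field; rewrite expf_neq0// pnatr_eq0.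
exists m, (j + k.+1)%N; rewrite NegzE -exprnN exprD.
by field; rewrite !expf_neq0// pnatr_eq0.
Qed.

Lemma in01 x : (x \in `[0, 1]) = (0 <= x <= 1).
Proof. by rewrite in_itv. Qed.

Lemma set01 x : `[0, 1]%classic x = (0 <= x <= 1) :> Prop.
Proof. by rewrite /= in_itv. Qed.

Lemma homo_inv f g : set_fun `[0, 1] `[0, 1] g ->
  {in `[0, 1], cancel g f} ->
  {in `[0, 1] &, {homo f : x y / x < y}} ->
  {in `[0, 1] &, {homo g : x y / x < y}}.
Proof.
move=> gI fgK fh x y xI yI xy.
have gxI : g x \in `[0, 1] by exact: gI.
have gyI : g y \in `[0, 1] by exact: gI.
rewrite ltNge; apply/negP; rewrite le_eqVlt => /orP[/eqP e|lt].
  by move: xy; rewrite -(fgK x)// -(fgK y)// e ltxx.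
have := fh _ _ gyI gxI lt; rewrite !fgK// => yx.
by have := lt_trans xy yx; rewrite ltxx.
Qed.

Lemma homo_bounds f g : set_fun `[0, 1] `[0, 1] f ->
  set_fun `[0, 1] `[0, 1] g ->
  {in `[0, 1], cancel g f} ->
  {in `[0, 1] &, {homo f : x y / x < y}} ->
  f 0 = 0 /\ f 1 = 1.
Proof.
move=> fI gI gK fh.
have fm := ltW_homo_in fh.
have I0 : (0 : R) \in `[0, 1] by rewrite in01 lexx ler01.
have I1 : (1 : R) \in `[0, 1] by rewrite in01 lexx ler01.
have gI' x : x \in `[0, 1] -> g x \in `[0, 1] by move=> ?; exact: gI.
have fI' x : x \in `[0, 1] -> f x \in `[0, 1] by move=> ?; exact: fI.
have f0 := fI' _ I0; have f1 := fI' _ I1.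
rewrite !in01 in f0 f1; case/andP: f0 => f0 _; case/andP: f1 => _ f1.
split; apply/eqP; rewrite eq_le.
- rewrite f0 andbT -[leRHS](gK 0)//; apply: fm => //; first exact: gI'.
  by have := gI' _ I0; rewrite in01 => /andP[].
- rewrite f1 /= -[leLHS](gK 1)//; apply: fm => //; first exact: gI'.
  by have := gI' _ I1; rewrite in01 => /andP[].
Qed.

Lemma homo_continuous f g : set_fun `[0, 1] `[0, 1] f ->
  set_fun `[0, 1] `[0, 1] g ->
  {in `[0, 1], cancel g f} ->
  {in `[0, 1] &, {homo f : x y / x < y}} ->
  {within `[0, 1], continuous f}.
Proof.
move=> fI gI gK fh; have [f0 f1] := homo_bounds fI gI gK fh.
apply: segment_inc_surj_continuous; first exact: le_mono_in.
rewrite f0 f1 => y yI; exists (g y); first exact: gI.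
exact: gK.
Qed.

Lemma thompson_intro f g :
  set_fun `[0, 1] `[0, 1] f -> set_fun `[0, 1] `[0, 1] g ->
  {in `[0, 1], cancel f g} -> {in `[0, 1], cancel g f} ->
  {in `[0, 1] &, {homo f : x y / x < y}} -> piecewise_linear2 f ->
  (forall x, x \notin `[0, 1] -> f x = x) -> thompson_spec f.
Proof.
move=> fI gI fK gK fh fpl fo; split=> //; exists g; split=> //.
  exact: (homo_continuous fI gI gK).
exact: (homo_continuous gI fI fK (homo_inv gI gK fh)).
Qed.

Lemma pl_dyadic f : f 0 = 0 -> piecewise_linear2 f ->
  forall x, 0 <= x <= 1 -> dyadic x -> dyadic (f x).
Proof.
move=> f0 [s [sD saff]] x; have [n] := ubnP (count (< x) s).
elim: n x => // n IH x; rewrite ltnS => xn /andP[x0 x1] xD.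
have max_seq (t : seq R) : t != [::] ->
    exists2 m, m \in t & forall y, y \in t -> y <= m.
  elim: t => // a [|b t] IHt _.
    by exists a; rewrite ?mem_head// => y; rewrite inE => /eqP->.
  have [//|m mt mM] := IHt.
  case: (leP a m) => am.
    exists m; first by rewrite inE mt orbT.
    by move=> y; rewrite inE => /orP[/eqP->//|/mM].
  exists a; first by rewrite mem_head.
  move=> y; rewrite inE => /orP[/eqP->//|/mM ym].
  exact: le_trans ym (ltW am).
have [e|/max_seq[m]] := eqVneq [seq y <- s | y < x] [::].
  have [|k fE] := saff 0 x (lexx _) x0 x1.
  - move=> y ys; apply/negP => /andP[_ yx].
    by have := in_nil y; rewrite -e mem_filter ys yx.
  - by rewrite (fE x) ?x0 ?lexx// f0 add0r subr0; exact: dyadicMX.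
rewrite mem_filter => /andP[mx ms] mM.
have [mD /andP[m0 m1]] := sD _ ms.
have [|k fE] := saff m x (ltW m0) (ltW mx) x1.
- move=> y ys; apply/negP => /andP[my yx].
  by have := mM y; rewrite mem_filter ys yx => /(_ isT); rewrite leNgt my.
- rewrite (fE x) ?(ltW mx) ?lexx//; apply: dyadicD.
    apply: IH => //; last by rewrite !ltW.
    apply: leq_trans xn.
    rewrite -!size_filter.
    rewrite (_ : [seq y <- s | y < m] = [seq y <- [seq y <- s | y < x] | y < m]).
      rewrite [in ltnLHS]size_filter -(count_predC (< m) [seq y <- s | y < x]).
      rewrite -[ltnLHS]addn0 ltn_add2l -has_count.
      by apply/hasP; exists m; rewrite ?mem_filter ?mx// /= ltxx.
    rewrite -filter_predI; apply: eq_filter => y /=.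
    by case: (ltP y m) => //= ym; rewrite (lt_trans ym mx).
  by apply: dyadicMX; apply: dyadicD => //; exact: dyadicN.
Qed.

Lemma thompson_elim f : thompson_spec f -> exists g,
  [/\ thompson_spec g, cancel f g, cancel g f,
      {in `[0, 1], forall x, f x \in `[0, 1]} &
      {in `[0, 1], forall x, dyadic x -> dyadic (f x)}].
Proof.
move=> [[g0 [[fI gI] [fK gK] _ _]] fh [s [sD saff]] fo].
pose g x := if x \in `[0, 1] then g0 x else x.
have fI' x : x \in `[0, 1] -> f x \in `[0, 1] by move=> ?; exact: fI.
have gI' x : x \in `[0, 1] -> g0 x \in `[0, 1] by move=> ?; exact: gI.
have gE x : x \in `[0, 1] -> g x = g0 x by rewrite /g => ->.
have {gI}gI : set_fun `[0, 1] `[0, 1] g by move=> x xI; rewrite /= gE// gI'.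
have fK' : cancel f g.
  move=> x; case: (boolP (x \in `[0, 1])) => xI; first by rewrite gE ?fK ?fI'.
  by rewrite fo// /g (negbTE xI).
have gK' : cancel g f.
  move=> x; rewrite /g; case: (boolP (x \in `[0, 1])) => xI; first by rewrite gK.
  by rewrite fo.
have gh := @homo_inv f g gI (in1W gK') fh.
have [f0 f1] := homo_bounds fI gI (in1W gK') fh.
have fd : {in `[0, 1], forall x, dyadic x -> dyadic (f x)}.
  by move=> x; rewrite in01; apply: pl_dyadic => //; exists s.
have g00 : g 0 = 0 by rewrite -{1}f0 fK'.
have g11 : g 1 = 1 by rewrite -{1}f1 fK'.
have I0 : (0 : R) \in `[0, 1] by rewrite in01 lexx ler01.
have I1 : (1 : R) \in `[0, 1] by rewrite in01 lexx ler01.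
exists g; split=> //; apply: (@thompson_intro _ f) => //; first last.
- by move=> x /negbTE xI; rewrite /g xI.
- exists (map f s); split=> [_ /mapP[x xs ->]|a b a0 ab b1 abs].
    have [xD /andP[x0 x1]] := sD _ xs.
    have xI : x \in `[0, 1] by rewrite in01 !ltW.
    split; first exact: fd.
    by rewrite -f0 -f1 !fh.
  have aI : a \in `[0, 1] by rewrite in01 a0 (le_trans ab).
  have bI : b \in `[0, 1] by rewrite in01 b1 (le_trans a0).
  have gI'' x : x \in `[0, 1] -> g x \in `[0, 1] by move=> ?; exact: gI.
  have gm := ltW_homo_in gh.
  have [||||k fE] := saff (g a) (g b).
  - by have := gI'' _ aI; rewrite in01 => /andP[].
  - exact: gm.
  - by have := gI'' _ bI; rewrite in01 => /andP[].
  - move=> x xs; apply/negP => /andP[ax xb].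
    have [_ /andP[x0 x1]] := sD _ xs.
    have xI : x \in `[0, 1] by rewrite in01 !ltW.
    have := abs (f x); rewrite map_f// => /(_ isT) /negP; apply.
    by rewrite -[X in X < _]gK' -[X in _ && (_ < X)]gK' !fh ?gI''.
  - exists (- k) => x /andP[ax xb].
    have xI : x \in `[0, 1] by rewrite in01 (le_trans a0)//= (le_trans xb).
    have := fE (g x); rewrite !gm// !gK' => /(_ isT) E.
    have -> : x - a = 2 ^ k * (g x - g a) by rewrite {1}E; ring.
    rewrite mulrA -expfzDr ?pnatr_eq0// addNr expr0z mul1r; ring.
Qed.

Lemma thompson_id : thompson_spec id.
Proof.
apply: (@thompson_intro _ id) => //.
exists [::]; split=> // a b *; exists 0 => x _; rewrite expr0z mul1r; ring.
Qed.

Lemma thompson_comp f h : thompson_spec f -> thompson_spec h ->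
  thompson_spec (f \o h).
Proof.
move=> Ff Fh.
have [g [Fg fK gK fI fD]] := thompson_elim Ff.
have [k [Fk hK kK hI hD]] := thompson_elim Fh.
have [_ [_ _ _ gI _]] := thompson_elim Fg.
have [_ [_ _ _ kI kD]] := thompson_elim Fk.
have [_ fh [s [sD saff]] fo] := Ff; have [_ hh [t [tD taff]] ho] := Fh.
have [_ kh _ _] := Fk.
have hm := ltW_homo_in hh; have km := ltW_homo_in kh.
have k0 : k 0 = 0 /\ k 1 = 1.
  exact: (@homo_bounds _ h).
have I0 : (0 : R) \in `[0, 1] by rewrite in01 lexx ler01.
have I1 : (1 : R) \in `[0, 1] by rewrite in01 lexx ler01.
apply: (@thompson_intro _ (k \o g)).
- by move=> x xI; apply/fI/hI.
- by move=> x xI; apply/kI/gI.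
- by apply: in1W => x; rewrite /= fK hK.
- by apply: in1W => x; rewrite /= kK gK.
- by move=> x y xI yI xy; apply: fh; rewrite ?hI// hh.
- exists (t ++ map k s); split=> [x|a b a0 ab b1 abs].
    rewrite mem_cat => /orP[/tD//|/mapP[{}x xs ->]].
    have [xD /andP[x0 x1]] := sD _ xs.
    have xI : x \in `[0, 1] by rewrite in01 !ltW.
    split; first exact: kD.
    by rewrite -k0.1 -k0.2 !kh.
  have aI : a \in `[0, 1] by rewrite in01 a0 (le_trans ab).
  have bI : b \in `[0, 1] by rewrite in01 b1 (le_trans a0).
  have [|i hE] := taff a b a0 ab b1.
    by move=> x xt; apply: abs; rewrite mem_cat xt.
  have [||||j fE] := saff (h a) (h b).
  - by have := hI _ aI; rewrite in01 => /andP[].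
  - exact: hm.
  - by have := hI _ bI; rewrite in01 => /andP[].
  - move=> x xs; apply/negP => /andP[ax xb].
    have [_ /andP[x0 x1]] := sD _ xs.
    have xI : x \in `[0, 1] by rewrite in01 !ltW.
    have := abs (k x); rewrite mem_cat map_f// orbT => /(_ isT) /negP; apply.
    by rewrite -[X in X < _]hK -[X in _ && (_ < X)]hK !kh ?hI.
  - exists (j + i) => x /andP[ax xb].
    have xI : x \in `[0, 1] by rewrite in01 (le_trans a0)//= (le_trans xb).
    have -> : (f \o h) x = f (h a) + 2 ^ j * (h x - h a) by apply: fE; rewrite !hm.
    by rewrite (hE x) ?ax// expfzDr ?pnatr_eq0//=; ring.
- by move=> x xI; rewrite /= ho// fo.
Qed.

Definition thompson := {f : R -> R | `[< thompson_spec f >]}.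

HB.instance Definition _ := Choice.on thompson.

Definition thompson_fun (f : thompson) : R -> R := val f.
Coercion thompson_fun : thompson >-> Funclass.

Lemma thompsonP (f : thompson) : thompson_spec f.
Proof. exact/asboolP/(valP f). Qed.

Lemma thompson_eq (f g : thompson) : f =1 g -> f = g.
Proof. by move=> fg; apply/val_inj/funext. Qed.

Lemma thompson_inv_proof (f : thompson) :
  exists g : thompson, cancel f g /\ cancel g f.
Proof.
have [g [Fg fK gK _ _]] := thompson_elim (thompsonP f).
by exists (exist _ g (asboolT Fg)).
Qed.

Definition thompson_one : thompson := exist _ id (asboolT thompson_id).

Definition thompson_mul (f g : thompson) : thompson :=
  exist _ (f \o g) (asboolT (thompson_comp (thompsonP f) (thompsonP g))).

Definition thompson_inv (f : thompson) : thompson :=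
  projT1 (cid (thompson_inv_proof f)).

Lemma thompson_invP (f : thompson) :
  cancel f (thompson_inv f) /\ cancel (thompson_inv f) f.
Proof. exact: projT2 (cid (thompson_inv_proof f)). Qed.

Fact thompson_mulA : associative thompson_mul.
Proof. by move=> f g h; exact: thompson_eq. Qed.

Fact thompson_mul1 : left_id thompson_one thompson_mul.
Proof. by move=> f; exact: thompson_eq. Qed.

Fact thompson_mulr1 : right_id thompson_one thompson_mul.
Proof. by move=> f; exact: thompson_eq. Qed.

Fact thompson_mulV : left_inverse thompson_one thompson_inv thompson_mul.
Proof. by move=> f; apply: thompson_eq => x; exact: (thompson_invP f).1. Qed.

Fact thompson_mulrV : right_inverse thompson_one thompson_inv thompson_mul.
Proof. by move=> f; apply: thompson_eq => x; exact: (thompson_invP f).2. Qed.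

HB.instance Definition _ := isGroup.Build thompson thompson_mulA
  thompson_mul1 thompson_mulr1 thompson_mulV thompson_mulrV.

End ThompsonGroup.

Section Subgroups.
Variable G : groupType.
Implicit Types A H : set G.

Definition subgroup H := group_closed [in H].

Definition generated A : set G := smallest subgroup A.

Definition finitely_generated H := exists2 A, finite_set A & H = generated A.

Fixpoint derived_series H k : set G :=
  if k is k'.+1 then
    generated [set ([~ x, y])%g | x in derived_series H k' & y in derived_series H k']
  else H.

Definition solvable_of_length H n :=
  [/\ subgroup H, derived_series H n = [set 1%g]
    & forall k, (k < n)%N -> derived_series H k <> [set 1%g]].

End Subgroups.

Definition thompson_orbit (R : realType) (H : set (thompson R)) (x : R) : set R :=
  [set h x | h in H].

Inductive tree := Leaf | Node of tree & tree.

HB.instance Definition _ := gen_eqMixin tree.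
HB.instance Definition _ := gen_choiceMixin tree.

(* A node is denoted by its address, with [false] for 0 and [true] for 1. *)
Definition address := seq bool.

Fixpoint leaves t : seq address :=
  if t is Node l r then
    map (cons false) (leaves l) ++ map (cons true) (leaves r)
  else [:: [::]].

Fixpoint inner_nodes t : seq address :=
  if t is Node l r then
    [::] :: map (cons false) (inner_nodes l) ++ map (cons true) (inner_nodes r)
  else [::].

Definition nodes t := inner_nodes t ++ leaves t.

Lemma root_node t : [::] \in nodes t.
Proof. by case: t => [|l r]; rewrite /nodes/= !inE. Qed.

Lemma child_node t u c : u \in inner_nodes t -> rcons u c \in nodes t.
Proof.
elim: t u c => // l IHl r IHr u c /=; rewrite /nodes/= inE mem_cat.
have consI b : injective (cons b : address -> address) by move=> x y [].
have nodesE x b : (b :: x \in inner_nodes (Node l r) ++ leaves (Node l r)) =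
    (x \in nodes (if b then r else l)).
  rewrite /nodes/= inE/= !mem_cat; case: b.
    rewrite !(mem_map (@consI true)).
    by do 2!case: mapP => [[? _ []]//|_].
  rewrite !(mem_map (@consI false)).
  by do 2!case: (mapP (f := cons true)) => [[? _ []]//|_]; rewrite !orbF.
case/or3P => [/eqP->|/mapP[v vl ->]|/mapP[v vr ->]].
- by rewrite -[_ \in _]/(_ \in inner_nodes (Node l r) ++ _) nodesE; case: c; exact: root_node.
- by rewrite rcons_cons nodesE IHl.
- by rewrite rcons_cons nodesE IHr.
Qed.

(* The pair (T+, T-). *)
Definition tree_pair := (tree * tree)%type.

Definition side (d : tree_pair) (s : bool) : tree := if s then d.1 else d.2.

Definition leaf_siblings t i := exists u : address,
  nth [::] (leaves t) i = rcons u false /\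
  nth [::] (leaves t) i.+1 = rcons u true.

Section TreePairs.
Variable R : realType.

Definition left_end (u : address) : R :=
  \sum_(i < size u) (nth false u i)%:R / 2 ^+ i.+1.

Definition width (u : address) : R := 2 ^- size u.

(* The right end point is .u1^N = .u + 2^-|u|. *)
Definition dyadic_interval (u : address) : set R :=
  `[left_end u, left_end u + width u].

Definition maps_linearly (f : R -> R) (u v : address) :=
  forall x, dyadic_interval u x ->
    f x = left_end v + width v / width u * (x - left_end u).

Definition reduced_diagram (f : thompson R) (d : tree_pair) :=
  [/\ size (leaves d.1) = size (leaves d.2),
      forall i, (i < size (leaves d.1))%N ->
        maps_linearly f (nth [::] (leaves d.1) i) (nth [::] (leaves d.2) i)
    & forall i, (i.+1 < size (leaves d.1))%N ->
        ~ (leaf_siblings d.1 i /\ leaf_siblings d.2 i)].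

End TreePairs.

(* Cells are the positive cells; their formal inverses carry no information. *)
Record complex := Complex {
  vertex : choiceType;
  edge : choiceType;
  cell : choiceType;
  ini : edge -> vertex;
  ter : edge -> vertex;
  top : cell -> edge;
  lbot : cell -> edge;
  rbot : cell -> edge }.

Definition is_complex_map (X Y : complex) (fv : vertex X -> vertex Y)
    (fe : edge X -> edge Y) (fc : cell X -> cell Y) :=
  [/\ forall e, ini (fe e) = fv (ini e),
      forall e, ter (fe e) = fv (ter e),
      forall c, top (fc c) = fe (top c),
      forall c, lbot (fc c) = fe (lbot c)
    & forall c, rbot (fc c) = fe (rbot c)].

Record diagram := Diagram {
  diagram_complex :> complex;
  top_edge : edge diagram_complex;
  bottom_edge : edge diagram_complex }.

Definition accepts (L : complex) (p : edge L) (D : diagram) :=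
  exists fv fe fc, [/\ @is_complex_map D L fv fe fc,
    fe (top_edge D) = p & fe (bottom_edge D) = p].

Section DiagramOfTreePair.
Variable d : tree_pair.

Local Notation n := (size (leaves d.1)).

(* [inl i] is the i-th leaf (counting from 0), common to both trees; [inr (s, u)]
   is the inner node of address [u] of T+ ([s = true]) or T- ([s = false]). *)
Definition pre_edge := (nat + bool * address)%type.

Definition node_edge (s : bool) (u : address) : pre_edge :=
  if u \in leaves (side d s) then inl (index u (leaves (side d s)))
  else inr (s, u).

Definition pre_edges : seq pre_edge :=
  map (node_edge true) (nodes d.1) ++ map (node_edge false) (nodes d.2).

Lemma mem_pre_edges s u : u \in nodes (side d s) -> node_edge s u \in pre_edges.
Proof.
by case: s => uN; rewrite mem_cat; apply/orP; [left|right]; exact: map_f.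
Qed.

Definition pair_edge := seq_sub pre_edges.

Definition pair_cell := {s : bool & seq_sub (inner_nodes (side d s))}.

Definition edge_of_node s u (uN : u \in nodes (side d s)) : pair_edge :=
  SeqSub (mem_pre_edges uN).

Definition cell_node (c : pair_cell) : address := ssval (tagged c).

Lemma cell_top_node (c : pair_cell) : cell_node c \in nodes (side d (tag c)).
Proof. by rewrite mem_cat (ssvalP (tagged c)). Qed.

Lemma cell_child_node (c : pair_cell) b :
  rcons (cell_node c) b \in nodes (side d (tag c)).
Proof. exact/child_node/(ssvalP (tagged c)). Qed.

(* The leaves below [u] are consecutive, and are those with prefix [u]. *)
Definition pre_ini (e : pre_edge) : nat :=
  match e with
  | inl i => i
  | inr (s, u) => find (prefix u) (leaves (side d s))
  end.

Definition pre_ter (e : pre_edge) : nat :=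
  match e with
  | inl i => i.+1
  | inr (s, u) => find (prefix u) (leaves (side d s))
                  + count (prefix u) (leaves (side d s))
  end.

(* [inord] does not truncate: these values are at most n when the trees have n
   leaves each. *)
Definition pair_complex := @Complex 'I_n.+1 pair_edge pair_cell
  (fun e => inord (pre_ini (ssval e)))
  (fun e => inord (pre_ter (ssval e)))
  (fun c => edge_of_node (cell_top_node c))
  (fun c => edge_of_node (cell_child_node c false))
  (fun c => edge_of_node (cell_child_node c true)).

Definition pair_diagram := @Diagram pair_complex
  (@edge_of_node true [::] (root_node d.1))
  (@edge_of_node false [::] (root_node d.2)).

End DiagramOfTreePair.

Section Folding.
Variables (X : complex) (glue : edge X -> edge X -> Prop).

(* The identifications obtained from [glue] by folding as long as possible, that
   is, the least equivalence relation containing [glue] and stable under both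
   kinds of foldings. *)
Inductive fold_edge : edge X -> edge X -> Prop :=
| fold_glue e e' : glue e e' -> fold_edge e e'
| fold_refl e : fold_edge e e
| fold_sym e e' : fold_edge e e' -> fold_edge e' e
| fold_trans e e' e'' : fold_edge e e' -> fold_edge e' e'' -> fold_edge e e''
| fold_lbot c c' :
    fold_edge (top c) (top c') -> fold_edge (lbot c) (lbot c')
| fold_rbot c c' :
    fold_edge (top c) (top c') -> fold_edge (rbot c) (rbot c')
| fold_top c c' :
    fold_edge (lbot c) (lbot c') -> fold_edge (rbot c) (rbot c') ->
    fold_edge (top c) (top c').

Inductive fold_vertex : vertex X -> vertex X -> Prop :=
| fold_ini e e' : fold_edge e e' -> fold_vertex (ini e) (ini e')
| fold_ter e e' : fold_edge e e' -> fold_vertex (ter e) (ter e')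
| foldv_refl v : fold_vertex v v
| foldv_sym v v' : fold_vertex v v' -> fold_vertex v' v
| foldv_trans v v' v'' :
    fold_vertex v v' -> fold_vertex v' v'' -> fold_vertex v v''.

(* Either kind of folding identifies two cells exactly when it leads to (or
   starts from) an identification of their top edges. *)
Definition fold_cell (c c' : cell X) := fold_edge (top c) (top c').

Definition fold_edgeb e e' := `[< fold_edge e e' >].
Definition fold_vertexb v v' := `[< fold_vertex v v' >].
Definition fold_cellb c c' := `[< fold_cell c c' >].

Lemma asbool_equiv (T : Type) (r : T -> T -> Prop) :
  (forall x, r x x) -> (forall x y, r x y -> r y x) ->
  (forall x y z, r x y -> r y z -> r x z) ->
  equiv_class_of (fun x y => `[< r x y >]).
Proof.
move=> rr rs rt; split=> [x|x y|y x z]; first exact/asboolP.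
  by apply/asbool_equiv_eq; split; exact: rs.
by move=> /asboolP xy /asboolP yz; apply/asboolP/(rt _ y).
Qed.

Canonical fold_edge_equiv := EquivRelPack
  (asbool_equiv fold_refl fold_sym fold_trans : equiv_class_of fold_edgeb).
Canonical fold_vertex_equiv := EquivRelPack
  (asbool_equiv foldv_refl foldv_sym foldv_trans : equiv_class_of fold_vertexb).
Canonical fold_cell_equiv := EquivRelPack
  (asbool_equiv (fun c => fold_refl (top c)) (fun c c' => @fold_sym _ _)
    (fun c c' c'' => @fold_trans _ _ _) : equiv_class_of fold_cellb).

Local Open Scope quotient_scope.
Local Notation qvertex := {eq_quot fold_vertexb}.
Local Notation qedge := {eq_quot fold_edgeb}.
Local Notation qcell := {eq_quot fold_cellb}.

(* The incidence maps do not depend on the representatives. *)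
Definition folded := @Complex qvertex qedge qcell
  (fun e => \pi_qvertex (ini (repr e)))
  (fun e => \pi_qvertex (ter (repr e)))
  (fun c => \pi_qedge (top (repr c)))
  (fun c => \pi_qedge (lbot (repr c)))
  (fun c => \pi_qedge (rbot (repr c))).

Definition folded_edge (e : edge X) : edge folded := \pi_qedge e.

End Folding.

Section Core.
Variables (I : choiceType) (D : I -> diagram).

(* The disjoint union of the diagrams [D i] and of an edge [None], which stands
   for p and whose end points are [inl false] and [inl true]. *)
Definition sum_complex := @Complex
  (bool + {i : I & vertex (D i)})%type
  (option {i : I & edge (D i)})
  {i : I & cell (D i)}
  (fun e => if e is Some x then inr (Tagged (fun i => vertex (D i)) (ini (tagged x)))
            else inl false)
  (fun e => if e is Some x then inr (Tagged (fun i => vertex (D i)) (ter (tagged x)))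
            else inl true)
  (fun c => Some (Tagged (fun i => edge (D i)) (top (tagged c))))
  (fun c => Some (Tagged (fun i => edge (D i)) (lbot (tagged c))))
  (fun c => Some (Tagged (fun i => edge (D i)) (rbot (tagged c)))).

Inductive root_glue : edge sum_complex -> edge sum_complex -> Prop :=
| glue_top i : root_glue None (Some (Tagged (fun i => edge (D i)) (top_edge (D i))))
| glue_bottom i :
    root_glue None (Some (Tagged (fun i => edge (D i)) (bottom_edge (D i)))).

Definition core_of : complex := folded root_glue.
Definition core_root_of : edge core_of := folded_edge root_glue None.

End Core.

Section Closure.
Variables (R : realType) (H : set (thompson R)).

(* The core does not depend on the generating set; here it is H itself. *)
Definition core_index :=
  {d : tree_pair | `[< exists2 h, H h & reduced_diagram h d >]}.

Definition core : complex := core_of (fun i : core_index => pair_diagram (val i)).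

Definition core_root : edge core :=
  core_root_of (fun i : core_index => pair_diagram (val i)).

Definition thompson_closure : set (thompson R) :=
  [set f | exists2 d, reduced_diagram f d & accepts core_root (pair_diagram d)].

End Closure.

(* Main.v *)
Require Import Defs.
From mathcomp Require Import all_boot all_order all_algebra.
From mathcomp Require Import all_classical all_reals all_analysis.
From mathcomp Require Import lra ring zify.
Set Implicit Arguments.
Unset Strict Implicit.
Unset Printing Implicit Defensive.

Import Order.TTheory GRing.Theory Num.Theory.
Local Open Scope classical_set_scope.
Local Open Scope ring_scope.

(** The closure of [H] consists of the elements of F that agree with elements of
    [H] between finitely many dyadic points ([thompson_closureE]). Indeed, two
    nodes [u] and [v] are identified in the core exactly when, after finitely many
    bisections, the parts of the interval of [u] are mapped linearly onto the
    parts of the interval of [v] by elements of [H]: this relation contains the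
    initial identifications and is stable under both kinds of foldings
    ([fold_rel]), and conversely the core accepts the diagram of an element
    piecewise in [H], because where the core stops branching all of [H] is linear
    and such an element has no genuine break ([one_piece], [reach_linear]).

    The rest is dynamics on [[0, 1]]. Let [Z] and [N] be two successive terms of
    the derived series of [H], let [(c, d)] be a component of the support of [Z],
    and let [Y] be the set of its points that are fixed by [N]. The group [Z]
    acts on [Y] through an abelian group, and the orbits of [Z] accumulate at [c].
    Germs at [c] are determined by slopes, which are powers of 2. It follows that
    the elements of [H] fixing [c] commute with [Z] on [Y], that they act trivially
    on [Y] as soon as they have slope 1 at [c] or fix a point of [(c, d)], and
    that the former also holds for elements piecewise in [H]: at a break inside [(c, d)]
    the two elements of [H] differ by one fixing a point, so that they agree on
    [Y] ([level_rid], [level_fix], [piecewise_single], [level_piecewise]).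

    (1) For the last nontrivial term [Z], [Y] is all of [(c, d)]. The stabiliser
    of [(c, d)] acts freely on it and embeds into the integers by the slope at [c],
    so that an orbit meets a fundamental domain of an element of [Z] in finitely
    many points.

    (2) By induction on [k], the elements of the [k]-th derived group of the closure
    fix all points fixed by the [k]-th derived group of [H]: a commutator of two
    elements preserving [(c, d)] has slope 1 at [c], hence acts trivially on [Y]
    ([derived_piecewise_fix]).

    (3) By induction on the derived length. A finitely generated [H] has finitely
    many components [(c, d)], and the slope at [c] maps the closure to the
    integers, so that it remains to treat the elements of the closure supported
    in [(c, d)] with slope 1 at [c]. Let [z] in [H] generate the group of slopes of
    [H] at [c]. If the derived group acts nontrivially on [(c, d)], it fixes a
    dyadic point [x] there ([component_dyadic]), which allows cutting at the
    points of the orbit of [x] under [z]. Up to conjugation by powers of [z] there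
    remain the elements supported in the interval from [x] to [z x]. They form the
    closure of the group of restrictions to this interval of the elements of [H]
    with slope 1 at [c], which is finitely generated and has smaller derived
    length ([piecewise_domain_group], [domain_group_fg],
    [domain_group_solvable]). *)

(* A product in the group is typed in the carrier of the group structure, which
   has no coercion to functions. *)
Local Notation ev f := (thompson_fun (f : thompson _)).

(** * Subgroups and derived series *)

Section GroupSets.
Variable G : groupType.
Implicit Types (A B H K : set G) (x y z g h : G).

Lemma subgroupP H : subgroup H <->
  [/\ H 1%g, forall x y, H x -> H y -> H (x * y)%g
    & forall x, H x -> H x^-1%g].
Proof.
split=> [gH|[H1 HM HV]].
  have HV := @group_closedV _ _ gH; have HM := @group_closedM _ _ gH.
  split=> [|x y Hx Hy|x Hx]; first by have := gH.1; rewrite inE.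
    by have := HM x y; rewrite !inE; exact.
  by have := HV x; rewrite !inE; exact.
by split=> [|x y]; rewrite !inE// => Hx Hy; apply/HM => //; exact: HV.
Qed.

Lemma subgroup1 H : subgroup H -> H 1%g.
Proof. by case/subgroupP. Qed.

Lemma subgroupM H x y : subgroup H -> H x -> H y -> H (x * y)%g.
Proof. by case/subgroupP => _ + _; exact. Qed.

Lemma subgroupV H x : subgroup H -> H x -> H x^-1%g.
Proof. by case/subgroupP => _ _; exact. Qed.

Lemma subgroupX H x k : subgroup H -> H x -> H (x ^+ k)%g.
Proof.
move=> gH Hx; elim: k => [|k IH]; first exact: subgroup1.
by rewrite expgS; exact: (subgroupM gH).
Qed.

Lemma subgroupJ H x y : subgroup H -> H x -> H y -> H (x ^ y)%g.
Proof.
by move=> gH Hx Hy; rewrite /conjg; do ?apply: subgroupM => //; exact: (subgroupV gH).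
Qed.

Lemma subgroupR H x y : subgroup H -> H x -> H y -> H ([~ x, y])%g.
Proof.
move=> gH Hx Hy; rewrite /commg; apply: subgroupM => //.
  exact: (subgroupV gH).
exact: subgroupJ.
Qed.

Lemma generated_subgroup A : subgroup (generated A).
Proof.
apply/subgroupP; split=> [K [gK _]|x y xA yA K AK|x xA K AK].
- exact: subgroup1.
- by apply: subgroupM; [exact: AK.1|exact: xA|exact: yA].
- by apply: subgroupV; [exact: AK.1|exact: xA].
Qed.

Lemma sub_generated A : A `<=` generated A.
Proof. by move=> x Ax K [_]; exact. Qed.

Lemma generated_min A K : subgroup K -> A `<=` K -> generated A `<=` K.
Proof. by move=> gK AK x; apply. Qed.

Lemma generated_sub A B : A `<=` generated B -> generated A `<=` generated B.
Proof. by apply: generated_min; exact: generated_subgroup. Qed.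

Lemma generatedS A B : A `<=` B -> generated A `<=` generated B.
Proof.
by move=> AB; apply: generated_sub => x /AB; exact: sub_generated.
Qed.

Lemma derived_subgroup H k : subgroup H -> subgroup (derived_series H k).
Proof. by case: k => // k _; exact: generated_subgroup. Qed.

Lemma derived_commg H k x y : derived_series H k x -> derived_series H k y ->
  derived_series H k.+1 ([~ x, y])%g.
Proof. by move=> Hx Hy; apply: sub_generated; exists x => //; exists y. Qed.

Lemma derived_min H k K : subgroup K ->
  (forall x y, derived_series H k x -> derived_series H k y ->
     K ([~ x, y])%g) -> derived_series H k.+1 `<=` K.
Proof.
by move=> gK cK; apply: generated_min => // _ [x Hx [y Hy <-]]; exact: cK.
Qed.

Lemma derivedS H K k : H `<=` K -> derived_series H k `<=` derived_series K k.
Proof.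
move=> HK; elim: k => //= k IH; apply: generatedS => _ [x Hx [y Hy <-]].
by exists x; [exact: IH|exists y => //; exact: IH].
Qed.

Lemma derived_succ_sub H k : subgroup H ->
  derived_series H k.+1 `<=` derived_series H k.
Proof.
move=> gH; have gk := derived_subgroup k gH.
by apply: (derived_min gk) => x y; exact: (subgroupR gk).
Qed.

Lemma derived_sub H k : subgroup H -> derived_series H k `<=` H.
Proof.
move=> gH; elim: k => // k IH x xk; apply: IH.
exact: derived_succ_sub.
Qed.

Lemma derived_norm H k x h : subgroup H -> H h -> derived_series H k x ->
  derived_series H k (x ^ h)%g.
Proof.
move=> gH; elim: k x h => [|k IH] x h Hh; first by move=> ?; exact: subgroupJ.
have gk := derived_subgroup k.+1 gH.
suff : derived_series H k.+1 `<=` [set x | derived_series H k.+1 (x ^ h)%g].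
  exact.
apply: derived_min.
  apply/subgroupP; split=> /= [|u v uh vh|u uh].
  - by rewrite conj1g; exact: (subgroup1 gk).
  - by rewrite conjMg; exact: (subgroupM gk).
  - by rewrite conjVg; exact: (subgroupV gk).
by move=> u v uk vk /=; rewrite conjRg; apply: derived_commg; exact: IH.
Qed.

End GroupSets.

(** * Germs of elements of F *)

Section Marks.
Variable R : realType.

Lemma prev_mark (l : seq R) (a x : R) : a < x -> exists m, [/\ a <= m < x,
  m = a \/ m \in l & forall p, p \in l -> ~~ (m < p < x)].
Proof.
move=> ax; elim: l => [|p l [m [/andP[am mx] ml mP]]].
  by exists a; split=> //; [rewrite lexx|left].
have [mpx|mpx] := boolP (m < p < x); last first.
  exists m; split=> [||q]; first by rewrite am.
    by case: ml => [|ml]; [left|right; rewrite inE ml orbT].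
  by rewrite inE => /orP[/eqP->|/mP].
case/andP: mpx => mp px; exists p; split=> [||q].
- by rewrite px (le_trans am (ltW mp)).
- by right; rewrite mem_head.
rewrite inE => /orP[/eqP->|/mP]; first by rewrite ltxx.
by apply: contra => /andP[pq ->]; rewrite (lt_trans mp pq).
Qed.

Lemma count_ltn (T : eqType) (P Q : pred T) (l : seq T) (e : T) :
  subpred P Q -> e \in l -> Q e -> ~~ P e -> (count P l < count Q l)%N.
Proof.
move=> PQ + Qe Pe; elim: l => //= y l IH.
rewrite inE => /orP[/eqP<-|/IH]; last first.
  by move=> lt; rewrite -addnS leq_add//; case: (P y) (PQ y) => // ->.
by rewrite Qe (negbTE Pe) add0n add1n ltnS sub_count.
Qed.

End Marks.

Section Elements.
Variable R : realType.
Local Notation F := (thompson R).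
Implicit Types (f g h : F) (x y a b c d : R) (s : seq R).

Lemma thM f g x : ev (f * g)%g x = f (g x).
Proof. by []. Qed.

Lemma th1 x : ev 1%g x = x.
Proof. by []. Qed.

Lemma thK f x : ev (f^-1)%g (f x) = x.
Proof. exact: (thompson_invP f).1. Qed.

Lemma thVK f x : f (ev (f^-1)%g x) = x.
Proof. exact: (thompson_invP f).2. Qed.

Lemma thJ f g x : ev (f ^ g)%g x = ev (g^-1)%g (f (g x)).
Proof. by []. Qed.

Lemma thR f g x : ev ([~ f, g])%g x = ev (f^-1)%g (ev (g^-1)%g (f (g x))).
Proof. by []. Qed.

Lemma th_inj f : injective f.
Proof. exact: can_inj (thK f). Qed.

Lemma th_ends f : f 0 = 0 /\ f 1 = 1.
Proof.
have [[g [[fI gI] [_ gK] _ _]] fh _ _] := thompsonP f.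
exact: homo_bounds fI gI gK fh.
Qed.

Lemma th_at0 f : f 0 = 0. Proof. by have [] := th_ends f. Qed.
Lemma th_at1 f : f 1 = 1. Proof. by have [] := th_ends f. Qed.

Lemma th_out f x : ~~ (0 <= x <= 1) -> f x = x.
Proof. by rewrite -in01 => xo; have [_ _ _] := thompsonP f; exact. Qed.

Lemma th_in f x : 0 <= x <= 1 -> 0 <= f x <= 1.
Proof.
by rewrite -!in01 => xI; have [[g [[fI _] _ _ _]] _ _ _] := thompsonP f; exact: fI.
Qed.

Lemma th_homo f : {homo f : x y / x < y}.
Proof.
move=> x y xy; have [_ fh _ _] := thompsonP f.
have [xI|xI] := boolP (0 <= x <= 1); have [yI|yI] := boolP (0 <= y <= 1).
- by apply: fh; rewrite ?in01.
- rewrite (th_out _ yI).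
  have := th_in f xI; move: xI yI xy; lra.
- rewrite (th_out _ xI).
  have := th_in f yI; move: xI yI xy; lra.
- by rewrite !th_out.
Qed.

Lemma th_lt f x y : (f x < f y) = (x < y).
Proof. exact: (leW_mono (le_mono (@th_homo f))). Qed.

Lemma th_le f x y : (f x <= f y) = (x <= y).
Proof. exact: (le_mono (@th_homo f)). Qed.

Lemma th_fixV f x : f x = x -> ev (f^-1)%g x = x.
Proof. by move=> {1}<-; rewrite thK. Qed.

Lemma next_break s c : exists2 b, c < b & forall p, p \in s -> ~~ (c < p < b).
Proof.
elim: s => [|p s [b cb bs]]; first by exists (c + 1) => //; lra.
have [cp|pc] := ltP c p.
  exists (Num.min b p); first by rewrite lt_min cb cp.
  move=> q; rewrite inE => /orP[/eqP->|/bs]; rewrite lt_min ?ltxx ?andbF//.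
  by apply: contra => /and3P[-> -> _].
exists b => // q; rewrite inE => /orP[/eqP->|/bs//].
by rewrite ltNge pc.
Qed.

Lemma prev_break s c : exists2 b, b < c & forall p, p \in s -> ~~ (b < p < c).
Proof.
have [b cb bs] := next_break (map -%R s) (- c).
exists (- b) => [|p ps]; first by rewrite ltrNl.
by have := bs (- p) (map_f _ ps); rewrite ltrN2 ltrNl andbC.
Qed.

Lemma exp2z_gt0 (k : int) : 0 < 2 ^ k :> R.
Proof. by rewrite exprz_gt0. Qed.

Lemma rgerm f c : exists (k : int) b, c < b /\
  forall x, c <= x <= b -> f x = f c + 2 ^ k * (x - c).
Proof.
have [c0|c0] := ltP c 0.
  exists 0, (c / 2); split=> [|x cx]; first lra.
  by rewrite !th_out ?expr0z; try lra; move: cx; lra.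
have [c1|c1] := leP 1 c.
  exists 0, (c + 1); split=> [|x cx]; first lra.
  have [->|cxn] := eqVneq x c; first by rewrite subrr mulr0 addr0.
  have [c1'|c1'] := eqVneq c 1.
    rewrite c1' th_at1 (@th_out _ x) ?expr0z; first lra.
    by move: cx; rewrite c1' => /andP[]; rewrite c1' in cxn; lra.
  by rewrite !th_out ?expr0z; try lra; move: cx; lra.
have [_ _ [s [_ saff]] _] := thompsonP f.
have [b cb bs] := next_break (1 :: s) c.
have b1 : b <= 1.
  by have := bs 1 (mem_head _ _); rewrite c1 /= -leNgt.
have [|k fE] := saff c b c0 (ltW cb) b1; last by exists k, b; split.
by move=> p ps; apply: bs; rewrite inE ps orbT.
Qed.

Lemma lgerm f c : exists (k : int) b, b < c /\
  forall x, b <= x <= c -> f x = f c + 2 ^ k * (x - c).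
Proof.
have [c1|c1] := ltP 1 c.
  exists 0, ((c + 1) / 2); split=> [|x cx]; first lra.
  by rewrite !th_out ?expr0z; try lra; move: cx; lra.
have [c0|c0] := leP c 0.
  exists 0, (c - 1); split=> [|x cx]; first lra.
  have [->|cxn] := eqVneq x c; first by rewrite subrr mulr0 addr0.
  have [c0'|c0'] := eqVneq c 0.
    rewrite c0' th_at0 (@th_out _ x) ?expr0z; first lra.
    by move: cx; rewrite c0' => /andP[]; rewrite c0' in cxn; lra.
  by rewrite !th_out ?expr0z; try lra; move: cx; lra.
have [_ _ [s [_ saff]] _] := thompsonP f.
have [b bc bs] := prev_break (0 :: s) c.
have b0 : 0 <= b.
  by have := bs 0 (mem_head _ _); rewrite c0 andbT -leNgt.
have [|k fE] := saff b c b0 (ltW bc) c1.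
  by move=> p ps; apply: bs; rewrite inE ps orbT.
exists k, b; split=> // x bx; rewrite (fE x bx) (fE c) ?lexx ?ltW//; ring.
Qed.

Lemma nondyadic_germ f c : ~ dyadic c -> exists (k : int) a b, a < c < b /\
  forall x, a <= x <= b -> f x = f c + 2 ^ k * (x - c).
Proof.
move=> cD.
have [cI|cI] := boolP (0 < c < 1); last first.
  have [c0|c0] := ltP c 0.
    exists 0, (c - 1), (c / 2); split=> [|x cx]; first lra.
    by rewrite !th_out ?expr0z; try lra; move: cx; lra.
  have [c1|c1] := ltP 1 c.
    exists 0, ((c + 1) / 2), (c + 1); split=> [|x cx]; first lra.
    by rewrite !th_out ?expr0z; try lra; move: cx; lra.
  case: cD; have [->|cn] := eqVneq c 0; first exact: dyadic0.
  by rewrite (_ : c = 1) //; [exact: dyadic1|move: cI c0 c1 cn; lra].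
have [_ _ [s [sD saff]] _] := thompsonP f.
have [a ac as_] := prev_break (0 :: s) c.
have [b cb bs] := next_break (1 :: s) c.
case/andP: cI => c0 c1.
have a0 : 0 <= a by have := as_ 0 (mem_head _ _); rewrite c0 andbT -leNgt.
have b1 : b <= 1 by have := bs 1 (mem_head _ _); rewrite c1 /= -leNgt.
have [||k fE] := saff a b a0 _ b1.
- exact: ltW (lt_trans ac cb).
- move=> p ps; apply/negP => /andP[ap pb].
  have [pc|cp|pc] := ltgtP p c.
  + by have := as_ p; rewrite inE ps orbT ap pc => /(_ isT).
  + by have := bs p; rewrite inE ps orbT pb cp => /(_ isT).
  + by apply: cD; rewrite -pc; case: (sD _ ps).
exists k, a, b; split; first by rewrite ac.
by move=> x ax; rewrite (fE x ax) (fE c) ?(ltW ac) ?(ltW cb)//; ring.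
Qed.

(** Triviality of the germs on the right and on the left of a point. The
    interval contains the point, which is therefore fixed. *)
Definition rid c f := exists2 b, c < b & forall x, c <= x <= b -> f x = x.
Definition lid c f := exists2 b, b < c & forall x, b <= x <= c -> f x = x.

Lemma rid_fix c f : rid c f -> f c = c.
Proof. by move=> [b cb]; apply; rewrite lexx ltW. Qed.

Lemma lid_fix c f : lid c f -> f c = c.
Proof. by move=> [b cb]; apply; rewrite lexx ltW. Qed.

Lemma rid1 c : rid c 1%g.
Proof. by exists (c + 1) => //; lra. Qed.

Lemma ridM c f g : rid c f -> rid c g -> rid c (f * g)%g.
Proof.
move=> [b cb fb] [e ce ge]; exists (Num.min b e); first by rewrite lt_min cb.
move=> x /andP[cx]; rewrite le_min => /andP[xb xe].
by rewrite thM ge ?cx// fb ?cx.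
Qed.

Lemma ridV c f : rid c f -> rid c f^-1%g.
Proof. by move=> [b cb fb]; exists b => // x /fb; exact: th_fixV. Qed.

Lemma affine_fix (k : int) c x : x != c -> c + 2 ^ k * (x - c) = x -> 2 ^ k = 1 :> R.
Proof.
move=> xc e; have xc0 : x - c != 0 by rewrite subr_eq0.
by apply: (mulIf xc0); rewrite mul1r -{2}e; ring.
Qed.

(** Near a point an element is affine on each side: if it fixes the point, its
    germ there is trivial or it has no other fixed point near it. *)
Lemma rgerm_dich c f : f c = c -> rid c f \/
  exists2 b, c < b & forall x, c < x <= b -> f x <> x.
Proof.
move=> fc; have [k [b [cb fE]]] := rgerm f c; rewrite fc in fE.
have [k1|k1] := eqVneq (2 ^ k : R) 1.
  by left; exists b => // x /fE->; rewrite k1; ring.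
right; exists b => // x /andP[cx xb]; rewrite fE ?xb ?ltW// => e.
by move: k1; rewrite (affine_fix _ e) ?eqxx// gt_eqF.
Qed.

Lemma lgerm_dich c f : f c = c -> lid c f \/
  exists2 b, b < c & forall x, b <= x < c -> f x <> x.
Proof.
move=> fc; have [k [b [cb fE]]] := lgerm f c; rewrite fc in fE.
have [k1|k1] := eqVneq (2 ^ k : R) 1.
  by left; exists b => // x /fE->; rewrite k1; ring.
right; exists b => // x /andP[bx xc]; rewrite fE ?bx ?ltW// => e.
by move: k1; rewrite (affine_fix _ e) ?eqxx// lt_eqF.
Qed.

(** An element has no breakpoint at a point that is not dyadic. *)
Lemma nondyadic_lid c f : ~ dyadic c -> lid c f -> rid c f.
Proof.
move=> /nondyadic_germ nd cf; have fc := lid_fix cf.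
have [k [a [b [/andP[ac cb] fE]]]] := nd f.
have [e ce fe] := cf; rewrite fc in fE.
pose x := Num.max a e.
have xc : x < c by rewrite gt_max ac ce.
have ax : a <= x by rewrite le_max lexx.
have ex : e <= x by rewrite le_max lexx orbT.
have k1 : 2 ^ k = 1 :> R.
  apply: (@affine_fix k c x); first by rewrite lt_eqF.
  by rewrite -fE ?ax ?(le_trans (ltW xc) (ltW cb))// fe// ex ltW.
exists b => // y /andP[cy yb].
by rewrite fE ?yb ?(le_trans (ltW ac) cy)// k1; ring.
Qed.

Lemma rslope_exists c f : exists k : int, exists2 b, c < b &
  forall x, c <= x <= b -> f x = f c + 2 ^ k * (x - c).
Proof. by have [k [b [cb fb]]] := rgerm f c; exists k, b. Qed.

(** The logarithm to base 2 of the right derivative. *)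
Definition rslope c f : int := projT1 (cid (rslope_exists c f)).

Lemma rslopeP c f : exists2 b, c < b &
  forall x, c <= x <= b -> f x = f c + 2 ^ rslope c f * (x - c).
Proof. exact: projT2 (cid (rslope_exists c f)). Qed.

Lemma rslope_unique c f k b : c < b ->
  (forall x, c <= x <= b -> f x = f c + 2 ^ k * (x - c)) -> rslope c f = k.
Proof.
move=> cb fb; have [e ce fe] := rslopeP c f.
pose x := Num.min b e.
have cx : c < x by rewrite lt_min cb ce.
have xb : x <= b by rewrite ge_min lexx.
have xe : x <= e by rewrite ge_min lexx orbT.
have := fe x; rewrite fb ?(ltW cx)// => /(_ xe)/addrI.
move/(mulIf (lt0r_neq0 _)); rewrite subr_gt0 => /(_ cx) /esym.
by move/ieexprIz; apply => //; rewrite pnatr_eq1.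
Qed.

Lemma rslopeM c f g : g c = c -> rslope c (f * g)%g = rslope c f + rslope c g.
Proof.
move=> gc; have [b cb fb] := rslopeP c f; have [e ce ge] := rslopeP c g.
rewrite gc in ge.
pose k := rslope c g.
have k0 := exp2z_gt0 k.
apply: (@rslope_unique _ _ _ (Num.min e (c + (b - c) / 2 ^ k))).
  by rewrite lt_min ce /= ltrDl divr_gt0// subr_gt0.
move=> x /andP[cx]; rewrite le_min => /andP[xe].
rewrite -lerBlDl ler_pdivlMr// => xb.
rewrite !thM gc ge ?cx// fb.
  by rewrite expfzDr ?pnatr_eq0//; ring.
rewrite -/k lerDl mulr_ge0 ?subr_ge0//=; last exact: ltW.
by move: xb; lra.
Qed.

Lemma rslope1 c : rslope c 1%g = 0.
Proof.
apply: (@rslope_unique _ _ _ (c + 1)); first lra.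
by move=> x _; rewrite expr0z !th1; ring.
Qed.

Lemma rslopeV c f : f c = c -> rslope c f^-1%g = - rslope c f.
Proof.
move=> fc; apply/eqP; rewrite -addr_eq0; apply/eqP.
by rewrite -rslopeM// mulVg rslope1.
Qed.

Lemma rslope0P c f : f c = c -> rid c f <-> rslope c f = 0.
Proof.
move=> fc; split=> [[b cb fb]|f0].
  apply: (rslope_unique cb) => x xb; rewrite expr0z mul1r fb// fc; ring.
have [b cb fb] := rslopeP c f; exists b => // x /fb ->.
by rewrite f0 expr0z fc; ring.
Qed.

(** The right germs at a fixed point commute, being linear. *)
Lemma rid_comm c f g : f c = c -> g c = c -> rid c ([~ f, g])%g.
Proof.
move=> fc gc; apply/rslope0P.
  by rewrite thR gc fc (th_fixV gc) (th_fixV fc).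
rewrite /commg /conjg !rslopeM//= ?thM ?gc ?fc ?(th_fixV gc)//.
by rewrite !rslopeV//; ring.
Qed.

End Elements.

(** * Elements that are piecewise in a subgroup *)

Section PiecewiseElements.
Variable R : realType.
Local Notation F := (thompson R).
Implicit Types (f g h : F) (H K : set F) (x y a b c d : R) (s : seq R).

Lemma th_dyadic f x : dyadic x -> dyadic (f x).
Proof.
move=> xD; have [xI|/th_out->//] := boolP (0 <= x <= 1).
have [_ [_ _ _ _ fD]] := thompson_elim (thompsonP f).
by apply: fD; rewrite ?in01.
Qed.

(** The intervals need not lie in [[0, 1]], since 0 and 1 may be put in [s] and all
    elements are the identity outside. *)
Definition piecewise H : set F := [set f | exists s, (forall p, p \in s -> dyadic p) /\
  forall a b, a <= b -> (forall p, p \in s -> ~~ (a < p < b)) ->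
    exists2 h, H h & forall x, a <= x <= b -> f x = h x].

Lemma sub_piecewise H : H `<=` piecewise H.
Proof. by move=> h Hh; exists [::]; split=> // a b _ _; exists h. Qed.

Lemma piecewise_germ H f c : piecewise H f ->
  exists2 h, H h & exists2 b, c < b & forall x, c <= x <= b -> f x = h x.
Proof.
move=> [s [_ fH]]; have [b cb bs] := next_break s c.
by have [h Hh fh] := fH c b (ltW cb) bs; exists h => //; exists b.
Qed.

Lemma piecewise_pt H f x : piecewise H f -> exists2 h, H h & f x = h x.
Proof.
by move=> /(@piecewise_germ _ _ x)[h Hh [b xb fh]]; exists h => //; apply: fh; rewrite lexx ltW.
Qed.

Lemma piecewise_fix H f x : piecewise H f -> (forall h, H h -> h x = x) -> f x = x.
Proof. by move=> /(@piecewise_pt _ _ x)[h /[swap] -> Hh]; exact. Qed.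

Lemma piecewise_subgroup H : subgroup H -> subgroup (piecewise H).
Proof.
move=> gH; apply/subgroupP; split=> [|f g [s [sD fH]] [t [tD gHt]]|f [s [sD fH]]].
- by apply: sub_piecewise; exact: subgroup1.
- exists (t ++ map (ev g^-1%g) s); split=> [p|a b ab abs].
    rewrite mem_cat => /orP[/tD//|/mapP[q qs ->]].
    by apply: th_dyadic; exact: sD.
  have [|k Hk gk] := gHt a b ab.
    by move=> p pt; apply: abs; rewrite mem_cat pt.
  have [||h Hh fh] := fH (ev g a) (ev g b); first by rewrite th_le.
    move=> p ps; have := abs (ev g^-1%g p).
    rewrite mem_cat map_f// orbT => /(_ isT).
    by rewrite -(th_lt g a) -(th_lt g _ b) thVK.
  exists (h * k)%g; first exact: subgroupM.
  by move=> x xab; rewrite !thM -gk// fh// !th_le.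
- exists (map (ev f) s); split=> [_ /mapP[q qs ->]|a b ab abs].
    by apply: th_dyadic; exact: sD.
  have [||h Hh fh] := fH (ev f^-1%g a) (ev f^-1%g b); first by rewrite th_le.
    move=> p ps; have := abs _ (map_f (ev f) ps).
    by rewrite -(th_lt (f^-1)%g a) -(th_lt (f^-1)%g _ b) thK.
  exists h^-1%g; first exact: subgroupV.
  move=> x xab; apply: (@th_inj _ h); rewrite thVK -fh ?thVK//.
  by rewrite !th_le.
Qed.

Definition cut_spec a b f (g : F) := forall x, g x = if a <= x <= b then f x else x.

Lemma cut_exists a b f : 0 <= a -> a <= b -> b <= 1 -> dyadic a -> dyadic b ->
  f a = a -> f b = b -> exists g, cut_spec a b f g.
Proof.
move=> a0 ab b1 aD bD fa fb.
pose r (f : F) x := if a <= x <= b then f x else x.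
have rI (h : F) x : h a = a -> h b = b -> a <= x <= b -> a <= h x <= b.
  by move=> ha hb; rewrite -{2}ha -{2}hb !th_le.
have rK (h : F) : h a = a -> h b = b -> forall x, r (h^-1)%g (r h x) = x.
  move=> ha hb x; rewrite {2}/r; case: ifPn => xab; last by rewrite /r (negbTE xab).
  by rewrite /r rI// thK.
have r01 (h : F) x : h a = a -> h b = b -> 0 <= x <= 1 -> 0 <= r h x <= 1.
  move=> ha hb xI; rewrite /r; case: ifPn => // /(rI _ _ ha hb)/andP[ax xb].
  by rewrite (le_trans a0)//= (le_trans xb).
have fVa := th_fixV fa; have fVb := th_fixV fb.
have fVV : (f^-1^-1)%g = f by rewrite invgK.
suff rT : thompson_spec (r f) by exists (exist _ (r f) (asboolT rT)).
apply: (@thompson_intro _ _ (r (f^-1)%g)).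
- by move=> x; rewrite !set01; exact: r01.
- by move=> x; rewrite !set01; exact: r01.
- by move=> x _; exact: rK.
- by move=> x _; have := rK _ fVa fVb x; rewrite fVV.
- move=> x y _ _ xy; rewrite /r.
  have [xab|xab] := boolP (a <= x <= b); have [yab|yab] := boolP (a <= y <= b).
  + by rewrite th_lt.
  + have := rI _ _ fa fb xab; move: xab yab; lra.
  + have := rI _ _ fa fb yab; move: xab yab; lra.
  + by [].
- have [_ _ [s [sD saff]] _] := thompsonP f.
  exists ([seq p <- [:: a; b] | 0 < p < 1] ++ s); split=> [p|u v u0 uv v1 uvs].
    rewrite mem_cat mem_filter => /orP[|/sD//].
    by rewrite !inE => /andP[p01 /orP[]/eqP pE]; split=> //; rewrite pE.
  have ua : ~~ (u < a < v).
    apply/negP => /andP[ua av]; have := uvs a.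
    rewrite ua av mem_cat mem_filter inE eqxx (le_lt_trans u0 ua) (lt_le_trans av v1).
    by move=> /(_ isT).
  have ub : ~~ (u < b < v).
    apply/negP => /andP[ub bv]; have := uvs b.
    rewrite ub bv mem_cat mem_filter !inE eqxx orbT (le_lt_trans u0 ub) (lt_le_trans bv v1).
    by move=> /(_ isT).
  have [|k fE] := saff u v u0 uv v1.
    by move=> p ps; apply: uvs; rewrite mem_cat ps orbT.
  have [[av vb]|] := pselect (a <= u /\ v <= b).
    exists k => x /andP[ux xv]; rewrite /r.
    rewrite (le_trans av ux) (le_trans xv vb) av (le_trans uv vb)/=.
    by apply: fE; rewrite ux.
  move=> nab; have id_r x : u <= x <= v -> r f x = x.
    move=> uxv; rewrite /r; case: ifPn => // axb.
    have [->//|xa] := eqVneq x a; have [->//|xb] := eqVneq x b.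
    by case: nab; move: ua ub uxv axb xa xb; split; lra.
  exists 0 => x uxv; rewrite expr0z mul1r !id_r ?lexx//; first ring.
- move=> x; rewrite in01 => xI; rewrite /r ifF//.
  by apply: contraNF xI => /andP[ax xb]; rewrite (le_trans a0)//= (le_trans xb).
Qed.

(** The default value is not taken when [a <= b] are dyadic fixed points of [f] in
    [[0, 1]]. *)
Definition cut a b f : F := xget 1%g (cut_spec a b f).

Lemma cutE a b f x : 0 <= a -> a <= b -> b <= 1 -> dyadic a -> dyadic b ->
  f a = a -> f b = b -> cut a b f x = if a <= x <= b then f x else x.
Proof.
move=> a0 ab b1 aD bD fa fb.
have := cut_exists a0 ab b1 aD bD fa fb => -[g gE].
by have : cut_spec a b f (cut a b f) by apply: xgetPex; exists g.
Qed.

Lemma cut_piecewise H a b f : subgroup H -> 0 <= a -> a <= b -> b <= 1 ->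
  dyadic a -> dyadic b -> f a = a -> f b = b ->
  piecewise H f -> piecewise H (cut a b f).
Proof.
move=> gH a0 ab b1 aD bD fa fb [s [sD fH]].
exists [:: a, b & s]; split=> [p|u v uv uvs].
  by rewrite !inE => /or3P[/eqP->|/eqP->|/sD].
have ua := uvs a; rewrite !inE eqxx in ua; move/(_ isT) in ua.
have ub := uvs b; rewrite !inE eqxx orbT in ub; move/(_ isT) in ub.
have [[av vb]|nab] := pselect (a <= u /\ v <= b).
  have [|h Hh fh] := fH u v uv.
    by move=> p ps; apply: uvs; rewrite !inE ps !orbT.
  exists h => // x /andP[ux xv].
  by rewrite cutE// (le_trans av ux) (le_trans xv vb)/= fh// ux.
exists 1%g; first exact: subgroup1.
move=> x uxv; rewrite cutE// th1; case: ifPn => // axb.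
have [->//|xa] := eqVneq x a; have [->//|xb] := eqVneq x b.
by case: nab; move: ua ub uxv axb xa xb; split; lra.
Qed.

End PiecewiseElements.

(** * Dyadic intervals and linearity *)

Section Addresses.
Variable R : realType.
Local Notation F := (thompson R).
Implicit Types (f g h : F) (x y a t : R) (b : bool) (u v w : address).

(** The affine parametrisation of the dyadic interval of [u] by [[0, 1]]. *)
Definition phi u t : R := left_end R u + width R u * t.

Lemma left_end_cons b u : left_end R (b :: u) = (b%:R + left_end R u) / 2.
Proof.
rewrite /left_end /= big_ord_recl /= expr1 mulrDl; congr (_ + _).
by rewrite mulr_suml; apply: eq_bigr => i _ /=; rewrite exprSr invfM mulrA.
Qed.

Lemma width_cons b u : width R (b :: u) = width R u / 2.
Proof. by rewrite /width /= exprSr invfM. Qed.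

Lemma phi_nil t : phi [::] t = t.
Proof. by rewrite /phi /left_end big_ord0 /width expr0 invr1 mul1r add0r. Qed.

Lemma phi_cons b u t : phi (b :: u) t = (b%:R + phi u t) / 2.
Proof. rewrite /phi left_end_cons width_cons; ring. Qed.

Lemma phi_cat u v t : phi (u ++ v) t = phi u (phi v t).
Proof. by elim: u t => [|b u IH] t; rewrite ?phi_nil//= !phi_cons IH. Qed.

Lemma phi_rcons u b t : phi (rcons u b) t = phi u ((b%:R + t) / 2).
Proof. by rewrite -cats1 phi_cat phi_cons phi_nil. Qed.

Lemma width_gt0 u : 0 < width R u.
Proof. by rewrite /width invr_gt0 exprn_gt0. Qed.

Lemma phi_lt u : {mono phi u : x y / x < y}.
Proof. by move=> x y; rewrite /phi ltrD2l ltr_pM2l// width_gt0. Qed.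

Lemma phi_le u : {mono phi u : x y / x <= y}.
Proof. by move=> x y; rewrite /phi lerD2l ler_pM2l// width_gt0. Qed.

Lemma phi01 u t : 0 <= t <= 1 -> 0 <= phi u t <= 1.
Proof.
elim: u t => [|b u IH] t; rewrite ?phi_nil// => /IH.
by rewrite phi_cons; case: b => /=; lra.
Qed.

Lemma phi01s u t : 0 < t < 1 -> 0 < phi u t < 1.
Proof.
elim: u t => [|b u IH] t; rewrite ?phi_nil// => /IH.
by rewrite phi_cons; case: b => /=; lra.
Qed.

Lemma phi_ends u : [&& 0 <= phi u 0, phi u 0 < phi u 1 & phi u 1 <= 1].
Proof.
have := @phi01 u 0; have := @phi01 u 1; rewrite !lexx !ler01 phi_lt ltr01.
by move=> /(_ isT)/andP[_ ->] /(_ isT)/andP[-> _].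
Qed.

Lemma phi_uniq u v : phi u 0 = phi v 0 -> phi u 1 = phi v 1 -> u = v.
Proof.
elim: u v => [|b u IH] [|c v]//; rewrite ?phi_nil !phi_cons.
- by have := phi_ends v; case: c => /= *; exfalso; lra.
- by have := phi_ends u; case: b => /= *; exfalso; lra.
move=> e0 e1; have eb : b = c.
  have := phi_ends u; have := phi_ends v.
  by case: b c e0 e1 => [] []//= *; exfalso; lra.
by rewrite eb (IH v)//; rewrite eb in e0 e1; lra.
Qed.

(** The middle of the interval of [u] has exact denominator
    [2 ^ (size u).+1], so that it determines the depth and then the address. *)
Lemma phi_mid u v : phi u (1 / 2) = phi v (1 / 2) -> u = v.
Proof.
have half : 0 < (1 / 2 : R) < 1 by lra.
elim: u v => [|b u IH] [|c v]//.
- rewrite !phi_nil !phi_cons; have := @phi01s v _ half.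
  by case: c => /= *; exfalso; lra.
- rewrite !phi_nil !phi_cons; have := @phi01s u _ half.
  by case: b => /= *; exfalso; lra.
rewrite !phi_cons => e0; have eb : b = c.
  have := @phi01s u _ half; have := @phi01s v _ half.
  by case: b c e0 => [] []//= *; exfalso; lra.
by rewrite eb (IH v)//; rewrite eb in e0; lra.
Qed.

Lemma dyadic_interval_phi u x :
  @dyadic_interval R u x <-> exists2 t, 0 <= t <= 1 & x = phi u t.
Proof.
have w0 := width_gt0 u.
rewrite /dyadic_interval /= in_itv /=; split=> [/andP[ux xu]|[t /andP[t0 t1] ->]].
  exists ((x - left_end R u) / width R u).
    rewrite divr_ge0 ?subr_ge0 ?(ltW w0)//=.
    by rewrite ler_pdivrMr// mul1r lerBlDl.
  by rewrite /phi; field; exact: lt0r_neq0.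
by rewrite /phi lerDl mulr_ge0 ?(ltW w0)//= lerD2l ger_pMr.
Qed.

Definition linear_on f u v := forall t, 0 <= t <= 1 -> f (phi u t) = phi v t.

Lemma linear_onP f u v : maps_linearly f u v <-> linear_on f u v.
Proof.
have wN : width R u != 0 by rewrite lt0r_neq0 ?width_gt0.
split=> [fl t t01|fl x /dyadic_interval_phi[t t01 ->]].
  rewrite fl; first by rewrite /phi; field.
  by apply/dyadic_interval_phi; exists t.
by rewrite fl// /phi; field.
Qed.

Lemma linear_cat f u v w : linear_on f u v -> linear_on f (u ++ w) (v ++ w).
Proof. by move=> fl t t01; rewrite !phi_cat fl//; exact: phi01. Qed.

Lemma linear_rcons f u v b :
  linear_on f u v -> linear_on f (rcons u b) (rcons v b).
Proof. by rewrite -!cats1; exact: linear_cat. Qed.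

Lemma linear_fun f u v v' : linear_on f u v -> linear_on f u v' -> v = v'.
Proof. by move=> fv fv'; apply: phi_uniq; rewrite -fv ?fv' ?lexx ?ler01. Qed.

Lemma linear_inv f u v : linear_on f u v -> linear_on f^-1%g v u.
Proof. by move=> fl t t01; rewrite -fl// thK. Qed.

Lemma linear_invP f u v : linear_on f^-1%g v u -> linear_on f u v.
Proof. by move=> /linear_inv; rewrite invgK. Qed.

Lemma linear_comp f g u v w :
  linear_on g u v -> linear_on f v w -> linear_on (f * g)%g u w.
Proof. by move=> gl fl t t01; rewrite thM gl// fl. Qed.

Lemma linear1 u : linear_on 1%g u u.
Proof. by []. Qed.

Lemma phi_half t : 0 <= t <= 1 ->
  exists b t', 0 <= t' <= 1 /\ t = (b%:R + t') / 2.
Proof.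
move=> t01; have [t2|t2] := leP t (1 / 2).
  by exists false, (2 * t); split; [lra|rewrite /=; lra].
by exists true, (2 * t - 1); split; [lra|rewrite /=; lra].
Qed.

Lemma linear_join f u v : (forall b, linear_on f (rcons u b) (rcons v b)) ->
  linear_on f u v.
Proof.
move=> fl t t01; have [b [t' [t01' ->]]] := phi_half t01.
by rewrite -!phi_rcons fl.
Qed.

Lemma phi_int u : exists A : nat, phi u 0 = A%:R / 2 ^+ size u.
Proof.
elim: u => [|b u [A IH]]; first by exists 0%N; rewrite phi_nil mul0r.
exists (b * 2 ^ size u + A)%N; rewrite phi_cons IH natrD natrM natrX /= exprS.
by field; rewrite expf_neq0.
Qed.

Lemma phi_width u : phi u 1 = phi u 0 + 2 ^- size u.
Proof. by rewrite /phi /width; ring. Qed.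

Lemma address_of k (L : nat) : (L < 2 ^ k)%N ->
  exists2 v, size v = k & phi v 0 = L%:R / 2 ^+ k.
Proof.
elim: k L => [|k IH] L Lk.
  by exists [::] => //; rewrite phi_nil; case: L Lk => // _; rewrite mul0r.
have [|v vs vE] := IH L./2; first by rewrite ltn_half_double -mul2n -expnS.
exists (rcons v (odd L)); first by rewrite size_rcons vs.
rewrite phi_rcons {1}/phi addr0.
have -> : left_end R v = L./2%:R / 2 ^+ k by rewrite -vE /phi mulr0 addr0.
rewrite /width vs -[in RHS](odd_double_half L) natrD -mul2n natrM exprS.
by field; rewrite expf_neq0.
Qed.

Lemma dyadic_phi u (i : nat) : dyadic (phi u i%:R).
Proof.
have [A AE] := phi_int u.
rewrite (_ : phi u i%:R = phi u 0 + i%:R / 2 ^+ size u); last by rewrite /phi /width; ring.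
rewrite AE; apply: dyadicD; first by exists A%:Z, (size u).
by exists i%:Z, (size u).
Qed.

Lemma dyadic_den (p : R) : dyadic p -> exists N : nat, forall k, (N <= k)%N ->
  exists m : int, p = m%:~R / 2 ^+ k.
Proof.
move=> [m [N ->]]; exists N => k Nk; exists (m * 2 ^+ (k - N)).
rewrite intrM rmorphXn /= -{2}(subnKC Nk) exprD.
by field; rewrite !expf_neq0.
Qed.

(** A dyadic point of denominator [2 ^ N] is not in the interior of a dyadic
    interval of depth at least [N]. *)
Lemma deep_avoid (s : seq R) : (forall p, p \in s -> dyadic p) ->
  exists N, forall u, (N <= size u)%N ->
    forall p, p \in s -> ~~ (phi u 0 < p < phi u 1).
Proof.
elim: s => [|p s IH] sD; first by exists 0%N.
have [|N1 N1P] := IH; first by move=> q qs; apply: sD; rewrite inE qs orbT.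
have [N2 N2P] := dyadic_den (sD p (mem_head _ _)).
exists (maxn N1 N2) => u; rewrite geq_max => /andP[uN1 uN2] q.
rewrite inE => /orP[/eqP->|]; last exact: N1P.
have [m ->] := N2P _ uN2; have [A AE] := phi_int u.
rewrite phi_width AE -[X in _ + X]mul1r -mulrDl.
have e0 : (0 : R) < 2 ^- size u by rewrite invr_gt0 exprn_gt0.
rewrite !(ltr_pM2r e0) -[A%:R]/(A%:Z%:~R) -(intrD _ A%:Z 1) !ltr_int.
by lia.
Qed.

(** Between two breakpoints an element has a slope [2 ^ e]; once the width
    [2 ^- size u] is small compared with the denominators of the breakpoint on
    the left and of its image, the image of the interval is aligned as a dyadic
    interval of depth [size u - e]. *)
Lemma deep_linear f : exists N, forall u, (N <= size u)%N ->
  exists v, linear_on f u v.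
Proof.
have [_ _ [s [sD saff]] _] := thompsonP f.
have sD' p : p \in s -> dyadic p by move=> /sD[].
have [N0 N0P] := deep_avoid sD'.
have one m : dyadic m -> 0 <= m -> exists N, forall u, (N <= size u)%N -> m <= phi u 0 ->
    (forall p, p \in s -> ~~ (m < p < phi u 1)) -> exists v, linear_on f u v.
  move=> mD m0; have [Nm NmP] := dyadic_den mD.
  have [Nf NfP] := dyadic_den (th_dyadic f mD).
  pose e := rslope m f.
  exists (maxn Nm (Nf + `|e|)) => u.
  rewrite geq_max => /andP[uNm uNf] mu mP.
  have u1 : phi u 1 <= 1 by have := @phi01 u 1; rewrite ler01 lexx => /(_ isT)/andP[].
  have u01 : phi u 0 < phi u 1 by rewrite phi_lt.
  have mu1 : m < phi u 1 by exact: le_lt_trans mu u01.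
  have [//|k fE] := saff m (phi u 1) m0 (ltW mu1) u1.
  have ke : e = k := rslope_unique mu1 fE.
  have {ke}fE x : m <= x <= phi u 1 -> f x = f m + 2 ^ e * (x - m) by rewrite ke; exact: fE.
  pose n := `|(size u)%:Z - e|%N.
  have nE : n%:Z = (size u)%:Z - e by rewrite /n gez0_abs; lia.
  have [M ME] := NmP _ uNm.
  have [M' M'E] : exists M', f m = M'%:~R / 2 ^+ n by apply: NfP; lia.
  have [A AE] := phi_int u.
  have eE : (2 : R) ^ e = 2 ^+ size u / 2 ^+ n.
    by rewrite exprnN exprnP -expfzDr ?pnatr_eq0//; congr (_ ^ _); lia.
  have n0 : (2 : R) ^+ n != 0 by rewrite expf_neq0.
  have u0 : (2 : R) ^+ size u != 0 by rewrite expf_neq0.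
  have fu0 : f (phi u 0) = (M' + A%:Z - M)%:~R / 2 ^+ n.
    rewrite fE ?mu ?ltW// M'E eE ME AE !rmorphB/= rmorphD /=; field; exact/andP.
  have fut t : 0 <= t <= 1 -> f (phi u t) = f (phi u 0) + t / 2 ^+ n.
    move=> t01.
    have ut0 : phi u 0 <= phi u t <= phi u 1 by rewrite !phi_le.
    case/andP: ut0 => ut ut1.
    rewrite (fE (phi u t)) ?ut1 ?(le_trans mu)// (fE (phi u 0)) ?mu ?(ltW u01)//.
    by rewrite /phi /width eE; field; exact/andP.
  have fu01 : 0 <= f (phi u 0) <= 1 by apply/th_in/phi01; rewrite lexx ler01.
  have fu1 : 0 <= f (phi u 1) <= 1 by apply/th_in/phi01; rewrite lexx ler01.
  have n0' : (0 : R) < 2 ^- n by rewrite invr_gt0 exprn_gt0.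
  have L0 : 0 <= M' + A%:Z - M.
    by move: fu01; rewrite fu0 => /andP[+ _]; rewrite pmulr_lge0// ler0z.
  have L1 : M' + A%:Z - M + 1 <= 2 ^+ n.
    move: fu1; rewrite fut ?lexx ?ler01// fu0 -mulrDl => /andP[_].
    rewrite ler_pdivrMr ?exprn_gt0// mul1r.
    by rewrite -(intrD _ _ 1) -[2 ^+ n]/((2%:Z)%:~R ^+ n) -rmorphXn ler_int.
  have [l lE] : exists l : nat, M' + A%:Z - M = l%:Z.
    by exists (absz (M' + A%:Z - M)%R); rewrite gez0_abs.
  have [|v vs vE] := @address_of n l.
    by move: L1; rewrite lE -natrX natz -[_ + 1]/(Posz (l + 1)) lez_nat addn1.
  exists v => t t01; rewrite fut// {2}/phi /width vs fu0 lE.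
  by rewrite -[l%:Z%:~R]/(l%:R) -vE /phi mulr0 addr0 mulrC.
have [N1 N1P] : exists N, forall m, m \in 0 :: s -> forall u, (N <= size u)%N ->
    m <= phi u 0 -> (forall p, p \in s -> ~~ (m < p < phi u 1)) ->
    exists v, linear_on f u v.
  have : forall m, m \in 0 :: s -> dyadic m /\ 0 <= m.
    move=> m; rewrite inE => /orP[/eqP->|/sD[mD /andP[m0 _]]]; split=> //.
      exact: dyadic0.
    exact: ltW.
  elim: (0 :: s) => [|m t IH] tP; first by exists 0%N.
  have [|N1 N1P] := IH; first by move=> q qt; apply: tP; rewrite inE qt orbT.
  have [mD m0] := tP m (mem_head _ _).
  have [N2 N2P] := one m mD m0; exists (maxn N1 N2) => q.
  rewrite inE => /orP[/eqP-> u|qt u]; rewrite geq_max => /andP[]; first by move=> _; exact: N2P.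
  by move=> + _; exact: N1P.
exists (maxn N0 N1) => u; rewrite geq_max => /andP[uN0 uN1].
have /and3P[u0 u01 _] := phi_ends u.
have [m [/andP[_ mu1] ms mP]] := prev_mark s (le_lt_trans u0 u01).
have mu0 : m <= phi u 0.
  case: ms => [->//|ms]; have := N0P u uN0 m ms.
  by rewrite mu1 andbT -leNgt.
by apply: (N1P m _ u uN1 mu0 mP); rewrite inE; case: ms => ->; rewrite ?eqxx ?orbT.
Qed.

End Addresses.

(** * Trees and reduced diagrams *)

Section Trees.
Implicit Types (t l r : tree) (u v w : address) (b : bool).

Lemma cons_injb b : injective (cons b : address -> address).
Proof. by move=> x y []. Qed.

Lemma map_cons_mem b c u (s : seq address) :
  (b :: u \in map (cons c) s) = (b == c) && (u \in s).
Proof.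
have [->|bc] /= := eqVneq b c; first exact: mem_map (@cons_injb c) _ _.
by apply/mapP => -[v _ [e _]]; rewrite e eqxx in bc.
Qed.

Lemma leaf_cons b u l r :
  (b :: u \in leaves (Node l r)) = (u \in leaves (if b then r else l)).
Proof. by rewrite mem_cat !map_cons_mem; case: b => /=; rewrite ?orbF. Qed.

Lemma leaf_nil l r : ([::] \in leaves (Node l r)) = false.
Proof. by rewrite mem_cat; apply/negP => /orP[]/mapP[]. Qed.

Lemma inner_cons b u l r :
  (b :: u \in inner_nodes (Node l r)) = (u \in inner_nodes (if b then r else l)).
Proof.
by rewrite [inner_nodes _]/= inE mem_cat !map_cons_mem; case: b => /=; rewrite ?orbF.
Qed.

Lemma inner_nil l r : [::] \in inner_nodes (Node l r).
Proof. by rewrite /= inE. Qed.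

Lemma nodes_cons b u l r :
  (b :: u \in nodes (Node l r)) = (u \in nodes (if b then r else l)).
Proof. by rewrite /nodes mem_cat [RHS]mem_cat inner_cons leaf_cons. Qed.

Lemma leaf_cat_inner t v w : v \in leaves t -> v ++ w \notin inner_nodes t.
Proof.
elim: t v => [//|l IHl r IHr] [|b v]; first by rewrite leaf_nil.
by rewrite leaf_cons inner_cons; case: b; [exact: IHr|exact: IHl].
Qed.

Lemma not_inner_leaf t u : u \notin inner_nodes t ->
  exists v w, v \in leaves t /\ u = v ++ w.
Proof.
elim: t u => [|l IHl r IHr] u; first by exists [::], u.
case: u => [|b u]; first by rewrite inner_nil.
rewrite inner_cons => uN.
have [v [w [vl ->]]] : exists v w, v \in leaves (if b then r else l) /\ u = v ++ w.
  by case: b uN; [exact: IHr|exact: IHl].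
by exists (b :: v), w; rewrite leaf_cons.
Qed.

Lemma node_parent t u b : rcons u b \in nodes t -> u \in inner_nodes t.
Proof.
elim: t u => [u|l IHl r IHr [|c u]]; first by rewrite /nodes inE; case: u.
  by rewrite inner_nil.
rewrite rcons_cons nodes_cons inner_cons.
by case: c; [exact: IHr|exact: IHl].
Qed.

Lemma leaf_node t u : u \in leaves t -> u \in nodes t.
Proof. by rewrite mem_cat orbC => ->. Qed.

Lemma inner_node t u : u \in inner_nodes t -> u \in nodes t.
Proof. by rewrite mem_cat => ->. Qed.

Lemma leafP t u : u \in leaves t <-> u \notin inner_nodes t /\
  forall v b, u = rcons v b -> v \in inner_nodes t.
Proof.
split=> [ul|[uN uP]].
  split; first by rewrite -[u]cats0 leaf_cat_inner.
  by move=> v b e; apply: (@node_parent _ _ b); rewrite -e leaf_node.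
have [v [w [vl e]]] := not_inner_leaf uN.
case/lastP: w e => [|w b] e; first by rewrite e cats0.
have := uP (v ++ w) b; rewrite e -rcons_cat => /(_ erefl).
by rewrite (negbTE (leaf_cat_inner _ vl)).
Qed.

Lemma uniq_leaves t : uniq (leaves t).
Proof.
elim: t => //= l IHl r IHr; rewrite cat_uniq.
rewrite !map_inj_uniq ?IHl ?IHr; try exact: cons_injb.
rewrite andbT /=; apply/hasPn => _ /mapP[u _ ->].
by rewrite map_cons_mem.
Qed.

Lemma index_leaf0 u l r : u \in leaves l ->
  index (false :: u) (leaves (Node l r)) = index u (leaves l).
Proof.
move=> ul; rewrite /= index_cat map_cons_mem eqxx ul /=.
by rewrite index_map//; exact: cons_injb.
Qed.

Lemma index_leaf1 u l r :
  index (true :: u) (leaves (Node l r)) = (size (leaves l) + index u (leaves r))%N.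
Proof.
rewrite /= index_cat map_cons_mem /= size_map.
by rewrite index_map//; exact: cons_injb.
Qed.

Lemma index_siblings t u : rcons u false \in leaves t -> rcons u true \in leaves t ->
  index (rcons u true) (leaves t) = (index (rcons u false) (leaves t)).+1.
Proof.
elim: t u => [u|l IHl r IHr [|b u]]; first by rewrite inE; case: u.
  rewrite !leaf_cons.
  case: l IHl => [_|l1 l2 _]; last by rewrite leaf_nil.
  by case: r IHr => [|r1 r2 ?]; rewrite ?leaf_nil.
rewrite !rcons_cons !leaf_cons; case: b => u0 u1; first by rewrite !index_leaf1 IHr// addnS.
by rewrite !index_leaf0// IHl.
Qed.

(** The tree whose inner nodes are the addresses of depth less than [k] below [u]
    all of whose prefixes from [u] on satisfy [P]. *)
Definition tree_of (P : pred address) :=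
  fix build k u := if k is k'.+1 then
    if P u then Node (build k' (rcons u false)) (build k' (rcons u true)) else Leaf
  else Leaf.

Lemma inner_tree_of P k u v : v \in inner_nodes (tree_of P k u) -> P (u ++ v).
Proof.
elim: k u v => //= k IH u v; case: ifPn => // Pu.
case: v => [|b v]; first by rewrite cats0.
by rewrite inner_cons -cat_rcons; case: b; exact: IH.
Qed.

Lemma leaf_tree_of P k u v : (forall w, (k <= size w)%N -> ~~ P (u ++ w)) ->
  v \in leaves (tree_of P k u) -> ~~ P (u ++ v).
Proof.
elim: k u v => [|k IH] u v Pk; first by move=> _; exact: Pk.
rewrite /=; case: ifPn => Pu; last by rewrite inE => /eqP->; rewrite cats0.
case: v => [|b v]; first by rewrite leaf_nil.
rewrite leaf_cons -cat_rcons; case: b => vl; apply: IH vl => w kw.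
  by rewrite cat_rcons Pk.
by rewrite cat_rcons Pk.
Qed.

End Trees.

Section ReducedDiagrams.
Variable R : realType.
Local Notation F := (thompson R).
Implicit Types (f g h : F) (H : set F) (u v w : address) (b : bool) (d : tree_pair).

Definition nonlinear f u := ~~ `[< exists v, linear_on f u v >].

Lemma nonlinear_cat f u w : nonlinear f (u ++ w) -> nonlinear f u.
Proof.
by apply: contra => /asboolP[v fv]; apply/asboolP; exists (v ++ w); exact: linear_cat.
Qed.

(** Linearity passes to subintervals, so that the addresses on which an element
    is not linear are closed under prefixes; their depth is bounded. *)
Lemma minimal_tree f : exists t, forall u, (u \in inner_nodes t) = nonlinear f u.
Proof.
have [N NP] := deep_linear f.
exists (tree_of (nonlinear f) N [::]) => u.
apply/idP/idP; first exact: inner_tree_of.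
apply: contraLR => /not_inner_leaf[v [w [vl ->]]].
have : ~~ nonlinear f v.
  apply: leaf_tree_of vl => x Nx /=; rewrite negbK; apply/asboolP; exact: NP.
by apply: contra; exact: nonlinear_cat.
Qed.

Lemma sorted_leaves t : sorted (fun u v => phi u (0 : R) < phi v (0 : R)) (leaves t).
Proof.
elim: t => //= l IHl r IHr.
have tr : transitive (fun u v => phi u (0 : R) < phi v (0 : R)) by move=> ? ? ?; exact: lt_trans.
rewrite sorted_pairwise// pairwise_cat -!sorted_pairwise//.
have sm b t : sorted (fun u v => phi u (0 : R) < phi v (0 : R)) (leaves t) ->
    sorted (fun u v => phi u (0 : R) < phi v (0 : R)) (map (cons b) (leaves t)).
  rewrite sorted_map; apply: sub_sorted => u v /=; rewrite !phi_cons; lra.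
rewrite !sm// !andbT; apply/allrelP => _ _ /mapP[u _ ->] /mapP[v _ ->].
rewrite !phi_cons /=; have := phi_ends R u; have := phi_ends R v; lra.
Qed.

(** Consider the maximal dyadic intervals that an element maps linearly onto dyadic
    intervals. Their images are the maximal such intervals for the inverse, in the
    same order. Hence the leaves of the minimal trees of an element and of its
    inverse correspond, and two sibling leaves never have sibling images, by
    maximality. *)
Lemma reduced_diagram_exists f : exists d, reduced_diagram f d.
Proof.
have [tp tpE] := minimal_tree f; have [tm tmE] := minimal_tree f^-1%g.
have linP g t : (forall u, (u \in inner_nodes t) = nonlinear g u) ->
    forall u, u \notin inner_nodes t <-> exists v, linear_on g u v.
  by move=> tE u; rewrite tE negbK; split=> /asboolP.
have img g t t' : (forall u, (u \in inner_nodes t) = nonlinear g u) ->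
    (forall u, (u \in inner_nodes t') = nonlinear g^-1%g u) ->
    forall u v, linear_on g u v -> u \in leaves t -> v \in leaves t'.
  move=> tE t'E u v guv /leafP[uN uP]; apply/leafP; split.
    by apply/(linP _ _ t'E); exists u; exact: linear_inv.
  move=> v' b e; apply: contrapT => /negP/(linP _ _ t'E)[u' /[dup] gv'] /linear_invP gu'.
  have eu : u = rcons u' b.
    by apply: linear_fun (linear_rcons b gv'); rewrite -e; exact: linear_inv.
  have := uP u' b eu; apply/negP/(linP _ _ tE).
  by exists v'.
have ex u : u \in leaves tp -> exists v, linear_on f u v.
  by move=> /leafP[/(linP _ _ tpE)].
pose im u := if pselect (exists v, linear_on f u v) is left e then projT1 (cid e) else [::].
have imP u : u \in leaves tp -> linear_on f u (im u).
  by rewrite /im; case: pselect => [e _|ne /ex//]; exact: projT2 (cid e).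
have lE : leaves tm = map im (leaves tp).
  apply: (@irr_sorted_eq _ (fun u v => phi u (0 : R) < phi v (0 : R))).
  - by move=> ? ? ?; exact: lt_trans.
  - by move=> ?; exact: ltxx.
  - exact: sorted_leaves.
  - rewrite sorted_map.
    apply: (sub_in_sorted (P := mem (leaves tp))) (sorted_leaves tp); last exact/allP.
    by move=> u v ul vl /=; rewrite -!imP ?lexx ?ler01// th_lt.
  - move=> v; apply/idP/mapP => [vl|[u ul ->]]; last exact: img (imP u ul) ul.
    have [u fvu] : exists u, linear_on f^-1%g v u by case/leafP: vl => /(linP _ _ tmE).
    have ul : u \in leaves tp.
      by apply: (img f^-1%g tm tp) fvu vl => // w; rewrite invgK.
    by exists u => //; apply: linear_fun (linear_invP fvu) (imP u ul).
exists (tp, tm); split=> /= [|i ip|i ip [[u [u0 u1]] [v [v0 v1]]]].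
- by rewrite lE size_map.
- apply/linear_onP; rewrite lE (nth_map [::])//; apply: imP.
  exact: mem_nth.
- have ip' : (i < size (leaves tp))%N by exact: ltnW.
  have := imP _ (mem_nth [::] ip'); have := imP _ (mem_nth [::] ip).
  rewrite -!(nth_map _ [::])// -lE u0 u1 v0 v1 => f1 f0.
  have : u \in inner_nodes tp.
    by apply: (@node_parent _ _ false); rewrite leaf_node// -u0 mem_nth.
  apply/negP/(linP _ _ tpE); exists v; by apply: linear_join => -[].
Qed.

End ReducedDiagrams.

Section ReducedFacts.
Variable R : realType.
Local Notation F := (thompson R).
Implicit Types (f g h : F) (H : set F) (u v w : address) (b : bool) (d : tree_pair).

Lemma reduced_leaf f d u : reduced_diagram f d -> u \in leaves d.1 ->
  linear_on f u (nth [::] (leaves d.2) (index u (leaves d.1))).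
Proof.
move=> [_ fd _] ul; have ui : (index u (leaves d.1) < size (leaves d.1))%N.
  by rewrite index_mem.
by have /linear_onP := fd _ ui; rewrite nth_index.
Qed.

Lemma reduced_inv f d : reduced_diagram f d -> reduced_diagram f^-1%g (d.2, d.1).
Proof.
move=> [sd fd nd]; split=> //= [i|i]; rewrite -sd => id.
  by apply/linear_onP/linear_inv/linear_onP/fd.
by move=> [? ?]; apply: (nd i id).
Qed.

Lemma reduced_linear f d u v : reduced_diagram f d -> u \notin inner_nodes d.1 ->
  linear_on f u v -> exists u' w, [/\ u' \in leaves d.1, u = u' ++ w
    & v = nth [::] (leaves d.2) (index u' (leaves d.1)) ++ w].
Proof.
move=> fd /not_inner_leaf[u' [w [u'l ->]]] fuv.
exists u', w; split=> //; apply: (linear_fun fuv).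
by apply: linear_cat; exact: reduced_leaf.
Qed.

(** A deepest inner node on which the map is linear would carry two sibling leaves
    that are mapped to sibling leaves. *)
Lemma reduced_inner f d u : reduced_diagram f d ->
  (u \in inner_nodes d.1) = nonlinear f u.
Proof.
move=> fd; apply/idP/idP; last first.
  apply: contraLR => /not_inner_leaf[u' [w [u'l ->]]]; rewrite negbK.
  apply/asboolP; eexists; apply: linear_cat; exact: (reduced_leaf fd u'l).
pose B := \max_(x <- inner_nodes d.1) size x.
have [n] := ubnP (B - size u)%N; elim: n u => // n IH u un ud.
have uB : (size u <= B)%N by apply: (@leq_bigmax_seq _ _ xpredT).
apply/negP => /asboolP[v fuv].
have child b : rcons u b \in leaves d.1.
  have := child_node b ud; rewrite mem_cat => /orP[ub|//].
  have bB : (size (rcons u b) <= B)%N by apply: (@leq_bigmax_seq _ _ xpredT).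
  rewrite size_rcons in bB.
  have : nonlinear f (rcons u b) by apply: IH => //; rewrite size_rcons; lia.
  by move=> /negP; case; apply/asboolP; exists (rcons v b); exact: linear_rcons.
have leafE b := linear_fun (reduced_leaf fd (child b)) (linear_rcons b fuv).
have := index_siblings (child false) (child true) => sib.
have [_ _ /(_ (index (rcons u false) (leaves d.1)))] := fd; apply.
  by rewrite -sib index_mem.
split; first by exists u; rewrite -sib !nth_index.
by exists v; rewrite -sib !leafE.
Qed.

(** The same notion as [piecewise], in terms of successive bisections of one
    interval, which suits inductions along trees. *)
Inductive pieces H f : address -> Prop :=
| pieces_one u h : H h -> (forall t, 0 <= t <= 1 -> f (phi u t) = h (phi u t)) ->
    pieces H f u
| pieces_node u : (forall b, pieces H f (rcons u b)) -> pieces H f u.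

Lemma piecewise_pieces H f u : piecewise H f -> pieces H f u.
Proof.
move=> [s [sD fH]]; have [N NP] := deep_avoid sD.
have [n] := ubnP (N - size u)%N; elim: n u => // n IH u un.
have [Nu|uN] := leqP N (size u).
  have /andP[_ /andP[/ltW u01 _]] := phi_ends R u.
  have [h Hh fh] := fH _ _ u01 (NP u Nu).
  by apply: (pieces_one Hh) => t t01; apply: fh; rewrite !phi_le.
by apply: pieces_node => b; apply: IH; rewrite size_rcons; lia.
Qed.

Lemma pieces_piecewise H f : subgroup H -> pieces H f [::] -> piecewise H f.
Proof.
move=> gH fp.
have {fp}[s [sD fH]] : exists s : seq R, (forall p, p \in s -> dyadic p) /\
  forall x y, phi [::] 0 <= x -> x <= y -> y <= phi [::] 1 ->
    (forall p, p \in s -> ~~ (x < p < y)) ->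
    exists2 h, H h & forall z, x <= z <= y -> f z = h z.
  elim: fp => {}u.
    move=> h Hh fh; exists [::]; split=> // x y ux xy yu _; exists h => // z /andP[xz zy].
    have [t t01 ->] : exists2 t, 0 <= t <= 1 & z = phi u t.
      apply/dyadic_interval_phi; rewrite /dyadic_interval /= in_itv /=.
      by move: ux yu; rewrite /phi; lra.
    exact: fh.
  move=> _ IH; have [s0 [s0D s0H]] := IH false; have [s1 [s1D s1H]] := IH true.
  pose m : R := phi u (1 / 2).
  have E00 : phi (rcons u false) 0 = phi u 0 :> R by rewrite phi_rcons addr0 mul0r.
  have E01 : phi (rcons u false) 1 = m by rewrite phi_rcons add0r.
  have E10 : phi (rcons u true) 0 = m by rewrite phi_rcons addr0.
  have E11 : phi (rcons u true) 1 = phi u 1 :> R.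
    by rewrite phi_rcons; congr phi; rewrite /=; field.
  exists (m :: s0 ++ s1); split=> [p|x y ux xy yu xyP].
    rewrite inE mem_cat => /orP[/eqP->|/orP[/s0D//|/s1D//]].
    by rewrite -E10; exact: (dyadic_phi R _ 0).
  have [ym|my] := leP y m.
    apply: s0H; rewrite ?E00 ?E01// => p ps; apply: xyP.
    by rewrite inE mem_cat ps orbT.
  have [mx|xm] := leP m x.
    apply: s1H; rewrite ?E10 ?E11// => p ps; apply: xyP.
    by rewrite inE mem_cat ps !orbT.
  by have := xyP m (mem_head _ _); rewrite xm my.
exists [:: 0, 1 & s]; split=> [p|a b ab abs].
  rewrite !inE => /or3P[/eqP->|/eqP->|/sD//]; [exact: dyadic0|exact: dyadic1].
have a0 := abs 0; rewrite !inE eqxx in a0; move/(_ isT) in a0.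
have a1 := abs 1; rewrite !inE eqxx orbT in a1; move/(_ isT) in a1.
have [[a0' b1']|nab] := pselect (0 <= a /\ b <= 1).
  apply: fH; rewrite ?phi_nil// => p ps; apply: abs.
  by rewrite !inE ps !orbT.
exists 1%g; first exact: subgroup1.
move=> x xab; have [->|x0] := eqVneq x 0; first by rewrite th_at0.
have [->|x1] := eqVneq x 1; first by rewrite th_at1.
by apply: th_out; apply/negP => x01; case: nab; move: a0 a1 xab x0 x1 x01; split; lra.
Qed.

Lemma pieces_tree H f u t : (forall v, v \in leaves t -> pieces H f (u ++ v)) ->
  pieces H f u.
Proof.
elim: t u => [|l IHl r IHr] u tP.
  by have := tP [::]; rewrite cats0 inE => /(_ isT).
by apply: pieces_node => -[]; [apply: IHr|apply: IHl] => v vl; rewrite cat_rcons;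
   apply: tP; rewrite leaf_cons.
Qed.

(** What the identification of two nodes in a core means for the action of [H]:
    after finitely many bisections, each part of the first interval is mapped
    linearly onto the corresponding part of the second by some element of [H]. *)
Inductive rel_addr H : address -> address -> Prop :=
| rel_one u v h : H h -> linear_on h u v -> rel_addr H u v
| rel_children u v : (forall b, rel_addr H (rcons u b) (rcons v b)) -> rel_addr H u v.

Lemma rel_rcons H u v b : rel_addr H u v -> rel_addr H (rcons u b) (rcons v b).
Proof.
case=> {u v} [u v h Hh huv|u v]; last exact.
exact: rel_one Hh (linear_rcons b huv).
Qed.

Lemma rel_refl H u : subgroup H -> rel_addr H u u.
Proof. by move=> gH; apply: rel_one (subgroup1 gH) _; exact: linear1. Qed.

Lemma rel_sym H u v : subgroup H -> rel_addr H u v -> rel_addr H v u.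
Proof.
move=> gH; elim=> {u v} [u v h Hh huv|u v _ IH]; last exact: rel_children.
exact: rel_one (subgroupV gH Hh) (linear_inv huv).
Qed.

Lemma rel_trans H u v w : subgroup H -> rel_addr H u v -> rel_addr H v w ->
  rel_addr H u w.
Proof.
move=> gH uv; elim: uv w => {u v} [u v h Hh huv|u v _ IH] w vw; last first.
  by apply: rel_children => b; apply: IH; exact: rel_rcons.
elim: vw u huv => {v w} [v w k Hk kvw|v w _ IH] u huv.
  exact: rel_one (subgroupM gH Hk Hh) (linear_comp huv kvw).
by apply: rel_children => b; apply: IH; exact: linear_rcons.
Qed.

Lemma rel_pieces H f u v : rel_addr H u v -> linear_on f u v -> pieces H f u.
Proof.
elim=> {u v} [u v h Hh huv|u v _ IH] fuv.
  by apply: (pieces_one Hh) => t t01; rewrite fuv ?huv.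
by apply: pieces_node => b; apply: IH; exact: linear_rcons.
Qed.

End ReducedFacts.

(** * Accepted elements are piecewise in the subgroup *)

Section CoreToPieces.
Variables (R : realType) (H : set (thompson R)).
Hypothesis gH : subgroup H.
Local Notation F := (thompson R).
Implicit Types (f g h : F) (u v w : address) (b : bool) (d : tree_pair).

Local Notation D := (fun i : core_index H => pair_diagram (val i)).
Local Notation fold := (fold_edge (@root_glue _ D)).

(** A leaf edge belongs to both trees; it gets its address in the source tree. *)
Definition pre_addr d (e : pre_edge) : address :=
  match e with inl j => nth [::] (leaves d.1) j | inr (_, u) => u end.

Definition edge_addr (e : edge (sum_complex D)) : address :=
  if e is Some x then pre_addr (val (tag x)) (ssval (tagged x)) else [::].

Lemma rel_node_edge h d s u : H h -> reduced_diagram h d -> u \in nodes (side d s) ->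
  rel_addr H (pre_addr d (node_edge d s u)) u.
Proof.
move=> Hh hd un; rewrite /node_edge; case: ifPn => [ul|_]; last exact: rel_refl.
case: s un ul => /= un ul; first by rewrite nth_index//; exact: rel_refl.
have [sd _ _] := hd.
have il : (index u (leaves d.2) < size (leaves d.1))%N by rewrite sd index_mem.
apply: (rel_one Hh); have := reduced_leaf hd (mem_nth [::] il).
by rewrite index_uniq ?uniq_leaves// nth_index.
Qed.

Lemma core_indexP (i : core_index H) : exists2 h, H h & reduced_diagram h (val i).
Proof. exact/asboolP/(valP i). Qed.

Lemma rel_edge_of_node (i : core_index H) s u (un : u \in nodes (side (val i) s)) :
  rel_addr H (edge_addr (Some (Tagged (fun i => edge (D i)) (edge_of_node un : edge (D i))))) u.
Proof. by have [h Hh hd] := core_indexP i; exact: rel_node_edge Hh hd un. Qed.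

Lemma rel_via u u' v v' : rel_addr H u u' -> rel_addr H v v' ->
  rel_addr H u' v' -> rel_addr H u v.
Proof.
move=> uu' vv' u'v'; apply: rel_trans gH uu' (rel_trans gH u'v' _).
exact: rel_sym gH vv'.
Qed.

(** Bisecting both intervals, and joining the two halves, preserve [rel_addr]:
    these are the two kinds of foldings. A leaf of a diagram of [h] in [H] has two
    addresses, which [h] relates. *)
Lemma fold_rel e e' : fold e e' -> rel_addr H (edge_addr e) (edge_addr e').
Proof.
have nodeV (i : core_index H) s u (un : u \in nodes (side (val i) s)) :=
  rel_sym gH (rel_edge_of_node un).
elim=> {e e'}.
- by move=> e e' [] i; exact: nodeV.
- by move=> e; exact: rel_refl.
- by move=> e e' _; exact: rel_sym gH.
- by move=> e e' e'' _ + _; exact: rel_trans gH.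
- move=> c c' _ IH; apply: (rel_via (rel_edge_of_node _) (rel_edge_of_node _)).
  by apply: rel_rcons; apply: (rel_via (nodeV _ _ _ _) (nodeV _ _ _ _) IH).
- move=> c c' _ IH; apply: (rel_via (rel_edge_of_node _) (rel_edge_of_node _)).
  by apply: rel_rcons; apply: (rel_via (nodeV _ _ _ _) (nodeV _ _ _ _) IH).
- move=> c c' _ IH0 _ IH1.
  apply: (rel_via (rel_edge_of_node _) (rel_edge_of_node _)).
  apply: rel_children => -[].
    exact: (rel_via (nodeV _ _ _ _) (nodeV _ _ _ _) IH1).
  exact: (rel_via (nodeV _ _ _ _) (nodeV _ _ _ _) IH0).
Qed.

Local Open Scope quotient_scope.

Lemma folded_edgeP (e e' : edge (sum_complex D)) :
  folded_edge (@root_glue _ D) e = folded_edge (@root_glue _ D) e' <-> fold e e'.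
Proof.
split=> [/eqmodP/asboolP//|ee']; exact/eqmodP/asboolP.
Qed.

Lemma folded_edge_repr (e : edge (core H)) : folded_edge (@root_glue _ D) (repr e) = e.
Proof. exact: reprK. Qed.

Lemma fold_repr (e : edge (sum_complex D)) :
  fold e (repr (folded_edge (@root_glue _ D) e)).
Proof. by apply/folded_edgeP; rewrite folded_edge_repr. Qed.

(** Going down the trees of an accepted diagram, each node is sent to the class of
    an edge whose address is related to the node. A leaf of both trees thus
    relates its two addresses, and since the element is linear there, it agrees
    piece by piece with elements of [H]. *)
Lemma closure_sub_piecewise : thompson_closure H `<=` piecewise H.
Proof.
move=> f [d fd [fv [fe [fc [[_ _ ft fl fr] ftop fbot]]]]].
apply: pieces_piecewise => //.
have RT := rel_trans gH; have RS := rel_sym gH.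
have nodeP u s (un : u \in nodes (side d s)) :
    exists2 e, fe (edge_of_node un) = folded_edge (@root_glue _ D) e & rel_addr H u (edge_addr e).
  elim/last_ind: u un => [|u b IH] un.
    exists None; last exact: rel_refl.
    case: s un => un; first by rewrite -[RHS]ftop; congr fe; exact: val_inj.
    by rewrite -[RHS]fbot; congr fe; exact: val_inj.
  have ui := node_parent un.
  have [e te ue] := IH (inner_node ui).
  pose c : cell (pair_complex d) := Tagged (fun s => seq_sub (inner_nodes (side d s))) (SeqSub ui).
  pose C := repr (fc c).
  have topE : fold e (top C).
    apply/folded_edgeP; rewrite -te.
    by apply: (etrans _ (esym (ft c))); congr fe; exact: val_inj.
  have relC : rel_addr H u (cell_node (tagged C)).
    exact: (RT _ _ _ (RT _ _ _ ue (fold_rel topE)) (rel_edge_of_node _)).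
  exists (if b then rbot C else lbot C).
    case: b un => un.
      by apply: (etrans _ (esym (fr c))); congr fe; exact: val_inj.
    by apply: (etrans _ (esym (fl c))); congr fe; exact: val_inj.
  by case: b un => un; apply: (RT _ _ _ (rel_rcons _ relC) (RS _ _ (rel_edge_of_node _))).
apply: (@pieces_tree _ _ _ _ d.1) => u ul /=.
pose v := nth [::] (leaves d.2) (index u (leaves d.1)).
have [sd _ _] := fd.
have ui : (index u (leaves d.1) < size (leaves d.2))%N by rewrite -sd index_mem.
have vl : v \in leaves d.2 by exact: mem_nth.
have [e eE ue] := nodeP u true (leaf_node ul).
have [e' eE' ve] := nodeP v false (leaf_node vl).
have ee' : fold e e'.
  apply/folded_edgeP; rewrite -eE -eE'; congr fe; apply: val_inj => /=.
  by rewrite /node_edge /= ul vl /v index_uniq// uniq_leaves.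
apply: (rel_pieces _ (reduced_leaf fd ul)).
exact: (RT _ _ _ ue (RT _ _ _ (fold_rel ee') (RS _ _ ve))).
Qed.

End CoreToPieces.

(** * Elements piecewise in the subgroup are accepted *)

Section LeafCounting.
Implicit Types (t l r : tree) (u v w : address) (b : bool).

(** The vertices of a diagram are numbers of leaves; for a node these are the end
    points of the corresponding edge. *)
Definition first_leaf t u := find (prefix u) (leaves t).
Definition leaf_count t u := count (prefix u) (leaves t).

Lemma node_has_leaf t u : u \in nodes t -> has (prefix u) (leaves t).
Proof.
elim: t u => [u|l IHl r IHr [_|b u]]; first by rewrite /nodes inE => /eqP->.
  have -> : has (prefix [::]) (leaves (Node l r)) = has predT (leaves (Node l r)).
    by apply: eq_has => -[].
  have := IHl [::] (root_node l); rewrite has_predT /= size_cat size_map addn_gt0.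
  by case: (leaves l).
rewrite nodes_cons /= has_cat !has_map.
have pE c : preim (cons c) (prefix (b :: u)) =1 fun v => (b == c) && prefix u v by [].
rewrite !(eq_has (pE _)); case: b {pE} => /= [/IHr|/IHl] ->; rewrite ?orbT//.
Qed.

Lemma first_leaf_cons b l r u : u \in nodes (if b then r else l) ->
  first_leaf (Node l r) (b :: u) =
  if b then (size (leaves l) + first_leaf r u)%N else first_leaf l u.
Proof.
move=> /node_has_leaf hu; rewrite /first_leaf /= find_cat has_map.
have pE c : preim (cons c) (prefix (b :: u)) =1 fun v => (b == c) && prefix u v by [].
rewrite (eq_has (pE _)) !find_map !(eq_find (pE _)) size_map.
by case: b hu {pE} => /= hu; [rewrite has_pred0|rewrite hu].
Qed.

Lemma leaf_count_cons b l r u :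
  leaf_count (Node l r) (b :: u) = leaf_count (if b then r else l) u.
Proof.
rewrite /leaf_count /= count_cat !count_map.
have pE c : preim (cons c) (prefix (b :: u)) =1 fun v => (b == c) && prefix u v by [].
rewrite !(eq_count (pE _)); case: b {pE} => /=; rewrite count_pred0 ?addn0//.
Qed.

Lemma first_leaf_nil t : first_leaf t [::] = 0%N.
Proof. by rewrite /first_leaf; case: (leaves t) => //= -[]. Qed.

Lemma leaf_count_nil t : leaf_count t [::] = size (leaves t).
Proof. by rewrite -count_predT; apply: eq_count => -[]. Qed.

Lemma first_leaf_children t u : u \in inner_nodes t ->
  [/\ first_leaf t (rcons u false) = first_leaf t u,
      first_leaf t (rcons u true) =
        (first_leaf t u + leaf_count t (rcons u false))%N
    & leaf_count t u =
        (leaf_count t (rcons u false) + leaf_count t (rcons u true))%N].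
Proof.
elim: t u => [//|l IHl r IHr] [_|b u].
  rewrite ?leaf_count_cons !first_leaf_cons ?root_node// !first_leaf_nil !leaf_count_nil.
  by rewrite /= size_cat !size_map addn0 add0n.
rewrite inner_cons => ui.
rewrite !rcons_cons !leaf_count_cons !first_leaf_cons ?child_node ?inner_node//.
by case: b ui => [/IHr|/IHl] [-> -> ->]; rewrite ?addnA.
Qed.

Lemma first_leaf_leaf t u : u \in leaves t ->
  first_leaf t u = index u (leaves t) /\ leaf_count t u = 1%N.
Proof.
elim: t u => [u|l IHl r IHr [|b u]]; first by rewrite inE => /eqP->.
  by rewrite leaf_nil.
rewrite leaf_cons => ul.
rewrite first_leaf_cons ?leaf_node// leaf_count_cons.
case: b ul => ul; first by rewrite index_leaf1; have [-> ->] := IHr _ ul.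
by rewrite index_leaf0//; have [-> ->] := IHl _ ul.
Qed.

Lemma first_leaf_le t u : (first_leaf t u + leaf_count t u <= size (leaves t))%N.
Proof.
rewrite /first_leaf /leaf_count; elim: (leaves t) => //= v s IH.
by case: ifP => /= _; rewrite ?addSn ?add0n ?add1n ?ltnS ?count_size.
Qed.

Lemma pre_ini_node d s u : u \in nodes (side d s) ->
  pre_ini d (node_edge d s u) = first_leaf (side d s) u.
Proof.
move=> un; rewrite /node_edge; case: ifPn => //= ul.
by have [-> _] := first_leaf_leaf ul.
Qed.

Lemma pre_ter_node d s u : u \in nodes (side d s) ->
  pre_ter d (node_edge d s u) = (first_leaf (side d s) u + leaf_count (side d s) u)%N.
Proof.
move=> un; rewrite /node_edge; case: ifPn => //= ul.
by have [-> ->] := first_leaf_leaf ul; rewrite addn1.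
Qed.

Lemma pair_cell_vertices d (c : cell (pair_complex d)) :
  [/\ ini (lbot c) = ini (top c), ini (rbot c) = ter (lbot c)
    & ter (rbot c) = ter (top c)].
Proof.
have [f0 f1 cE] := first_leaf_children (ssvalP (tagged c)).
have cn := cell_child_node c; have tn := cell_top_node c.
by split; congr inord => /=; rewrite ?pre_ini_node ?pre_ter_node// ?cE ?f0 ?f1 ?addnA.
Qed.

End LeafCounting.

Section PiecesToCore.
Variables (R : realType) (H : set (thompson R)).
Hypothesis gH : subgroup H.
Local Notation F := (thompson R).
Implicit Types (f g h : F) (u v w : address) (b : bool) (d : tree_pair).

Local Notation D := (fun i : core_index H => pair_diagram (val i)).
Local Notation glue := (@root_glue _ D).
Local Notation fold := (fold_edge glue).
Local Notation fedge := (folded_edge glue).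
Local Notation edgeC := (edge (core H)).
Local Notation cellC := (cell (core H)).
Implicit Types (E : edgeC) (C : cellC).

Local Open Scope quotient_scope.

Definition folded_cell (c : cell (sum_complex D)) : cellC :=
  \pi_({eq_quot (fold_cellb glue)}) c.

Definition bot b C : edgeC := if b then rbot C else lbot C.

Lemma folded_cellP c c' :
  folded_cell c = folded_cell c' <-> fold (top c) (top c').
Proof.
split=> [/eqmodP/asboolP//|ee']; exact/eqmodP/asboolP.
Qed.

Lemma folded_cell_repr C : folded_cell (repr C) = C.
Proof. exact: reprK. Qed.

Lemma fold_cell_repr c : fold (top c) (top (repr (folded_cell c))).
Proof. by apply/folded_cellP; rewrite folded_cell_repr. Qed.

Lemma folded_top c : top (folded_cell c) = fedge (top c).
Proof. by apply/folded_edgeP; apply: fold_sym; exact: fold_cell_repr. Qed.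

Lemma folded_bot b c : bot b (folded_cell c) = fedge (if b then rbot c else lbot c).
Proof.
case: b; apply/folded_edgeP; apply: fold_sym.
  by apply: fold_rbot; exact: fold_cell_repr.
by apply: fold_lbot; exact: fold_cell_repr.
Qed.

(** The core is folded: a cell is determined by its top edge, and a top edge by
    the bottom edges. *)
Lemma core_cell_top_inj C C' : top C = top C' -> C = C'.
Proof.
rewrite -(folded_cell_repr C) -(folded_cell_repr C') !folded_top.
by move=> /folded_edgeP tt; apply/folded_cellP.
Qed.

Lemma core_cell_bot_inj C C' : (forall b, bot b C = bot b C') -> top C = top C'.
Proof.
rewrite -(folded_cell_repr C) -(folded_cell_repr C') !folded_top => bb.
apply/folded_edgeP; apply: fold_top.
  by have := bb false; rewrite !folded_bot => /folded_edgeP.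
by have := bb true; rewrite !folded_bot => /folded_edgeP.
Qed.

Lemma folded_ini e e' : ini e = ini e' -> ini (fedge e) = ini (fedge e').
Proof.
move=> ee'; apply/eqmodP/asboolP.
apply: foldv_trans (foldv_sym (fold_ini (fold_repr e))) _; rewrite ee'.
exact: fold_ini (fold_repr e').
Qed.

Lemma folded_ter e e' : ter e = ter e' -> ter (fedge e) = ter (fedge e').
Proof.
move=> ee'; apply/eqmodP/asboolP.
apply: foldv_trans (foldv_sym (fold_ter (fold_repr e))) _; rewrite ee'.
exact: fold_ter (fold_repr e').
Qed.

Lemma folded_initer e e' : ini e = ter e' -> ini (fedge e) = ter (fedge e').
Proof.
move=> ee'; apply/eqmodP/asboolP.
apply: foldv_trans (foldv_sym (fold_ini (fold_repr e))) _; rewrite ee'.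
exact: fold_ter (fold_repr e').
Qed.

Lemma core_cell_vertices C :
  [/\ ini (bot false C) = ini (top C), ini (bot true C) = ter (bot false C)
    & ter (bot true C) = ter (top C)].
Proof.
rewrite -(folded_cell_repr C) !folded_bot !folded_top.
have [e1 e2 e3] := pair_cell_vertices (tagged (repr C)).
split; [apply: folded_ini|apply: folded_initer|apply: folded_ter].
- by congr inr; congr Tagged; rewrite e1.
- by congr inr; congr Tagged; rewrite e2.
- by congr inr; congr Tagged; rewrite e3.
Qed.

(** The edges of the core that are reached from [p] along the letters of an
    address, by going from the top edge of a cell to a bottom edge. *)
Inductive reach : address -> edgeC -> Prop :=
| reach_root : reach [::] (core_root H)
| reach_bot u C b : reach u (top C) -> reach (rcons u b) (bot b C).

Lemma reach_inv w E : reach w E -> (w = [::] /\ E = core_root H) \/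
  exists u b C, [/\ w = rcons u b, reach u (top C) & E = bot b C].
Proof. by case=> [|u C b uC]; [left|right; exists u, b, C]. Qed.

Lemma reach_rcons u b E : reach (rcons u b) E ->
  exists2 C, reach u (top C) & E = bot b C.
Proof.
move=> /reach_inv[[e _]|[u' [b' [C [/rcons_inj[-> ->] uC ->]]]]]; last by exists C.
by case: u e.
Qed.

Lemma reach_cat u v w E E' : (forall E1 E2, reach u E1 -> reach v E2 -> E1 = E2) ->
  reach (u ++ w) E -> reach (v ++ w) E' -> E = E'.
Proof.
move=> uv; elim/last_ind: w E E' => [|w b IH] E E'; first by rewrite !cats0; exact: uv.
rewrite -!rcons_cat => /reach_rcons[C uC ->] /reach_rcons[C' vC' ->].
by congr bot; apply: core_cell_top_inj; exact: IH _ _ uC vC'.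
Qed.

Lemma reach_fun u E E' : reach u E -> reach u E' -> E = E'.
Proof.
rewrite -[u]cat0s; apply: reach_cat => E1 E2.
move=> /reach_inv[[_ ->]|[u' [b [? [e _ _]]]]]; last by case: u' e.
by move=> /reach_inv[[_ ->//]|[u' [b [? [e _ _]]]]]; case: u' e.
Qed.

Definition node_fedge (i : core_index H) s u (un : u \in nodes (side (val i) s)) : edgeC :=
  fedge (Some (Tagged (fun i => edge (D i)) (edge_of_node un : edge (D i)))).

Definition node_fcell (i : core_index H) s u (ui : u \in inner_nodes (side (val i) s)) : cellC :=
  folded_cell (Tagged (fun i => cell (D i))
    (Tagged (fun s => seq_sub (inner_nodes (side (val i) s))) (SeqSub ui) : cell (D i))).

Lemma node_fcell_top (i : core_index H) s u (ui : u \in inner_nodes (side (val i) s))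
   (un : u \in nodes (side (val i) s)) : top (node_fcell ui) = node_fedge un.
Proof.
rewrite /node_fcell folded_top; congr folded_edge; congr Some; congr Tagged.
exact: val_inj.
Qed.

Lemma node_fcell_bot (i : core_index H) s u b (ui : u \in inner_nodes (side (val i) s))
   (un : rcons u b \in nodes (side (val i) s)) : bot b (node_fcell ui) = node_fedge un.
Proof.
rewrite /node_fcell folded_bot; case: b un => un;
  congr folded_edge; congr Some; congr Tagged; exact: val_inj.
Qed.

Lemma reach_node (i : core_index H) s u (un : u \in nodes (side (val i) s)) :
  reach u (node_fedge un).
Proof.
elim/last_ind: u un => [|u b IH] un.
  rewrite (_ : node_fedge un = core_root H); first exact: reach_root.
  apply/folded_edgeP; apply: fold_sym; apply: fold_glue.
  case: s un => un.
    rewrite (_ : edge_of_node un = top_edge (D i)); last exact: val_inj.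
    exact: glue_top.
  rewrite (_ : edge_of_node un = bottom_edge (D i)); last exact: val_inj.
  exact: glue_bottom.
have ui := node_parent un; rewrite -(node_fcell_bot ui).
by apply: reach_bot; rewrite (node_fcell_top _ (inner_node ui)).
Qed.

Lemma core_index_of h : H h -> exists i : core_index H, reduced_diagram h (val i).
Proof.
move=> Hh; have [d hd] := reduced_diagram_exists h.
have dP : `[< exists2 h, H h & reduced_diagram h d >] by apply/asboolP; exists h.
by exists (exist _ d dP).
Qed.

(** If an edge of the core is the top of no cell, then an address leading to it is
    an inner node of no diagram of an element of [H]. *)
Lemma cell_or_linear u E : reach u E ->
  (exists C, top C = E) \/ (forall h, H h -> exists v, linear_on h u v).
Proof.
move=> uE; case: (pselect (exists C, top C = E)) => [|nC]; [by left|right=> h Hh].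
have [i hi] := core_index_of Hh.
have [ui|] := boolP (u \in inner_nodes (side (val i) true)).
  case: nC; exists (node_fcell ui); rewrite (node_fcell_top _ (inner_node ui)).
  exact: reach_fun (reach_node _) uE.
by rewrite (reduced_inner _ hi) negbK => /asboolP.
Qed.

(** Two elements of [H] that agree at the middle of an interval on which all of [H]
    is linear map it onto the same dyadic interval, because the middle determines
    the interval; so they agree on it, and bisections can be undone. *)
Lemma one_piece f u : (forall h, H h -> exists v, linear_on h u v) ->
  pieces H f u -> exists2 h, H h & forall t, 0 <= t <= 1 -> f (phi u t) = h (phi u t).
Proof.
move=> + fu; elim: fu => {}u; first by move=> h Hh fh _; exists h.
move=> _ IH hu.
have hub b h : H h -> exists v, linear_on h (rcons u b) v.
  by move=> /hu[v hv]; exists (rcons v b); exact: linear_rcons.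
have [h0 Hh0 fh0] := IH false (hub false); have [h1 Hh1 fh1] := IH true (hub true).
have [v0 huv0] := hu h0 Hh0; have [v1 huv1] := hu h1 Hh1.
have half : 0 <= (1 / 2 : R) <= 1 by lra.
have t0 : 0 <= (0 : R) <= 1 by lra.
have t1 : 0 <= (1 : R) <= 1 by lra.
have v01 : v0 = v1.
  apply: (@phi_mid R); rewrite -huv0// -huv1//.
  have E0 : phi u (1 / 2) = phi (rcons u false) 1 :> R by rewrite phi_rcons add0r.
  have E1 : phi u (1 / 2) = phi (rcons u true) 0 :> R by rewrite phi_rcons addr0.
  by rewrite {1}E0 -fh0// -E0 E1 fh1.
exists h0 => // t t01; have [b [t' [t'01 ->]]] := phi_half t01.
rewrite -phi_rcons; case: b; last exact: fh0.
by rewrite fh1// !phi_rcons huv0 ?huv1 ?v01//; move: t'01; rewrite /=; lra.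
Qed.

Lemma reach_linear_one h u v E E' : H h -> linear_on h u v ->
  reach u E -> reach v E' -> E = E'.
Proof.
move=> Hh huv uE vE'; have [i hi] := core_index_of Hh.
have uN : u \notin inner_nodes (val i).1.
  by rewrite (reduced_inner _ hi) negbK; apply/asboolP; exists v.
have [u' [w [u'l uE' vE'']]] := reduced_linear hi uN huv.
rewrite uE' in uE; rewrite vE'' in vE'.
apply: reach_cat uE vE' => E1 E2 E1r E2r.
have [sd _ _] := hi.
set v' := nth _ _ _ in E2r.
have ix : (index u' (leaves (val i).1) < size (leaves (val i).2))%N by rewrite -sd index_mem.
have v'l : v' \in leaves (side (val i) false) by exact: mem_nth.
have u'l' : u' \in leaves (side (val i) true) by [].
rewrite (reach_fun E1r (reach_node (leaf_node u'l'))).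
rewrite (reach_fun E2r (reach_node (leaf_node v'l))).
congr folded_edge; congr Some; congr Tagged; apply: val_inj => /=.
by rewrite /node_edge u'l' v'l /v' index_uniq// uniq_leaves.
Qed.

(** By bisection, the top edge of a cell being determined by its bottom edges. When
    one of the two edges has no cell below it, bisection stops, but there the
    element agrees with a single element of [H], whose own diagram has been used
    in the construction of the core. *)
Lemma reach_linear f u v E E' : piecewise H f -> linear_on f u v ->
  reach u E -> reach v E' -> E = E'.
Proof.
move=> pf; have := piecewise_pieces u pf.
have pfV := subgroupV (piecewise_subgroup gH) pf.
move=> fu; elim: fu v E E' => {}u.
  move=> h Hh fh v E E' fuv; apply: reach_linear_one Hh _.
  by move=> t t01; rewrite -fh// fuv.
move=> fub IH v E E' fuv uE vE'.
have fu : pieces H f u by exact: pieces_node.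
have [[C CE]|hu] := cell_or_linear uE; last first.
  have [h Hh fh] := one_piece hu fu.
  by apply: (reach_linear_one Hh _ uE vE') => t t01; rewrite -fh// fuv.
have [[C' CE']|hv] := cell_or_linear vE'; last first.
  have [h Hh fh] := one_piece hv (piecewise_pieces v pfV).
  apply: (reach_linear_one (subgroupV gH Hh) _ uE vE').
  apply: linear_inv => t t01; rewrite -fh//.
  by rewrite -fuv// thK.
rewrite -CE -CE'; apply: core_cell_bot_inj => b.
apply: (IH b (rcons v b)); first exact: linear_rcons.
  by apply: reach_bot; rewrite CE.
by apply: reach_bot; rewrite CE'.
Qed.

(** The inner nodes of a reduced diagram are the addresses where the element is
    not linear; there not all of [H] is linear either, by [one_piece], so that
    the core has a cell to continue with. *)
Lemma reach_reduced f d : piecewise H f -> reduced_diagram f d ->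
  (forall u, u \in nodes d.1 -> exists E, reach u E) /\
  (forall u, u \in inner_nodes d.1 -> exists C, reach u (top C)).
Proof.
move=> pf fd.
have innerP u E : u \in inner_nodes d.1 -> reach u E -> exists C, reach u (top C).
  move=> ui uE; have [[C CE]|hu] := cell_or_linear uE; first by exists C; rewrite CE.
  have [h Hh fh] := one_piece hu (piecewise_pieces u pf).
  move: ui; rewrite (reduced_inner _ fd) => /negP; case; apply/asboolP.
  by have [v huv] := hu h Hh; exists v => t t01; rewrite fh// huv.
have nodeP u : u \in nodes d.1 -> exists E, reach u E.
  elim/last_ind: u => [|u b IH] un; first by exists (core_root H); exact: reach_root.
  have ui := node_parent un; have [E uE] := IH (inner_node ui).
  by have [C uC] := innerP u E ui uE; exists (bot b C); exact: reach_bot.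
split=> // u ui; have [E uE] := nodeP u (inner_node ui).
exact: innerP uE.
Qed.

(** The images of the vertices are read off the leaves; consecutive leaves agree
    at their common vertex because the bottom edges of a cell are consecutive. *)
Lemma vertex_map (t : tree) (G : address -> edgeC) :
  (forall u, u \in inner_nodes t -> exists2 C, top C = G u & forall b, bot b C = G (rcons u b)) ->
  exists V : nat -> vertex (core H), forall u, u \in nodes t ->
    ini (G u) = V (first_leaf t u) /\ ter (G u) = V (first_leaf t u + leaf_count t u)%N.
Proof.
elim: t G => [|l IHl r IHr] G GP.
  exists (fun j => if j is 0%N then ini (G [::]) else ter (G [::])) => u.
  by rewrite /nodes /= inE => /eqP->.
have [|Vl VlP] := IHl (fun u => G (false :: u)).
  by move=> u ul; apply: (GP (false :: u)); rewrite inner_cons.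
have [|Vr VrP] := IHr (fun u => G (true :: u)).
  by move=> u ul; apply: (GP (true :: u)); rewrite inner_cons.
have [C CE bE] := GP [::] (inner_nil l r).
have [c1 c2 c3] : [/\ ini (G [:: false]) = ini (G [::]),
    ini (G [:: true]) = ter (G [:: false]) & ter (G [:: true]) = ter (G [::])].
  by have := core_cell_vertices C; rewrite CE !bE.
have [l0 l1] := VlP [::] (root_node l); have [r0 r1] := VrP [::] (root_node r).
rewrite !first_leaf_nil !leaf_count_nil ?add0n in l0 l1 r0 r1.
pose V j := if (j < size (leaves l))%N then Vl j else Vr (j - size (leaves l))%N.
have VlE j : (j <= size (leaves l))%N -> V j = Vl j.
  rewrite /V leq_eqVlt => /orP[/eqP->|->//].
  by rewrite ltnn subnn -l1 -r0 c2.
have VrE j : V (size (leaves l) + j)%N = Vr j.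
  by rewrite /V ltnNge leq_addr /= addKn.
exists V => -[_|b u]; last first.
  rewrite nodes_cons => un; rewrite first_leaf_cons// leaf_count_cons.
  case: b un => un; first by rewrite -addnA !VrE; exact: VrP.
  have le := first_leaf_le l u.
  by rewrite !VlE//; [exact: VlP|exact: leq_trans (leq_addr _ _) le].
rewrite first_leaf_nil leaf_count_nil add0n /= size_cat !size_map VrE -r1 c3.
by rewrite VlE// -l0 c1.
Qed.

Lemma piecewise_sub_closure : piecewise H `<=` thompson_closure H.
Proof.
move=> f pf; have [d fd] := reduced_diagram_exists f; exists d => //.
have [sd _ _] := fd.
have pfV := subgroupV (piecewise_subgroup gH) pf.
have [n1 i1] := reach_reduced pf fd.
have [n2 i2] := reach_reduced pfV (reduced_inv fd); rewrite /= in n2 i2.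
have nodeP s u : u \in nodes (side d s) -> exists E, reach u E.
  by case: s; [exact: n1|exact: n2].
have innerP s u : u \in inner_nodes (side d s) -> exists C, reach u (top C).
  by case: s; [exact: i1|exact: i2].
pose G u : edgeC := xget (core_root H) [set E | reach u E].
have GP s u : u \in nodes (side d s) -> reach u (G u).
  by move=> /nodeP[E uE]; rewrite /G; case: xgetP => [E' _ //|/(_ E)].
have leafG u v i : (i < size (leaves d.1))%N -> u = nth [::] (leaves d.1) i ->
    v = nth [::] (leaves d.2) i -> G u = G v.
  move=> id uE vE.
  have ul : u \in leaves (side d true) by rewrite uE mem_nth.
  have vl : v \in leaves (side d false) by rewrite vE mem_nth// -sd.
  apply: (reach_linear pf _ (GP _ _ (leaf_node ul)) (GP _ _ (leaf_node vl))).
  by have := reduced_leaf fd ul; rewrite uE vE index_uniq ?uniq_leaves.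
have nodeG s u : u \in nodes (side d s) -> G (pre_addr d (node_edge d s u)) = G u.
  rewrite /node_edge => un; case: ifPn => //= ul.
  case: s un ul => un ul; first by rewrite nth_index.
  have ix : (index u (leaves d.2) < size (leaves d.1))%N by rewrite sd index_mem.
  by apply: (leafG _ _ _ ix) => //; rewrite nth_index.
pose fe (e : edge (pair_diagram d)) : edgeC := G (pre_addr d (ssval e)).
have feE s u (un : u \in nodes (side d s)) : fe (edge_of_node un) = G u by exact: nodeG.
have /choice[fc fcP] : forall c : cell (pair_diagram d), exists C, reach (cell_node c) (top C).
  by move=> c; apply: (innerP (tag c)); exact: (ssvalP (tagged c)).
have VP s : exists V : nat -> vertex (core H), forall u, u \in nodes (side d s) ->
    ini (G u) = V (first_leaf (side d s) u) /\
    ter (G u) = V (first_leaf (side d s) u + leaf_count (side d s) u)%N.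
  apply: vertex_map => u ui; have [C uC] := innerP s u ui.
  exists C; first by apply: reach_fun uC (GP s u (inner_node ui)).
  by move=> b; apply: reach_fun (reach_bot b uC) (GP s _ (child_node b ui)).
have [V1 V1P] := VP true; have [V2 V2P] := VP false.
have V12 j : (j <= size (leaves d.1))%N -> V1 j = V2 j.
  have leafV i : (i < size (leaves d.1))%N -> V1 i = V2 i /\ V1 i.+1 = V2 i.+1.
    move=> id; pose u := nth [::] (leaves d.1) i; pose v := nth [::] (leaves d.2) i.
    have ul : u \in leaves d.1 by rewrite mem_nth.
    have vl : v \in leaves d.2 by rewrite mem_nth// -sd.
    have [u0 u1] := V1P u (leaf_node ul); have [v0 v1] := V2P v (leaf_node vl).
    move: u0 u1 v0 v1; have [-> ->] := first_leaf_leaf ul; have [-> ->] := first_leaf_leaf vl.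
    rewrite !index_uniq ?uniq_leaves -?sd// !addn1 (leafG u v i)// => <- <- <- <-.
    by [].
  case: j => [|j] jd; last by case: (leafV j jd).
  suff /leafV[] : (0 < size (leaves d.1))%N by [].
  by have := node_has_leaf (root_node d.1); case: (leaves d.1).
have VE s u : u \in nodes (side d s) ->
    ini (G u) = V1 (first_leaf (side d s) u) /\
    ter (G u) = V1 (first_leaf (side d s) u + leaf_count (side d s) u)%N.
  case: s => un; first exact: V1P.
  have le := first_leaf_le d.2 u; rewrite -sd in le.
  rewrite !V12//; first exact: V2P.
  exact: leq_trans (leq_addr _ _) le.
have leS s u : (first_leaf (side d s) u + leaf_count (side d s) u <= size (leaves d.1))%N.
  by have := first_leaf_le (side d s) u; case: s; rewrite //= -sd.
have edgeP (e : edge (pair_diagram d)) : exists s u, u \in nodes (side d s) /\ ssval e = node_edge d s u.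
  have := ssvalP e; rewrite mem_cat => /orP[]/mapP[u un ->].
    by exists true, u.
  by exists false, u.
exists (fun j : vertex (pair_diagram d) => V1 (j : 'I_(size (leaves d.1)).+1)), fe, fc; split; first split.
- move=> e; have [s [u [un eE]]] := edgeP e.
  rewrite /fe eE nodeG// /= eE pre_ini_node// inordK; first by have [] := VE s u un.
  by rewrite ltnS; exact: leq_trans (leq_addr _ _) (leS s u).
- move=> e; have [s [u [un eE]]] := edgeP e.
  rewrite /fe eE nodeG// /= eE pre_ter_node// inordK; first by have [] := VE s u un.
  by rewrite ltnS.
- by move=> c; rewrite feE; apply: reach_fun (fcP c) (GP _ _ (cell_top_node c)).
- move=> c; rewrite feE.
  exact: reach_fun (reach_bot false (fcP c)) (GP _ _ (cell_child_node c false)).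
- move=> c; rewrite feE.
  exact: reach_fun (reach_bot true (fcP c)) (GP _ _ (cell_child_node c true)).
- by rewrite feE; apply: reach_fun (GP true _ (root_node d.1)) reach_root.
- by rewrite feE; apply: reach_fun (GP false _ (root_node d.2)) reach_root.
Qed.

Lemma thompson_closureE : thompson_closure H = piecewise H.
Proof.
apply/seteqP; split; first exact: closure_sub_piecewise.
exact: piecewise_sub_closure.
Qed.

End PiecesToCore.

(** * Components of supports *)

Section Supports.
Variable R : realType.
Local Notation F := (thompson R).
Implicit Types (f g h s t w z : F) (H Z N : set F) (x y a b c d : R).

Definition fixes Z x := forall z, Z z -> z x = x.

(** The connected components of the support of [Z]. *)
Definition component Z c d := [/\ c < d, fixes Z c, fixes Z d
  & forall x, c < x < d -> exists2 z, Z z & z x <> x].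

Definition normalizes H Z := forall h z, H h -> Z z -> Z (z ^ h)%g.

Lemma not_fixes Z x : ~ fixes Z x -> exists2 z, Z z & z x <> x.
Proof.
move=> nf; apply: contrapT => ne; apply: nf => z Zz; apply: contrapT => zx.
by apply: ne; exists z.
Qed.

Lemma fixes_sup Z (A : set R) : subgroup Z -> has_sup A ->
  (forall z x, Z z -> A x -> exists2 y, A y & x <= z y) -> fixes Z (sup A).
Proof.
move=> gZ [A0 Aub] AZ.
have le z : Z z -> sup A <= z (sup A).
  move=> Zz; apply: ge_sup => // x /(AZ z x Zz)[y Ay xy].
  by apply: le_trans xy _; rewrite th_le; exact: ub_le_sup.
move=> z Zz; apply/eqP; rewrite eq_le le// andbT.
by rewrite -[leRHS](thVK z) th_le; apply: le; exact: subgroupV.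
Qed.

Lemma fixes_inf Z (A : set R) : subgroup Z -> has_inf A ->
  (forall z x, Z z -> A x -> exists2 y, A y & z y <= x) -> fixes Z (inf A).
Proof.
move=> gZ [A0 Alb] AZ.
have le z : Z z -> z (inf A) <= inf A.
  move=> Zz; apply: lb_le_inf => // x /(AZ z x Zz)[y Ay xy].
  by apply: le_trans _ xy; rewrite th_le; exact: ge_inf.
move=> z Zz; apply/eqP; rewrite eq_le le//=.
by rewrite -[leLHS](thVK z) th_le; apply: le; exact: subgroupV.
Qed.

Lemma fixes_out Z x : ~~ (0 < x < 1) -> fixes Z x.
Proof.
move=> xI z _; have [->|x0] := eqVneq x 0; first exact: th_at0.
have [->|x1] := eqVneq x 1; first exact: th_at1.
by apply: th_out; move: xI x0 x1; lra.
Qed.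

Lemma component_exists Z x : subgroup Z -> ~ fixes Z x ->
  exists c d, component Z c d /\ c < x < d.
Proof.
move=> gZ xZ.
have /andP[x0 x1] : 0 < x < 1.
  by apply: contrapT => /negP xI; apply: xZ; exact: fixes_out.
pose A := [set t | fixes Z t /\ t <= x]; pose B := [set t | fixes Z t /\ x <= t].
have A0 : A 0 by split; [move=> z _; exact: th_at0|exact: ltW].
have B1 : B 1 by split; [move=> z _; exact: th_at1|exact: ltW].
have Aub : has_ubound A by exists x => t [].
have Blb : has_lbound B by exists x => t [].
have cZ : fixes Z (sup A).
  apply: fixes_sup => //; first by split=> //; exists 0.
  by move=> z t Zz [tZ tx]; exists t => //; rewrite tZ.
have dZ : fixes Z (inf B).
  apply: fixes_inf => //; first by split=> //; exists 1.
  by move=> z t Zz [tZ tx]; exists t => //; rewrite tZ.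
have cx : sup A <= x by apply: ge_sup; [exists 0|move=> t []].
have xd : x <= inf B by apply: lb_le_inf; [exists 1|move=> t []].
have cx' : sup A < x by rewrite lt_neqAle cx andbT; apply/eqP => e; apply: xZ; rewrite -e.
have xd' : x < inf B by rewrite lt_neqAle xd andbT; apply/eqP => e; apply: xZ; rewrite e.
exists (sup A), (inf B); split; last by rewrite cx'.
split=> // [|y /andP[cy yd]]; first exact: lt_trans cx' xd'.
apply: not_fixes => yZ; have [yx|xy] := leP y x.
  by have := ub_le_sup Aub (conj yZ yx : A y); rewrite leNgt cy.
by have := ge_inf Blb (conj yZ (ltW xy) : B y); rewrite leNgt yd.
Qed.

(** The orbit of a point of a component accumulates at both ends, because the
    supremum and the infimum of an orbit are fixed points. *)
Lemma component_up Z c d x b : subgroup Z -> component Z c d -> c < x < d -> b < d ->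
  exists2 z, Z z & b < z x < d.
Proof.
move=> gZ [cd cZ dZ cdZ] /andP[cx xd] bd; apply: contrapT => ne.
pose A := [set y | exists2 z, Z z & y = z x].
have Ax : A x by exists 1%g; [exact: subgroup1|].
have Aub : ubound A b.
  move=> _ [z Zz ->]; rewrite leNgt; apply/negP => bz; apply: ne; exists z => //.
  by rewrite bz -(dZ z Zz) th_lt.
have sZ : fixes Z (sup A).
  apply: fixes_sup => //; first by split; [exists x|exists b].
  move=> z _ Zz [w Zw ->]; exists (ev z^-1%g (w x)); last by rewrite thVK.
  by exists (z^-1 * w)%g => //; apply: subgroupM => //; exact: subgroupV.
have [|z Zz /(_ (sZ z Zz))//] := cdZ (sup A).
have Ahub : has_ubound A by exists b.
rewrite (lt_le_trans cx (ub_le_sup Ahub Ax)) /=; apply: le_lt_trans bd.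
by apply: ge_sup => //; exists x.
Qed.

Lemma component_down Z c d x b : subgroup Z -> component Z c d -> c < x < d -> c < b ->
  exists2 z, Z z & c < z x < b.
Proof.
move=> gZ [cd cZ dZ cdZ] /andP[cx xd] cb; apply: contrapT => ne.
pose A := [set y | exists2 z, Z z & y = z x].
have Ax : A x by exists 1%g; [exact: subgroup1|].
have Alb : lbound A b.
  move=> _ [z Zz ->]; rewrite leNgt; apply/negP => bz; apply: ne; exists z => //.
  by rewrite bz -(cZ z Zz) th_lt cx.
have sZ : fixes Z (inf A).
  apply: fixes_inf => //; first by split; [exists x|exists b].
  move=> z _ Zz [w Zw ->]; exists (ev z^-1%g (w x)); last by rewrite thVK.
  by exists (z^-1 * w)%g => //; apply: subgroupM => //; exact: subgroupV.
have [|z Zz /(_ (sZ z Zz))//] := cdZ (inf A).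
have Ahlb : has_lbound A by exists b.
rewrite (le_lt_trans (ge_inf Ahlb Ax) xd) andbT; apply: lt_le_trans cb _.
by apply: lb_le_inf => //; exists x.
Qed.

Lemma fixes_norm H Z h x : normalizes H Z -> H h -> fixes Z x -> fixes Z (h x).
Proof.
move=> nZ Hh xZ z Zz; have := xZ _ (nZ h z Hh Zz).
by rewrite thJ => /(congr1 h); rewrite thVK.
Qed.

Lemma component_norm H Z h c d : subgroup H -> normalizes H Z -> H h ->
  component Z c d -> component Z (h c) (h d).
Proof.
move=> gH nZ Hh [cd cZ dZ cdZ]; split; rewrite ?th_lt//.
- exact: fixes_norm nZ Hh cZ.
- exact: fixes_norm nZ Hh dZ.
move=> x; rewrite -[x](thVK h) !th_lt => /cdZ[z Zz zx].
exists (z ^ h^-1)%g; first by apply: nZ => //; exact: subgroupV.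
by rewrite thJ invgK thK => /th_inj.
Qed.

Lemma component_eq Z c d c' d' x : component Z c d -> component Z c' d' ->
  c < x < d -> c' < x < d' -> c = c' /\ d = d'.
Proof.
move=> [_ cZ dZ cdZ] [_ cZ' dZ' cdZ'] xcd xcd'.
have no y : fixes Z y -> ~ (c < y < d) /\ ~ (c' < y < d').
  by move=> yZ; split=> [/cdZ|/cdZ'] [z Zz]; apply; exact: yZ.
have [_ n1] := no c cZ; have [_ n2] := no d dZ.
have [n3 _] := no c' cZ'; have [n4 _] := no d' dZ'.
have /andP[cx xd] := xcd; have /andP[cx' xd'] := xcd'.
split; apply/eqP; rewrite eq_le !leNgt; apply/andP; split; apply/negP => lt.
- by apply: n1; rewrite lt (lt_trans cx).
- by apply: n3; rewrite lt (lt_trans cx').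
- by apply: n4; rewrite lt (lt_trans cx xd').
- by apply: n2; rewrite lt (lt_trans cx' xd).
Qed.

Lemma component_meet H Z h c d x : subgroup H -> normalizes H Z -> H h ->
  component Z c d -> c < x < d -> c < h x < d -> h c = c /\ h d = d.
Proof.
move=> gH nZ Hh cd xcd hxcd.
have hcd := component_norm gH nZ Hh cd.
by apply: (component_eq hcd cd _ hxcd); rewrite !th_lt.
Qed.

Lemma component_stab H Z h c d : subgroup H -> normalizes H Z -> H h ->
  component Z c d -> h c = c -> h d = d.
Proof.
move=> gH nZ Hh cdZ hc; have := component_norm gH nZ Hh cdZ; rewrite hc => hcd.
have [cd _ _ _] := cdZ; have [chd _ _ _] := hcd.
pose x := (c + Num.min d (h d)) / 2.
have m : c < Num.min d (h d) by rewrite lt_min cd.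
have m1 : Num.min d (h d) <= d by rewrite ge_min lexx.
have m2 : Num.min d (h d) <= h d by rewrite ge_min lexx orbT.
by have [] := @component_eq _ _ _ _ _ x hcd cdZ; rewrite /x //; move: m m1 m2; lra.
Qed.

End Supports.

(** * One step of the derived series *)

Section Levels.
Variable R : realType.
Local Notation F := (thompson R).
Implicit Types (f g h s t w z : F) (x y a b c d : R).

(** Two successive terms [Z] and [N] of the derived series of [H], as far as the
    arguments below depend on them. *)
Definition level (H Z N : set F) := [/\ [/\ subgroup H, subgroup Z & subgroup N],
  Z `<=` H, normalizes H Z, normalizes H N
  & forall z w, Z z -> Z w -> N ([~ z, w])%g].

Variables (H Z N : set F) (c d : R).
Hypotheses (HZN : level H Z N) (cdZ : component Z c d).

Let gH : subgroup H. Proof. by case: HZN => -[]. Qed.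
Let gZ : subgroup Z. Proof. by case: HZN => -[]. Qed.
Let gN : subgroup N. Proof. by case: HZN => -[]. Qed.
Let ZH : Z `<=` H. Proof. by case: HZN. Qed.
Let nZ : normalizes H Z. Proof. by case: HZN. Qed.
Let nN : normalizes H N. Proof. by case: HZN. Qed.
Let cZ : fixes Z c. Proof. by case: cdZ. Qed.

Local Notation Y y := (c < y < d /\ fixes N y).

Let YZ z y : Z z -> Y y -> Y (z y).
Proof.
move=> Zz [/andP[cy yd] yN]; split; last exact: fixes_norm nN (ZH Zz) yN.
by have [_ _ dZ _] := cdZ; rewrite -(cZ Zz) -(dZ z Zz) !th_lt cy.
Qed.

Let rid_of_commuting s y : (forall w x, Z w -> Y x -> s (w x) = w (s x)) ->
  rid c s -> Y y -> s y = y.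
Proof.
move=> sw [b cb sb] Yy; have [ycd _] := Yy.
have [w Zw /andP[cw wb]] := component_down gZ cdZ ycd cb.
have := sw w y Zw Yy; rewrite sb ?(ltW cw) ?(ltW wb)// => /th_inj.
by [].
Qed.

(** The commutator of [s] and [z] is in [Z] and has trivial germ at [c]. At a point
    fixed by [N] the elements of [Z] commute, so that the commutator acts in the
    same way on the whole orbit of the point, which accumulates at [c]. *)
Lemma level_commute s z y : H s -> s c = c -> Z z -> Y y -> s (z y) = z (s y).
Proof.
have ZZ z' w x : Z z' -> Z w -> Y x -> z' (w x) = w (z' x).
  move=> Zz' Zw [_ xN]; have [_ _ _ _ zwN] := HZN.
  have := xN _ (zwN z' w Zz' Zw); rewrite thR.
  by move=> /(congr1 z') /(congr1 w); rewrite !thVK.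
move=> Hs sc Zz Yy.
have Zsz : Z ([~ s, z])%g.
  rewrite -invgR /commg; apply: (subgroupV gZ); apply: (subgroupM gZ).
    exact: (subgroupV gZ).
  exact: nZ.
have := rid_of_commuting (fun w x Zw => ZZ _ w x Zsz Zw) (rid_comm sc (cZ Zz)) Yy.
by rewrite thR => /(congr1 s) /(congr1 z); rewrite !thVK.
Qed.

Lemma level_rid s y : H s -> rid c s -> Y y -> s y = y.
Proof.
move=> Hs cs; apply: (rid_of_commuting _ cs) => w x Zw.
by apply: level_commute => //; exact: rid_fix.
Qed.

(** The orbit under [Z] of a fixed point of this kind accumulates at [c] and
    consists of fixed points, because [s] commutes with [Z] there. Hence the germ
    of [s] at [c], being affine, is trivial. *)
Lemma level_fix1 s e y : H s -> s c = c -> Y e -> s e = e -> Y y -> s y = y.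
Proof.
move=> Hs sc Ye se Yy.
have [|[b cb sb]] := rgerm_dich sc; first by move=> cs; exact: level_rid.
have [ecd _] := Ye.
have [w Zw /andP[cw wb]] := component_down gZ cdZ ecd cb.
by case: (sb (w e)); rewrite ?cw ?ltW// level_commute// se.
Qed.

(** A fixed point that is moved by [N] lies in a component of [N], which is
    preserved; its end points are fixed by [N], and one of them is in the
    component of [Z]. *)
Lemma level_fix s x y : H s -> s c = c -> c < x < d -> s x = x -> Y y -> s y = y.
Proof.
move=> Hs sc xcd sx Yy.
have [xN|xN] := pselect (fixes N x); first exact: level_fix1 sc (conj xcd xN) sx Yy.
have [q1 [q2 [qN xq]]] := component_exists gN xN.
have [|sq1 sq2] := component_meet gH nN Hs qN xq; first by rewrite sx.
have [_ q1N q2N qmv] := qN; have [ycd yN] := Yy.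
have : ~~ (q1 < y < q2) by apply/negP => /qmv[z Nz]; apply; exact: yN.
rewrite negb_and -!leNgt => /orP[yq|qy].
  apply: (level_fix1 Hs sc _ sq1 Yy); split=> //.
  by move: yq ycd xq xcd; lra.
apply: (level_fix1 Hs sc _ sq2 Yy); split=> //.
by move: qy ycd xq xcd; lra.
Qed.

(** At a break, the two elements of [H] differ by one fixing a point of the
    component, which is trivial at the points fixed by [N] by [level_fix]; hence
    the element of [H] used on the last piece also serves on the previous ones. *)
Lemma piecewise_single f x : piecewise H f -> f c = c -> c < x < d ->
  exists h, [/\ H h, h c = c, f x = h x & forall y, Y y -> y <= x -> f y = h y].
Proof.
move=> [l [_ fH]] fc; have [n] := ubnP (count (fun p => c < p < x) l).
elim: n x => // n IH x xn /andP[cx xd].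
have [m [/andP[cm mx] ml mP]] := prev_mark l cx.
have [h Hh fh] := fH m x (ltW mx) mP.
have [mc|mc] := eqVneq m c.
  have hc : h c = c by rewrite -fh ?fc// mc lexx ltW.
  exists h; split=> //; first by rewrite fh ?(ltW mx) ?lexx.
  by move=> y [/andP[cy _] _] yx; rewrite fh// mc ltW.
have cm' : c < m by rewrite lt_neqAle eq_sym mc.
have {ml}ml : m \in l by case: ml => // e; rewrite e eqxx in mc.
have mcd : c < m < d by rewrite cm' (lt_trans mx).
have [|h1 [Hh1 h1c fh1 fh1Y]] := IH m _ mcd.
  rewrite ltnS in xn; apply: leq_trans xn.
  apply: (count_ltn (e := m)) => //; rewrite ?cm' ?mx ?ltxx ?andbF//.
  by move=> p /andP[-> pm]; exact: lt_trans pm mx.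
have hm : f m = h m by rewrite fh// lexx ltW.
pose u : F := (h1^-1 * h)%g; have Hu : H u by apply: subgroupM => //; exact: subgroupV.
have um : u m = m by rewrite thM -hm fh1 thK.
have hE y : h y = h1 (u y) by rewrite thM thVK.
have [uc _] : u c = c /\ u d = d by apply: (component_meet gH nZ Hu cdZ mcd); rewrite um.
exists h; split=> //; first by rewrite hE uc.
  by rewrite fh ?lexx ?ltW.
move=> y Yy yx; have [ym|my] := leP y m; last by rewrite fh ?(ltW my).
by rewrite fh1Y// hE (level_fix Hu uc mcd um Yy).
Qed.

Lemma level_piecewise f y : piecewise H f -> rid c f -> Y y -> f y = y.
Proof.
move=> pf cf Yy; have [ycd _] := Yy.
have [h [Hh hc fh fhY]] := piecewise_single pf (rid_fix cf) ycd.
have [b cb fb] := cf.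
have [|w Zw /andP[cw]] := component_down gZ cdZ ycd (b := Num.min y b).
  by rewrite lt_min cb andbT; case/andP: ycd.
rewrite lt_min => /andP[wy wb].
have Yw := YZ Zw Yy; have [wcd _] := Yw.
rewrite fh; apply: (level_fix Hh hc wcd _ Yy).
by rewrite -fhY ?fb ?ltW.
Qed.

Lemma level_fix_rid s x y : H s -> s c = c -> c < x < d -> s x = x -> Y y -> rid c s.
Proof.
move=> Hs sc xcd sx Yy; have [//|[b cb sb]] := rgerm_dich sc.
have [ycd _] := Yy.
have [w Zw /andP[cw wb]] := component_down gZ cdZ ycd cb.
case: (sb (w y)); first by rewrite cw ltW.
exact: level_fix Hs sc xcd sx (YZ Zw Yy).
Qed.

(** Up to [x], [f] agrees on the points fixed by [N] with an element [g] of [H];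
    [g] and [h] agree at [x], hence at all these points, and [f] fixes those near
    [c]. *)
Lemma level_meet f h x y : piecewise H f -> rid c f -> Y y -> H h -> c < x < d ->
  h x = f x -> rid c h.
Proof.
move=> pf cf Yy Hh xcd hx; have fc := rid_fix cf.
have [g [Hg gc fg fgY]] := piecewise_single pf fc xcd.
have gd := component_stab gH nZ Hg cdZ gc.
have [hc _] : h c = c /\ h d = d.
  by apply: (component_meet gH nZ Hh cdZ xcd); rewrite hx fg -[c]gc -[d]gd !th_lt.
pose u : F := (g^-1 * h)%g; have Hu : H u by apply: subgroupM => //; exact: subgroupV.
have ux : u x = x by rewrite thM hx fg thK.
have uc : u c = c by rewrite thM hc th_fixV.
have [ycd _] := Yy; have [b cb fb] := cf; have [cx xd] := andP xcd.
have [|w Zw /andP[cw]] := component_down gZ cdZ ycd (b := Num.min x b).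
  by rewrite lt_min cx.
rewrite lt_min => /andP[wx wb].
have Yw := YZ Zw Yy; have [wcd _] := Yw.
apply: (level_fix_rid Hh hc wcd _ Yy).
have := level_fix Hu uc xcd ux Yw; rewrite thM => /(congr1 g); rewrite thVK => ->.
by rewrite -fgY ?fb ?ltW.
Qed.

(** The comparison is transported by [Z] to points so close to [c] that both
    elements are linear there. *)
Lemma level_order s t y : H s -> H t -> s c = c -> t c = c -> Y y -> s y < t y ->
  rslope c s < rslope c t.
Proof.
move=> Hs Ht sc tc Yy lt; have [ycd _] := Yy.
have [b cb sb] := rslopeP c s; have [e ce te] := rslopeP c t.
rewrite sc in sb; rewrite tc in te.
have [|w Zw /andP[cw]] := component_down gZ cdZ ycd (b := Num.min b e).
  by rewrite lt_min cb.
rewrite lt_min => /andP[wb we].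
have : s (w y) < t (w y) by rewrite (level_commute Hs sc Zw Yy) (level_commute Ht tc Zw Yy) th_lt.
rewrite sb ?te ?(ltW cw) ?(ltW wb) ?(ltW we)// ltrD2l ltr_pM2r ?subr_gt0//.
by rewrite ltr_eXz2l// ltr1n.
Qed.

Lemma level_order0 s y : H s -> s c = c -> Y y -> (y < s y) = (0 < rslope c s).
Proof.
move=> Hs sc Yy; have H1 : H 1%g by exact: subgroup1.
have o1 := @level_order 1%g s y H1 Hs (th1 c) sc Yy.
have o2 := @level_order s 1%g y Hs H1 sc (th1 c) Yy.
rewrite rslope1 th1 in o1 o2.
have [ys|sy|e] := ltgtP y (s y); first by rewrite o1.
  by apply/esym/negbTE; rewrite -leNgt ltW// o2.
have [ycd _] := Yy.
by have /rslope0P -> := level_fix_rid Hs sc ycd (esym e) Yy.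
Qed.

End Levels.

(** * Derived length *)

Section DerivedLevels.
Variable R : realType.
Local Notation F := (thompson R).
Implicit Types (f g h s t w z : F) (H K G Z N : set F) (x y a b c d : R) (k j n : nat).

Lemma normalizes_derived H k : subgroup H -> normalizes H (derived_series H k).
Proof. by move=> gH h z Hh Hz; exact: derived_norm. Qed.

Lemma derived_level H k : subgroup H ->
  level H (derived_series H k) (derived_series H k.+1).
Proof.
move=> gH; split; [split=> //; exact: derived_subgroup|exact: derived_sub|
  exact: normalizes_derived|exact: normalizes_derived|].
by move=> z w; exact: derived_commg.
Qed.

Lemma derived_anti H i j : subgroup H -> (i <= j)%N ->
  derived_series H j `<=` derived_series H i.
Proof.
move=> gH; elim: j => [|j IH]; first by rewrite leqn0 => /eqP->.
rewrite leq_eqVlt ltnS => /orP[/eqP->//|/IH ij] x /(derived_succ_sub gH)/ij.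
by [].
Qed.

Lemma rid_subgroup c : subgroup [set f : F | rid c f].
Proof.
by apply/subgroupP; split=> /= [|f g|f]; [exact: rid1|exact: ridM|exact: ridV].
Qed.

Lemma derived_rid H k c f : fixes (derived_series H k) c ->
  derived_series H k.+1 f -> rid c f.
Proof.
move=> cH; move: f; apply: derived_min; first exact: rid_subgroup.
by move=> f g Hf Hg; apply: rid_comm; exact: cH.
Qed.

Lemma fixes_sub Z N x : N `<=` Z -> fixes Z x -> fixes N x.
Proof. by move=> NZ xZ z /NZ; exact: xZ. Qed.

(** Otherwise [(c, d)] would be a component of the next term as well. Consider the
    last term having it as a component. Its elements are products of commutators
    of elements fixing [c], so that their germs at [c] are trivial; but one of
    them moves a point fixed by the following term. *)
Lemma component_fixed H n k c d : subgroup H -> derived_series H n `<=` [set 1%g] ->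
  component (derived_series H k) c d ->
  exists2 y, c < y < d & fixes (derived_series H k.+1) y.
Proof.
move=> gH Hn kcd; apply: contrapT => ne.
have [cd ck dk _] := kcd.
have step j : (k <= j)%N -> (forall y, c < y < d -> ~ fixes (derived_series H j) y) ->
    component (derived_series H j) c d.
  move=> kj nf; split=> //; [apply: fixes_sub ck|apply: fixes_sub dk|].
  - exact: derived_anti.
  - exact: derived_anti.
  by move=> y /nf /not_fixes.
have {ne}all j : (k < j)%N -> component (derived_series H j) c d.
  elim: j => // j IH; rewrite ltnS leq_eqVlt => /orP[/eqP<-|kj].
    by apply: step => // y ycd yf; apply: ne; exists y.
  apply: step => [|y ycd yf]; first by rewrite ltnW// ltnW.
  have [_ _ _ /(_ y ycd)[z Hz]] := IH kj; apply.
  have cj : component (derived_series H j) c d := IH kj.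
  apply: (level_rid (derived_level j gH) cj) => //; first exact: derived_sub Hz.
  case: j kj Hz {IH yf cj} => // j kj Hz; apply: derived_rid Hz.
  by apply: fixes_sub ck; exact: derived_anti.
have [|_ _ _ mv] := all (maxn k.+1 n); first by rewrite leq_maxl.
have [|z Hz] := mv ((c + d) / 2); first by move: cd; lra.
have /Hn -> // : derived_series H n z by apply: derived_anti Hz => //; exact: leq_maxr.
Qed.

(** Commutators descend one level: on a component of the upper term, both
    elements fix the left end, so that their commutator has trivial germ
    there. *)
Lemma piecewise_comm H Z N G f g x : level H Z N -> subgroup (piecewise H) ->
  G `<=` piecewise H ->
  (forall h y, G h -> fixes Z y -> h y = y) -> G f -> G g -> fixes N x ->
  ([~ f, g] : F)%g x = x.
Proof.
move=> HZN gp Gp GZ Gf Gg xN; have [[_ gZ _] _ _ _ _] := HZN.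
have [xZ|/component_exists[//|c [d [cdZ xcd]]]] := pselect (fixes Z x).
  have fx := GZ _ _ Gf xZ; have gx := GZ _ _ Gg xZ.
  by rewrite thR gx fx (th_fixV gx) (th_fixV fx).
have [_ cZ _ _] := cdZ.
apply: (level_piecewise HZN cdZ) => //.
  by apply: (subgroupR gp); exact: Gp.
by apply: rid_comm; exact: GZ.
Qed.

Lemma derived_piecewise_fix H G k j f x : subgroup H -> subgroup G ->
  G `<=` piecewise H ->
  (forall h y, G h -> fixes (derived_series H k) y -> h y = y) ->
  derived_series G j f -> fixes (derived_series H (k + j)) x -> f x = x.
Proof.
move=> gH gG Gp Gk; elim: j f x => [|j IH] f x; first by rewrite addn0; exact: Gk.
move=> Gf; move: f Gf x.
suff : derived_series G j.+1 `<=`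
    [set f | forall x, fixes (derived_series H (k + j.+1)) x -> ev f x = x] by [].
apply: derived_min.
  apply/subgroupP; split=> [x _//|f g fx gx x xH|f fx x xH].
    by rewrite /= thM gx// fx.
  by apply: th_fixV; exact: fx.
move=> f g Gf Gg x; rewrite addnS => xH.
apply: (piecewise_comm (derived_level (k + j) gH) _ _ _ Gf Gg xH).
- exact: piecewise_subgroup.
- by move=> h Gh; apply: Gp; exact: derived_sub Gh.
- by move=> h y Gh yH; exact: IH.
Qed.

Lemma th_eq1 f : (forall x, f x = x) -> f = 1%g.
Proof. by move=> fE; apply: thompson_eq => x; rewrite fE. Qed.

Lemma fixes1 x : fixes [set 1%g] x.
Proof. by move=> _ ->. Qed.

Lemma derived_piecewise1 H n : subgroup H -> derived_series H n `<=` [set 1%g] ->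
  derived_series (piecewise H) n `<=` [set 1%g].
Proof.
move=> gH Hn f pf; apply: th_eq1 => x.
apply: (@derived_piecewise_fix H (piecewise H) 0 n) => //.
- exact: piecewise_subgroup.
- by move=> h y ph yH; exact: piecewise_fix ph yH.
by apply: fixes_sub (@fixes1 x).
Qed.

Lemma piecewise_solvable H n : solvable_of_length H n ->
  solvable_of_length (piecewise H) n.
Proof.
move=> [gH Hn Hk]; have gp := piecewise_subgroup gH.
have sub1 (K : set F) : subgroup K -> K `<=` [set 1%g] -> K = [set 1%g].
  move=> gK K1; apply/seteqP; split=> // _ ->; exact: subgroup1.
split=> // [|k kn pk].
  apply: sub1; first exact: derived_subgroup.
  by apply: derived_piecewise1 => //; rewrite Hn.
apply: (Hk k kn); apply: sub1; first exact: derived_subgroup.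
by rewrite -pk; apply: derivedS; exact: sub_piecewise.
Qed.

End DerivedLevels.

(** * Orbits on dyadic points *)

Section Orbits.
Variable R : realType.
Local Notation F := (thompson R).
Implicit Types (f g h s t w z : F) (H : set F) (x y a b c d : R).

Lemma small_pow2 (e : R) : 0 < e -> exists k : nat, 2 ^- k < e.
Proof.
move=> e0; have [n en] : exists n : nat, e^-1 < n%:R.
  exists (Num.bound e^-1); apply: archi_boundP.
  by rewrite invr_ge0 ltW.
exists n; rewrite -[ltRHS]invrK ltf_pV2 ?posrE ?invr_gt0 ?exprn_gt0//.
apply: lt_trans en _; rewrite -natrX ltr_nat; exact: ltn_expl.
Qed.

Lemma dyadic_between a b : a < b -> exists2 p, dyadic p & a < p < b.
Proof.
move=> ab; have [|k kab] := @small_pow2 (b - a); first by rewrite subr_gt0.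
have k0 : (0 : R) < 2 ^+ k by rewrite exprn_gt0.
exists ((Num.floor (a * 2 ^+ k) + 1)%:~R / 2 ^+ k); first by exists (Num.floor (a * 2 ^+ k) + 1), k.
rewrite ltr_pdivlMr// floorD1_gt /=.
have fl : (Num.floor (a * 2 ^+ k))%:~R <= a * 2 ^+ k by exact: ge_floor.
rewrite ltr_pdivrMr// intrD.
have : 1 < (b - a) * 2 ^+ k by rewrite -ltr_pdivrMr// mul1r.
by move: fl; lra.
Qed.

Lemma infinite_dyadic a b : a < b -> infinite_set [set x | dyadic x /\ a < x < b].
Proof.
move=> ab fin; have [p pD /andP[ap pb]] := dyadic_between ab.
have [|k kb] := @small_pow2 (b - p); first by rewrite subr_gt0.
pose q (j : nat) : R := p + 2 ^- (k + j).
apply: infinite_nat; rewrite -(_ : q @^-1` [set x | dyadic x /\ a < x < b] = setT).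
  apply: finite_preimage fin => i j _ _ /addrI/invr_inj/eqP.
  by rewrite eq_le !ler_eXn2l ?ltr1n// -eqn_leq eqn_add2l => /eqP.
apply/seteqP; split=> // j _ /=.
have q0 : (0 : R) < 2 ^- (k + j) by rewrite invr_gt0 exprn_gt0.
have qk : (2 : R) ^- (k + j) <= 2 ^- k.
  by rewrite lef_pV2 ?posrE ?exprn_gt0// ler_eXn2l ?ltr1n// leq_addr.
rewrite /q; split; last by move: ap kb q0 qk; lra.
by apply: dyadicD => //; exists 1, (k + j)%N; rewrite mul1r.
Qed.

Lemma finite_intervalz (m : int) : finite_set [set k : int | - m < k < m].
Proof.
apply: (@sub_finite_set _ _ ((fun n : nat => n%:Z - m) @` `I_(absz (m + m)%R))).
  move=> k /= km; exists (absz (k + m)%R); lia.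
exact: finite_image.
Qed.

(** The stabiliser of a component of the last nontrivial derived subgroup acts
    freely on it, through the discrete group of slopes at its left end: an
    orbit meets a fundamental domain of one nontrivial element in finitely many
    points, while there are infinitely many dyadic points in it. *)
Lemma infinite_orbits H n : solvable_of_length H n ->
  infinite_set [set thompson_orbit H x | x in @dyadic01 R].
Proof.
move=> [gH Hn Hk] fin; have H1 := subgroup1 gH.
case: n => [|n] in Hn Hk.
  have fin1 : finite_set [set thompson_orbit H x | x in @dyadic01 R] := fin.
  apply: (@infinite_dyadic 0 1 ltr01).
  have -> : [set x : R | dyadic x /\ 0 < x < 1] =
      (fun x => [set x]) @^-1` [set thompson_orbit H x | x in @dyadic01 R].
    rewrite /= in Hn; apply/seteqP; split=> [x xD|x [y yD]] /=.
      exists x => //; rewrite Hn; apply/seteqP; split=> [_ [_ -> <-]//|_ ->].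
      by exists 1%g.
    rewrite Hn => /seteqP[yx _]; have := yx y; rewrite /= => <- //.
    by exists 1%g.
  apply: finite_preimage fin1 => x y _ _ /seteqP[xy _].
  exact: xy.
have gZ := derived_subgroup n gH.
have [[z0 Zz0 z01]|ne] := pselect (exists2 z : F, derived_series H n z & z <> 1%g); last first.
  apply: (Hk n) => //; apply/seteqP; split=> [z Zz|_ ->]; last exact: subgroup1.
  by apply: contrapT => z1; apply: ne; exists z.
have [x xZ] : exists x, ~ fixes (derived_series H n) x.
  apply: contrapT => ne; apply: z01; apply: th_eq1 => x; apply: contrapT => zx.
  by apply: ne; exists x => /(_ z0 Zz0).
have [c [d [cdZ xcd]]] := component_exists gZ xZ.
have HZN := derived_level n gH.
have Y y : c < y < d -> c < y < d /\ fixes (derived_series H n.+1) y.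
  by move=> ycd; split=> //; rewrite Hn; exact: fixes1.
have nZ := @normalizes_derived R H n gH.
have [_ cZ dZ cdmv] := cdZ.
have [z Zz xz] : exists2 z : F, derived_series H n z & x < z x.
  have [z Zz zx] := cdmv x xcd.
  have [xz|xz] := ltP x (z x); first by exists z.
  exists z^-1%g; first exact: (subgroupV gZ).
  by rewrite -(th_lt z) thVK lt_neqAle xz andbT; apply/eqP.
have Hz : H z by exact: derived_sub Zz.
have zc := cZ z Zz; have zd := dZ z Zz.
have zxd : z x < d by rewrite -zd th_lt; case/andP: xcd.
pose J := [set y : R | dyadic y /\ x < y < z x].
have Jcd y : J y -> c < y < d.
  by move=> [_ /andP[xy yz]]; case/andP: xcd => cx _; rewrite (lt_trans cx)//= (lt_trans yz).
have J01 y : J y -> dyadic01 y.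
  move=> Jy; split; first by case: Jy.
  apply: contrapT => /negP y01; have [w Zw] := cdmv y (Jcd y Jy).
  by apply; exact: fixes_out.
apply: (infinite_dyadic xz); rewrite -/J.
apply: (@sub_finite_set _ _ (\bigcup_(O in [set thompson_orbit H y | y in @dyadic01 R]) (J `&` O))).
  move=> y Jy; exists (thompson_orbit H y); first by exists y => //; exact: J01.
  by split=> //; exists 1%g.
apply: bigcup_finite => // _ [p _ <-].
have [[y0 [Jy0 [h0 Hh0 hp]]]|nJ] := pselect (J `&` thompson_orbit H p !=set0); last first.
  apply: (@sub_finite_set _ _ set0) => // y Jy; apply: nJ; by exists y.
(* The slope at [c] of an element of the stabiliser determines the image of
   [y0], and it lies between those of [z^-1] and of [z]. *)
pose S k := [set y : R | exists h : F, [/\ H h, h c = c, rslope c h = k & y = h y0]].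
apply: (@sub_finite_set _ _ (\bigcup_(k in [set k | - rslope c z < k < rslope c z]) S k)).
  move=> y [Jy [h1 Hh1 hy]].
  pose h : F := (h1 * h0^-1)%g.
  have Hh : H h by apply: (subgroupM gH) => //; exact: subgroupV.
  have hE : h y0 = y by rewrite thM -hp thK.
  have [hc _] : h c = c /\ h d = d.
    by apply: (component_meet gH nZ Hh cdZ (Jcd _ Jy0)); rewrite hE; exact: Jcd.
  have Y0 := Y _ (Jcd _ Jy0).
  have [_ /andP[xy yz]] := Jy; have [_ /andP[xy0 y0z]] := Jy0.
  exists (rslope c h); last by exists h.
  apply/andP; split.
    rewrite -rslopeV//; apply: (level_order HZN cdZ _ Hh _ hc Y0).
    - exact: subgroupV.
    - exact: th_fixV.
    - by rewrite hE; apply: lt_trans xy; rewrite -(th_lt z) thVK.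
  apply: (level_order HZN cdZ Hh Hz hc zc Y0).
  by rewrite hE; apply: lt_trans yz _; rewrite th_lt.
apply: bigcup_finite; first exact: finite_intervalz.
move=> k _.
have Y0 := Y _ (Jcd _ Jy0).
have Suniq y y' : S k y -> S k y' -> y = y'.
  move=> [h [Hh hc hk ->]] [h' [Hh' hc' hk' ->]].
  have [lt|lt|//] := ltgtP (h y0) (h' y0).
    by have := level_order HZN cdZ Hh Hh' hc hc' Y0 lt; rewrite hk hk' ltxx.
  by have := level_order HZN cdZ Hh' Hh hc' hc Y0 lt; rewrite hk hk' ltxx.
have [[y Sy]|nS] := pselect (S k !=set0).
  by apply: sub_finite_set (finite_set1 y) => y' Sy'; exact: Suniq.
by apply: (@sub_finite_set _ _ set0) => // y Sy; apply: nS; exists y.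
Qed.

End Orbits.

Lemma PoszS (n : nat) : n.+1%:Z = n%:Z + 1.
Proof. by rewrite intS addrC. Qed.

(** * Homomorphisms to the integers and finite generation *)

Section IntegerPowers.
Variable G : groupType.
Implicit Types (z : G) (i j : int) (H : set G).
Local Open Scope group_scope.

Definition zexp z i : G :=
  match i with Posz n => z ^+ n | Negz n => z^-1 ^+ n.+1 end.

Lemma zexpS z i : zexp z (i + 1)%R = zexp z i * z.
Proof.
case: i => [n|[|n]].
- by rewrite -PoszS; exact: expgSr.
- by apply: esym; exact: mulVg.
rewrite (_ : (Negz n.+1 + 1)%R = Negz n); last by rewrite !NegzE [in LHS]PoszS; ring.
transitivity (z^-1 ^+ n.+1 * z^-1 * z); first by rewrite -mulgA mulVg mulg1.
by congr (_ * z); exact: esym (expgSr _ _).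
Qed.

Lemma zexpP z i : zexp z (i - 1)%R = zexp z i * z^-1.
Proof. by rewrite -{2}(subrK 1%R i) zexpS -mulgA mulgV mulg1. Qed.

Lemma zexpD z i j : zexp z (i + j)%R = zexp z i * zexp z j.
Proof.
elim/int_rect: j => [|n IH|n IH]; first by rewrite addr0 mulg1.
  have -> : (i + n.+1%:Z = i + n%:Z + 1)%R by rewrite PoszS addrA.
  by rewrite zexpS IH PoszS zexpS mulgA.
have -> : (i + - n.+1%:Z = i - n%:Z - 1)%R by rewrite PoszS opprD addrA.
have -> : (- n.+1%:Z = - n%:Z - 1)%R by rewrite PoszS opprD.
by rewrite zexpP IH zexpP mulgA.
Qed.

Lemma zexpN z i : zexp z (- i)%R = (zexp z i)^-1.
Proof.
apply: (mulgI (zexp z i)); rewrite -zexpD subrr mulgV; exact: expg0.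
Qed.

Lemma zexp1 z : zexp z 1%R = z. Proof. exact: expg1. Qed.

Lemma zexp_in H z i : subgroup H -> H z -> H (zexp z i).
Proof. by move=> gH Hz; case: i => n; apply: subgroupX => //; exact: subgroupV. Qed.

Lemma generated_zexp z w : generated [set z] w -> exists i, w = zexp z i.
Proof.
move: w; apply: generated_min; last by move=> _ ->; exists 1%R; rewrite zexp1.
apply/subgroupP; split=> [|_ _ [i ->] [j ->]|_ [i ->]]; first by exists 0%R.
  by exists (i + j)%R; rewrite zexpD.
by exists (- i)%R; rewrite zexpN.
Qed.

Definition additive_on H (la : G -> int) :=
  forall f g, H f -> H g -> la (f * g) = (la f + la g)%R.

Lemma additive_zexp H la z i : subgroup H -> additive_on H la -> H z ->
  la (zexp z i) = (i * la z)%R.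
Proof.
move=> gH laM Hz; have H1 := subgroup1 gH.
have la1 : la 1 = 0%R.
  by have := laM _ _ H1 H1; rewrite mulg1 => /eqP; rewrite -subr_eq subrr => /eqP.
have Hzi j : H (zexp z j) by exact: zexp_in.
elim/int_rect: i => [|m IH|m IH]; first by rewrite mul0r; exact: la1.
  by rewrite PoszS zexpS laM// IH; ring.
have := laM _ _ (Hzi (- m.+1%:Z)%R) Hz; rewrite -zexpS PoszS opprD subrK IH.
by move/eqP; rewrite -subr_eq => /eqP <-; ring.
Qed.

(** Division with remainder by the least positive value. *)
Lemma least_positive H (la : G -> int) : subgroup H ->
  additive_on H la ->
  (exists2 f, H f & la f <> 0%R) ->
  exists2 z, H z & (0 < la z)%R /\ forall f, H f -> exists i, la f = (i * la z)%R.
Proof.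
move=> gH laM [f0 Hf0 f0N].
have laV f : H f -> la f^-1 = (- la f)%R.
  by move=> Hf; have := additive_zexp (- 1)%R gH laM Hf; rewrite zexpN zexp1 => ->; ring.
have [n0 n0P] : exists n : nat, `[< exists2 f, H f & la f = (n.+1 : int) >].
  have [lt|lt|//] := ltgtP (la f0) 0%R.
    exists (absz (la f0)).-1; apply/asboolP; exists f0^-1; first exact: subgroupV.
    by rewrite laV//; move: lt; lia.
  by exists (absz (la f0)).-1; apply/asboolP; exists f0 => //; move: lt; lia.
have [n /asboolP[z Hz zn] nmin] := ex_minnP (ex_intro (fun n : nat => `[< exists2 f, H f & la f = (n.+1 : int) >]) n0 n0P).
exists z => //; split=> [|f Hf]; first by rewrite zn.
have Hzi i : H (zexp z i) by exact: zexp_in.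
have laZ i := additive_zexp i gH laM Hz.
pose q := (la f %/ la z)%Z; exists q.
have zN : la z != 0%R by rewrite zn.
have Hfz : H (f * zexp z (- q)%R) by apply: (subgroupM gH) => //; exact: zexp_in.
have rE : la (f * zexp z (- q)%R) = (la f %% la z)%Z.
  by rewrite (laM _ _ Hf (Hzi _)) laZ {1}(divz_eq (la f) (la z)) -/q; ring.
have r0 : (0 <= (la f %% la z)%Z)%R by rewrite modz_ge0.
have r1 : ((la f %% la z)%Z < la z)%R by rewrite ltz_pmod// zn.
have [r0'|r0'] := eqVneq (la f %% la z)%Z 0%R.
  by rewrite {1}(divz_eq (la f) (la z)) r0' addr0.
have : (n <= (absz (la f %% la z)%Z).-1)%N.
  apply: nmin; apply/asboolP; exists (f * zexp z (- q)%R) => //.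
  by rewrite rE; move: r0 r0'; lia.
by move: r0 r0' r1; rewrite zn; lia.
Qed.

End IntegerPowers.

Section CoveredSets.
Variable G : groupType.
Implicit Types (C M A H : set G) (f g z : G).

(** Finite generation, relative to an ambient set, of a set that may lack both the
    generators and the products. *)
Definition covered C M := exists A, [/\ finite_set A, A `<=` C & M `<=` generated A].

Lemma covered_fg C : subgroup C -> covered C C -> finitely_generated C.
Proof.
move=> gC [A [fA AC CA]]; exists A => //; apply/seteqP; split=> //.
exact: generated_min.
Qed.

Lemma covered_sub C M M' : M `<=` M' -> covered C M' -> covered C M.
Proof. by move=> MM' [A [fA AC M'A]]; exists A; split=> // x /MM'/M'A. Qed.

Lemma covered1 C M : M `<=` [set 1%g] -> covered C M.
Proof.
move=> M1; exists set0; split=> // x /M1 ->.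
by apply: subgroup1; exact: generated_subgroup.
Qed.

Lemma covered_mul C M M1 M2 : covered C M1 -> covered C M2 ->
  (forall f, M f -> exists g h, [/\ M1 g, M2 h & f = (g * h)%g]) -> covered C M.
Proof.
move=> [A [fA AC M1A]] [B [fB BC M2B]] MM; exists (A `|` B); split=> [|x []|f /MM].
- by rewrite finite_setU.
- exact: AC.
- exact: BC.
move=> [g [h [/M1A gA /M2B hB ->]]].
apply: (subgroupM (generated_subgroup (A `|` B))).
  by apply: generatedS gA => x; left.
by apply: generatedS hB => x; right.
Qed.

(** The kernel and a preimage of a generator of the image generate. *)
Lemma covered_ker C M (la : G -> int) : subgroup M -> M `<=` C ->
  additive_on M la ->
  covered C [set f | M f /\ la f = 0] -> covered C M.
Proof.
move=> gM MC laM cK.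
have [ne|ne] := pselect (exists2 f, M f & la f <> 0); last first.
  apply: covered_sub cK => f Mf; split=> //; apply: contrapT => lf.
  by apply: ne; exists f.
have [z Mz [z0 zdiv]] := least_positive gM laM ne.
have cz : covered C (generated [set z]).
  by exists [set z]; split=> // _ ->; exact: MC.
apply: (covered_mul cK cz) => f Mf; have [i fi] := zdiv f Mf.
have Mzi j : M (zexp z j) by exact: zexp_in.
exists (f * zexp z (- i))%g, (zexp z i); split.
- split; first exact: subgroupM.
  by rewrite laM// (additive_zexp _ gM laM Mz) fi; ring.
- by apply: (zexp_in _ (generated_subgroup _)); exact: sub_generated.
- by rewrite -mulgA -zexpD addNr mulg1.
Qed.

End CoveredSets.

(** * Components of finitely generated solvable groups *)

Section DyadicFixedPoint.
Variable R : realType.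
Local Notation F := (thompson R).
Implicit Types (f g h s t w z b : F) (H K G Z N : set F) (x y a c d : R) (k j n : nat).

Lemma component_in H Z c d p : subgroup H -> component H c d -> c < p < d ->
  Z `<=` H -> forall r1 r2, component Z r1 r2 -> r1 < p < r2 -> c <= r1 /\ r2 <= d.
Proof.
move=> gH [_ cH dH _] /andP[cp pd] ZH r1 r2 [_ _ _ mv] /andP[r1p pr2].
split; rewrite leNgt; apply/negP => lt.
  by have [|z /ZH Hz] := mv c; [rewrite lt (lt_trans cp)|apply; exact: cH].
by have [|z /ZH Hz] := mv d; [rewrite lt (lt_trans r1p)|apply; exact: dH].
Qed.

(** The component of the derived group cannot start at [c]: its right end would be
    fixed by [H], which preserves the components of the derived group, so that it
    would be the whole component of [H]. *)
Lemma component_in_lt H n c d p r1 r2 : subgroup H -> derived_series H n `<=` [set 1%g] ->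
  component H c d -> c < p < d -> component (derived_series H 1) r1 r2 ->
  r1 < p < r2 -> c < r1.
Proof.
move=> gH Hn cdH pcd r12 pr.
have D1H : derived_series H 1 `<=` H := derived_succ_sub (k := 0) gH.
have [cr rd] := component_in gH cdH pcd D1H r12 pr.
rewrite lt_neqAle cr andbT; apply/eqP => e; rewrite -e in r12 pr.
have [_ cH dH cdmv] := cdH.
have r2H : fixes H r2.
  move=> h Hh.
  exact: component_stab gH (normalizes_derived (k := 1) gH) Hh r12 (cH h Hh).
have [r2d|r2d] := ltP r2 d.
  have [|h Hh] := cdmv r2; last by apply; exact: r2H.
  by rewrite r2d andbT; move: pr; lra.
have {r2d}r2d : r2 = d by apply/eqP; rewrite eq_le rd.
have [y ycd yH] := component_fixed (k := 0) gH Hn cdH.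
have [_ _ _ mv] := r12; have [|w Hw] := mv y; first by rewrite r2d.
by apply; exact: yH.
Qed.

(** Take [b] in the derived group with nontrivial germ at the left end of one of
    its components, and consider the leftmost point fixed by the derived group at
    which the right germ of [b] is nontrivial. If it were not dyadic, the left
    germ of [b] there would be nontrivial too, so that it would be the right end
    of a component of the derived group, and [b] would have nontrivial germ at the
    left end of this component. *)
Lemma component_dyadic H n c d y : subgroup H -> derived_series H n `<=` [set 1%g] ->
  component H c d -> c < y < d -> ~ fixes (derived_series H 1) y ->
  exists2 x, dyadic x & c < x < d /\ fixes (derived_series H 1) x.
Proof.
move=> gH Hn cdH ycd yN; set D1 := derived_series H 1.
have gD1 : subgroup D1 by exact: derived_subgroup.
have L1 := derived_level 1 gH.
have D1H : D1 `<=` H := derived_succ_sub (k := 0) gH.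
have [_ cH dH _] := cdH.
have [q [q' [qD1 yq]]] := component_exists gD1 yN.
have cq := component_in_lt gH Hn cdH ycd qD1 yq.
have [t tq tD2] := component_fixed gH Hn qD1.
have [_ qfix _ qmv] := qD1; have [b Db bt] := qmv t tq.
have bq : ~ rid q b.
  by move=> bq; apply: bt; apply: (level_rid L1 qD1 (D1H _ Db) bq).
have [b0 cb0 bb0] : rid c b by apply: (@derived_rid _ H 0).
pose E := [set e : R | [/\ c < e <= q, fixes D1 e & ~ rid e b]].
have Eq : E q by split=> //; rewrite cq lexx.
have Elb e : E e -> b0 <= e.
  move=> [/andP[ce _] _ be]; rewrite leNgt; apply/negP => eb0; apply: be.
  exists b0 => // x /andP[ex xb]; apply: bb0.
  by rewrite xb (le_trans (ltW ce)).
have Ehi : has_inf E by split; [exists q|exists b0].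
have Ehl : has_lbound E by exists b0.
pose y0 := inf E.
have y0D : fixes D1 y0.
  apply: fixes_inf => // z e Dz [? eD be]; exists e => //.
  by rewrite eD.
have cy0 : c < y0 by apply: lt_le_trans cb0 _; apply: lb_le_inf; [exists q|].
have y0q : y0 <= q by apply: ge_inf.
have y0d : y0 < d by apply: le_lt_trans y0q _; move: yq ycd; lra.
have y0N : ~ rid y0 b.
  move=> [b1 yb1 bb1]; suff : b1 <= y0 by rewrite leNgt yb1.
  apply: lb_le_inf; first by exists q.
  move=> e Ee; have y0e : y0 <= e by apply: ge_inf.
  rewrite leNgt; apply/negP => eb1; have [_ _] := Ee; apply.
  exists b1 => // x /andP[ex xb]; apply: bb1.
  by rewrite xb (le_trans y0e).
have [y0dy|y0nd] := pselect (dyadic y0); first by exists y0 => //; rewrite cy0.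
exfalso; have [bl|[b2 b2y0 bb2]] := lgerm_dich (y0D b Db).
  by apply: y0N; exact: nondyadic_lid.
pose p := (Num.max b2 c + y0) / 2.
have mx : Num.max b2 c < y0 by rewrite gt_max b2y0.
have mx1 : b2 <= Num.max b2 c by rewrite le_max lexx.
have mx2 : c <= Num.max b2 c by rewrite le_max lexx orbT.
have b2p : b2 < p by rewrite /p; lra.
have py0 : p < y0 by rewrite /p; lra.
have pcd : c < p < d by rewrite (lt_trans py0)// andbT /p; lra.
have [|r1 [r2 [rD1 pr]]] := component_exists gD1 (x := p).
  by move=> /(_ b Db); apply: bb2; rewrite ltW.
have cr1 := component_in_lt gH Hn cdH pcd rD1 pr.
have [r12 r1D r2D rmv] := rD1; have /andP[r1p pr2] := pr.
have r2y0 : r2 = y0.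
  apply/eqP; rewrite eq_le !leNgt; apply/andP; split; apply/negP => lt.
    by have [|w Dw] := rmv y0; [rewrite lt (lt_trans r1p)|apply; exact: y0D].
  by apply: (bb2 r2); rewrite ?lt ?r2D// (le_trans (ltW b2p) (ltW pr2)).
have [br1|br1] := pselect (rid r1 b); last first.
  have : E r1 by split=> //; rewrite cr1 (le_trans (ltW (lt_trans r1p py0))).
  by move=> /(ge_inf Ehl); rewrite leNgt (lt_trans r1p py0).
have [t' tr' tD'] := component_fixed gH Hn rD1.
have [|w Dw /andP[wb2 wr2]] := component_up gD1 rD1 tr' (b := b2); first by rewrite r2y0.
apply: (bb2 (w t')); first by rewrite -r2y0 wr2 ltW.
apply: (level_rid L1 rD1 (D1H _ Db) br1); split.
  by rewrite wr2 -(r1D w Dw) th_lt; case/andP: tr' => ->.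
by apply: fixes_norm tD'; [exact: normalizes_derived gH|exact: D1H].
Qed.

End DyadicFixedPoint.

Section FinitelyManyComponents.
Variable R : realType.
Local Notation F := (thompson R).
Implicit Types (f g h a : F) (H : set F) (x y c d : R).

Lemma finite_inj (T U : Type) (S : set T) (D : set U) (p : T -> U) :
  finite_set D -> (forall u, S u -> D (p u)) ->
  (forall u v, S u -> S v -> p u = p v -> u = v) -> finite_set S.
Proof.
move=> fD SD pinj.
apply: (@sub_finite_set _ _ (\bigcup_(i in D) [set u | S u /\ p u = i])).
  by move=> u Su; exists (p u); [exact: SD|].
apply: bigcup_finite => // i _.
have [[u [Su pu]]|nS] := pselect ([set u | S u /\ p u = i] !=set0).
  apply: sub_finite_set (finite_set1 u) => v [Sv pv]; apply: pinj => //.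
  by rewrite pu.
by apply: (@sub_finite_set _ _ set0) => // u Su; apply: nS; exists u.
Qed.

(** Between two fixed points of an element at which its right germ is
    nontrivial there is a breakpoint. *)
Lemma finite_rigid a : finite_set [set c | a c = c /\ ~ rid c a].
Proof.
have [_ _ [s [_ saff]] _] := thompsonP a.
(* The breakpoints control the element on [[0, 1]] only. *)
pose l := [:: 0, 1 & s]; pose rank c := count (fun p => p <= c) l.
apply: (@finite_inj R nat _ `I_(size l).+1 rank) => [//|c _|c c'].
  by rewrite /= ltnS; exact: count_size.
have lt u v : a u = u -> ~ rid u a -> a v = v -> u < v ->
    (rank u < rank v)%N.
  move=> au uN av uv.
  have [p ps /andP[up pv]] : exists2 p, p \in l & u < p <= v.
    apply: contrapT => np.
    have npP p : p \in l -> ~~ (u < p <= v).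
      by move=> ps; apply/negP => uvp; apply: np; exists p.
    have [u0|u0] := ltP u 0.
      by apply: uN; exists (u / 2) => [|x ux]; [lra|apply: th_out; lra].
    have [u1|u1] := leP 1 u.
      apply: uN; exists (u + 1) => [|x ux]; first lra.
      have [->|xu] := eqVneq x u; first exact: au.
      by apply: th_out; move: ux xu; lra.
    have v1 : v <= 1.
      have := npP 1; rewrite /l !inE eqxx orbT => /(_ isT).
      by move: u1; lra.
    have [|k aE] := saff u v u0 (ltW uv) v1.
      move=> p ps; have := npP p; rewrite /l !inE ps !orbT => /(_ isT).
      by apply: contra => /andP[-> /ltW].
    apply: uN; exists v => // x uxv; rewrite aE// au.
    have := aE v; rewrite lexx (ltW uv) av au => /(_ isT) E.
    have k1 : 2 ^ k = 1 :> R.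
      by apply: (affine_fix _ (esym E)); rewrite gt_eqF.
    by rewrite k1; ring.
  apply: (count_ltn (e := p)) => //; last by rewrite -ltNge.
  by move=> q /= qu; exact: le_trans qu (ltW uv).
move=> [ac cN] [ac' cN'] e; have [cc|cc|//] := ltgtP c c'.
  by have := lt c c' ac cN ac' cc; rewrite e ltnn.
by have := lt c' c ac' cN' ac cc; rewrite e ltnn.
Qed.

Lemma component_right_eq H c d d' : component H c d -> component H c d' -> d = d'.
Proof.
move=> cdH cdH'; have [cd _ _ _] := cdH; have [cd' _ _ _] := cdH'.
pose x := (c + Num.min d d') / 2.
have m : c < Num.min d d' by rewrite lt_min cd.
have m1 : Num.min d d' <= d by rewrite ge_min lexx.
have m2 : Num.min d d' <= d' by rewrite ge_min lexx orbT.
by have [] := @component_eq _ _ _ _ _ _ x cdH cdH'; rewrite /x //; move: m m1 m2; lra.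
Qed.

Lemma component_germ H n A c d : subgroup H -> derived_series H n `<=` [set 1%g] ->
  H = generated A -> component H c d -> exists2 a, A a & ~ rid c a.
Proof.
move=> gH Hn HA cdH; apply: contrapT => ne.
have [y ycd yH] := component_fixed (k := 0) gH Hn cdH.
have [_ _ _ mv] := cdH; have [h Hh] := mv y ycd; apply.
apply: (level_rid (derived_level 0 gH) cdH) => //.
have : H `<=` [set f | rid c f]; last exact.
rewrite HA; apply: generated_min; first exact: rid_subgroup.
by move=> a Aa; apply: contrapT => ca; apply: ne; exists a.
Qed.

(** Some generator has a nontrivial germ at the left end of each component. *)
Lemma finite_components H n : subgroup H -> derived_series H n `<=` [set 1%g] ->
  finitely_generated H -> finite_set [set c | exists d, component H c d].
Proof.
move=> gH Hn [A fA HA].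
apply: (@sub_finite_set _ _ (\bigcup_(a in A) [set c | ev a c = c /\ ~ rid c a])).
  move=> c [d cdH]; have [a Aa ca] := component_germ gH Hn HA cdH.
  exists a => //; split=> //; have [_ cH _ _] := cdH; apply: cH.
  by rewrite HA; exact: sub_generated.
by apply: bigcup_finite => // a _; exact: finite_rigid.
Qed.

End FinitelyManyComponents.

(** * The closure on one component *)

Section FundamentalDomain.
Variable R : realType.
Local Notation F := (thompson R).
Implicit Types (f g h k t w a : F) (y b : R) (i j : int).

Lemma component_01 (Z : set F) c d : component Z c d -> 0 <= c /\ d <= 1.
Proof.
move=> [cd _ _ mv]; split; rewrite leNgt; apply/negP => lt.
  have m : c < Num.min d 0 by rewrite lt_min cd.
  have m1 : Num.min d 0 <= d by rewrite ge_min lexx.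
  have m2 : Num.min d 0 <= 0 :> R by rewrite ge_min lexx orbT.
  have [|z Zz] := mv ((c + Num.min d 0) / 2); first by move: m m1; lra.
  by apply; apply: th_out; move: m m2; lra.
have m : Num.max c 1 < d by rewrite gt_max cd.
have m1 : c <= Num.max c 1 by rewrite le_max lexx.
have m2 : 1 <= Num.max c 1 by rewrite le_max lexx orbT.
have [|z Zz] := mv ((Num.max c 1 + d) / 2); first by move: m m1; lra.
by apply; apply: th_out; move: m m2; lra.
Qed.

(* The element [z] generates the group of germs of [H] at [c], and the interval
   from [x] to [z x] is a fundamental domain for it on the component. *)
Variables (H : set F) (n : nat) (c d x : R) (z : F).
Hypotheses (gH : subgroup H) (Hn : derived_series H n.+1 `<=` [set 1%g]).
Hypotheses (cdH : component H c d) (xD : dyadic x) (xcd : c < x < d).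
Hypothesis xD1 : fixes (derived_series H 1) x.
Hypotheses (Hz : H z) (z_gt0 : 0 < rslope c z).
Hypothesis zdiv : forall h, H h -> exists i, rslope c h = i * rslope c z.

Local Notation D1 := (derived_series H 1).
Local Notation x' := (ev z x).
Let L0 : level H H D1 := derived_level 0 gH.
Let cH : fixes H c. Proof. by case: cdH. Qed.
Let dH : fixes H d. Proof. by case: cdH. Qed.
Let Hzi i : H (zexp z i). Proof. exact: zexp_in. Qed.

Let xx' : x < x'.
Proof. by rewrite (level_order0 L0 cdH) //; exact: cH. Qed.

Let H_cd h y : H h -> c < y < d -> c < h y < d.
Proof. by move=> Hh /andP[cy yd]; rewrite -{1}(cH Hh) -{1}(dH Hh) !th_lt cy. Qed.

Let H_D1 h y : H h -> fixes D1 y -> fixes D1 (h y).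
Proof. by move=> Hh; exact: (fixes_norm (normalizes_derived (k := 1) gH) Hh). Qed.

Let x'cd : c < x' < d. Proof. exact: H_cd. Qed.
Let x'D1 : fixes D1 x'. Proof. exact: H_D1. Qed.
Let x'D : dyadic x'. Proof. exact: th_dyadic. Qed.
Let x0 : 0 <= x.
Proof. by have [c0 _] := component_01 cdH; case/andP: xcd => /ltW /(le_trans c0). Qed.
Let x1 : x' <= 1.
Proof. by have [_ d1] := component_01 cdH; case/andP: x'cd => _ /ltW /le_trans ->. Qed.

Definition germ_kernel : set F := [set h | H h /\ rid c h].
Local Notation K := germ_kernel.

Lemma germ_kernel_subgroup : subgroup K.
Proof.
apply/subgroupP; split=> [|f g [Hf cf] [Hg cg]|f [Hf cf]]; split.
- exact: subgroup1.
- exact: rid1.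
- exact: subgroupM.
- exact: ridM.
- exact: subgroupV.
- exact: ridV.
Qed.

Let K_fix k y : K k -> c < y < d -> fixes D1 y -> k y = y.
Proof. by move=> [Hk ck] ycd yD; apply: (level_rid L0 cdH). Qed.

Definition restrict_domain (k : F) : F := cut x x' k.
Local Notation rho := restrict_domain.

Let rhoE k y : K k -> rho k y = if x <= y <= x' then k y else y.
Proof.
by move=> Kk; apply: cutE => //; [exact: ltW|exact: K_fix|exact: K_fix].
Qed.

Let K_dom k y : K k -> x <= y <= x' -> x <= k y <= x'.
Proof.
move=> Kk /andP[xy yx]; rewrite -{1}(K_fix Kk xcd xD1).
by rewrite -(K_fix Kk x'cd x'D1) !th_le xy.
Qed.

Let rhoM k k' : K k -> K k' -> rho (k * k')%g = (rho k * rho k')%g.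
Proof.
move=> Kk Kk'; have Kkk' := subgroupM germ_kernel_subgroup Kk Kk'.
apply: thompson_eq => y; rewrite thM !rhoE//.
have [yI|yI] := boolP (x <= y <= x'); first by rewrite thM K_dom.
by rewrite (negbTE yI).
Qed.

Let rhoV k : K k -> rho k^-1%g = (rho k)^-1%g.
Proof.
move=> Kk; have KV := subgroupV germ_kernel_subgroup Kk.
apply: (mulgI (rho k)); rewrite -rhoM// !mulgV.
apply: thompson_eq => y; rewrite rhoE ?th1; first by case: ifP.
exact: subgroup1 germ_kernel_subgroup.
Qed.

Definition domain_group : set F := rho @` K.
Local Notation HI := domain_group.

Lemma domain_group_subgroup : subgroup HI.
Proof.
have gK := germ_kernel_subgroup; have K1 := subgroup1 gK.
apply/subgroupP; split=> [|_ _ [k Kk <-] [k' Kk' <-]|_ [k Kk <-]].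
- by exists 1%g => //; apply: thompson_eq => y; rewrite rhoE// th1; case: ifP.
- by exists (k * k')%g; [exact: subgroupM|exact: rhoM].
- by exists k^-1%g; [exact: subgroupV|exact: rhoV].
Qed.

Definition domain_closure : set F :=
  [set f | piecewise H f /\ forall y, ~~ (x <= y <= x') -> f y = y].
Local Notation CI := domain_closure.

Let CI_rid f : CI f -> rid c f.
Proof.
move=> [_ fo]; exists ((c + x) / 2); first by case/andP: xcd; lra.
by move=> y yc; apply: fo; case/andP: xcd; move: yc; lra.
Qed.

Let CI_fix f y : CI f -> fixes D1 y -> f y = y.
Proof.
move=> CIf yD; have [pf fo] := CIf.
have [yI|/fo//] := boolP (x <= y <= x').
apply: (level_piecewise L0 cdH pf (CI_rid CIf)); split=> //.
by case/andP: xcd; case/andP: x'cd; move: yI; lra.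
Qed.

Let HI_CI : HI `<=` CI.
Proof.
move=> _ [k Kk <-]; have [Hk _] := Kk; split=> [|y yI]; last by rewrite rhoE// (negbTE yI).
apply: cut_piecewise => //; [exact: ltW|exact: K_fix|exact: K_fix|exact: sub_piecewise].
Qed.

Let id_across f u v : CI f -> u <= v -> ~~ (u < x < v) -> ~~ (u < x' < v) ->
  ~ (x <= u /\ v <= x') -> forall y, u <= y <= v -> f y = y.
Proof.
move=> CIf uv ux ux' nI y yuv; have [_ fo] := CIf.
have [yI|/fo//] := boolP (x <= y <= x').
have [->|yx] := eqVneq y x; first exact: CI_fix.
have [->|yx'] := eqVneq y x'; first exact: CI_fix.
by case: nI; move: xx' ux ux' yuv yI yx yx'; split; lra.
Qed.

(** An element of [H] that agrees at a point of the fundamental domain with an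
    element piecewise in [H] supported there has trivial germ at [c] by
    [level_meet], so that it has a restriction to the domain. *)
Lemma piecewise_domain_group : piecewise HI = CI.
Proof.
apply/seteqP; split=> f.
  move=> pf; have [s [sD fHI]] := pf; split; last first.
    move=> y yI; have [h [k Kk <-] ->] := piecewise_pt y pf.
    by rewrite rhoE// (negbTE yI).
  exists [:: x, x' & s]; split=> [p|u v uv uvP].
    by rewrite !inE => /or3P[/eqP->|/eqP->|/sD].
  have [|r [k Kk <-] fr] := fHI u v uv.
    by move=> p ps; apply: uvP; rewrite !inE ps !orbT.
  have ux := uvP x; rewrite !inE eqxx in ux; move/(_ isT) in ux.
  have ux' := uvP x'; rewrite !inE eqxx orbT in ux'; move/(_ isT) in ux'.
  have [[xu vx]|nI] := pselect (x <= u /\ v <= x').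
    exists k; first by case: Kk.
    move=> y yuv; rewrite fr// rhoE//; case/andP: yuv => uy yv.
    by rewrite (le_trans xu)// (le_trans yv).
  exists 1%g; first exact: subgroup1.
  move=> y yuv; rewrite fr// th1.
  by apply: (id_across _ uv ux ux' nI yuv); apply: HI_CI; exists k.
move=> CIf; have [[s [sD fH]] fo] := CIf.
exists [:: x, x' & s]; split=> [p|u v uv uvP].
  by rewrite !inE => /or3P[/eqP->|/eqP->|/sD].
have [|h Hh fh] := fH u v uv.
  by move=> p ps; apply: uvP; rewrite !inE ps !orbT.
have ux := uvP x; rewrite !inE eqxx in ux; move/(_ isT) in ux.
have ux' := uvP x'; rewrite !inE eqxx orbT in ux'; move/(_ isT) in ux'.
have [[xu vx]|nI] := pselect (x <= u /\ v <= x'); last first.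
  exists 1%g; first exact: subgroup1 domain_group_subgroup.
  by move=> y yuv; rewrite th1; exact: id_across yuv.
have Kh : K h.
  split=> //; have [pf _] := CIf.
  apply: (level_meet (x := u) L0 cdH pf (CI_rid CIf) (conj xcd xD1) Hh).
    by case/andP: xcd; case/andP: x'cd; move: xu vx uv; lra.
  by rewrite fh// lexx.
exists (rho h); first by exists h.
move=> y yuv; rewrite fh// rhoE//; case/andP: yuv => uy yv.
by rewrite (le_trans xu)// (le_trans yv).
Qed.

(** The restrictions fix the points fixed by the derived group, so that their
    derived series is one step ahead of that of [H]. *)
Lemma domain_group_solvable : derived_series HI n `<=` [set 1%g].
Proof.
move=> f HIf; apply: th_eq1 => y.
apply: (@derived_piecewise_fix _ H HI 1 n) => //.
- exact: domain_group_subgroup.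
- by move=> r /HI_CI[].
- by move=> r t /HI_CI CIr; exact: CI_fix.
- by apply: fixes_sub (fixes1 y); rewrite add1n.
Qed.

Let zi_le i j : (i <= j)%R -> ev (zexp z i) x <= ev (zexp z j) x.
Proof.
move=> ij; have -> : j = i + (absz (j - i)%R)%:Z by rewrite gez0_abs ?subr_ge0// addrC subrK.
elim: (absz _) => [|m IH]; first by rewrite addr0.
rewrite PoszS addrA zexpS; apply: le_trans IH _.
by rewrite thM th_le ltW.
Qed.

Let z_component : component (generated [set z]) c d.
Proof.
have zH : generated [set z] `<=` H by apply: generated_min => // _ ->.
have [cd _ _ _] := cdH; split=> //; [exact: fixes_sub zH cH|exact: fixes_sub zH dH|].
move=> y ycd; exists z; first exact: sub_generated.
move=> zy; have := level_fix L0 cdH Hz (cH Hz) ycd zy (conj xcd xD1).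
by move=> e; move: xx'; rewrite e ltxx.
Qed.

Let z_up b : b < d -> exists i, b < ev (zexp z i) x.
Proof.
move=> bd; have [w zw /andP[bw _]] := component_up (generated_subgroup _) z_component xcd bd.
by have [i wE] := generated_zexp zw; exists i; rewrite -wE.
Qed.

Let z_down b : c < b -> exists i, ev (zexp z i) x < b.
Proof.
move=> cb; have [w zw /andP[_ wb]] := component_down (generated_subgroup _) z_component xcd cb.
by have [i wE] := generated_zexp zw; exists i; rewrite -wE.
Qed.

Let lid_d f : piecewise H f -> rid c f -> f d = d -> lid d f.
Proof.
move=> pf cf fd; have [//|[b bd fb]] := lgerm_dich fd.
have [i bi] := z_up bd; case: (fb (ev (zexp z i) x)).
  by rewrite (ltW bi); case/andP: (H_cd (Hzi i) xcd).
apply: (level_piecewise L0 cdH pf cf); split; first exact: H_cd.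
exact: H_D1.
Qed.

(** High powers of [z] of either sign push the fundamental domain into the
    neighbourhoods of the ends on which the element is the identity. *)
Let finite_conjugates k : K k -> finite_set [set rho (k ^ zexp z i)%g | i in [set: int]].
Proof.
move=> Kk; have [Hk ck] := Kk; have [b cb kb] := ck.
have [b' b'd kb'] := lid_d (sub_piecewise Hk) ck (dH Hk).
have [i0 i0b] := z_up b'd; have [j0 j0b] := z_down cb.
have [m [mi0 mj0]] : exists m : int, i0 <= m /\ - m < j0.
  have [le|lt] := leP i0 (1 - j0).
    by exists (1 - j0); rewrite opprB ltrBlDr ltrDl.
  exists i0; split=> //; rewrite ltrNl; apply: lt_trans lt.
  by rewrite ltrDr.
apply: (@sub_finite_set _ _ ([set 1%g] `|`
  (fun i => rho (k ^ zexp z i)%g) @` [set i | - m < i < m])); last first.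
  rewrite finite_setU; split; first exact: finite_set1.
  by apply: finite_image; exact: finite_intervalz.
move=> _ [i _ <-]; have [im|im] := pselect (- m < i < m); first by right; exists i.
have Kki : K (k ^ zexp z i)%g.
  split; first by apply: subgroupJ.
  apply/rslope0P; first by rewrite thJ (cH (Hzi i)) (cH Hk) (th_fixV (cH (Hzi i))).
  rewrite /conjg !rslopeM ?thM ?(cH (Hzi i)) ?(cH Hk)//.
  rewrite rslopeV ?(cH (Hzi i))//.
  have /rslope0P -> := ck; last exact: cH.
  by ring.
left; apply: thompson_eq => y; rewrite rhoE// th1; case: ifP => // /andP[xy yx].
have fixk : k (ev (zexp z i) y) = ev (zexp z i) y.
  have ziE : ev (zexp z (i + 1)) x = ev (zexp z i) x' by rewrite zexpS.
  have /orP[im'|im'] : (i <= - m) || (m <= i).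
    by move/negP: im; rewrite negb_and -!leNgt.
    apply: kb; rewrite -[X in X <= _](cH (Hzi i)) th_le.
    have -> : c <= y by case/andP: xcd => /ltW /le_trans ->.
    apply: le_trans (ltW j0b); apply: (@le_trans _ _ (ev (zexp z (i + 1)) x)).
      by rewrite ziE th_le.
    by apply: zi_le; rewrite lezD1 (le_lt_trans im').
  apply: kb'; rewrite -[X in _ && (_ <= X)](dH (Hzi i)) th_le.
  have -> : y <= d by case/andP: x'cd => _ /ltW; exact: le_trans.
  rewrite andbT; apply: le_trans (ltW i0b) _; apply: (@le_trans _ _ (ev (zexp z i) x)).
    by apply: zi_le; exact: le_trans mi0 im'.
  by rewrite th_le.
by rewrite thJ fixk thK.
Qed.

(** Correcting the generators of [H] by powers of [z] yields finitely many elements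
    of the germ kernel, whose conjugates by powers of [z] generate it; only
    finitely many of these act nontrivially on the fundamental domain. *)
Lemma domain_group_fg : finitely_generated H -> finitely_generated HI.
Proof.
move=> [A fA HA]; have gK := germ_kernel_subgroup; have gHI := domain_group_subgroup.
have AH a : A a -> H a by move=> Aa; rewrite HA; exact: sub_generated.
(* [a * z ^ - q a] has slope 1 at [c]. *)
pose q a := (rslope c a %/ rslope c z)%Z.
pose A' := [set (a * zexp z (- q a))%g | a in A].
have lam : additive_on H (rslope c : F -> int).
  by move=> f g _ Hg; apply: rslopeM; exact: cH.
have A'K : A' `<=` K.
  move=> _ [a /AH Ha <-]; split; first exact: subgroupM.
  apply/rslope0P; first by rewrite thM !cH.
  rewrite lam// (additive_zexp _ gH lam Hz).
  have [i ai] := zdiv Ha; rewrite /q ai mulzK ?gt_eqF//; ring.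
pose T := [set (k ^ zexp z i)%g | k in A' & i in [set: int]].
have T_conj u i : generated T u -> generated T (u ^ zexp z i)%g.
  have gT := generated_subgroup T.
  suff : generated T `<=` [set u | generated T (u ^ zexp z i)%g] by exact.
  apply: generated_min.
    apply/subgroupP; split=> /= [|s t su sv|s su]; first by rewrite conj1g; exact: (subgroup1 gT).
      by rewrite conjMg; exact: (subgroupM gT).
    by rewrite conjVg; exact: (subgroupV gT).
  move=> _ [k kA' [j _ <-]]; apply: sub_generated; exists k => //.
  by exists (j + i) => //; rewrite zexpD conjgM.
have HT h : H h -> exists i, generated T (h * zexp z i)%g.
  suff : H `<=` [set h | exists i, generated T (h * zexp z i)%g] by exact.
  have gT := generated_subgroup T.
  rewrite {1}HA; apply: generated_min; last first.
    move=> a Aa; exists (- q a); apply: sub_generated; exists (a * zexp z (- q a))%g.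
      by exists a.
    by exists 0 => //; rewrite conjg1.
  apply/subgroupP; split=> /= [|f g [i fi] [j gj]|f [i fi]].
  - by exists 0; rewrite mulg1; exact: (subgroup1 gT).
  - exists (j + i).
    have -> : (f * g * zexp z (j + i) = (f * zexp z i) * (g * zexp z j) ^ zexp z i)%g.
      by rewrite /conjg zexpD !mulgA mulgK.
    by apply: (subgroupM gT) => //; exact: T_conj.
  - exists (- i).
    have -> : (f^-1 * zexp z (- i) = (f * zexp z i)^-1 ^ zexp z (- i))%g.
      by rewrite /conjg zexpN invgK invgM !mulgA mulgV mul1g.
    by apply: T_conj; exact: (subgroupV gT).
have TK : T `<=` K.
  move=> _ [k /A'K[Hk ck] [i _ <-]]; split; first exact: subgroupJ.
  rewrite -[(k ^ _)%g](mulVKg k) -/([~ k, zexp z i])%g.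
  apply: ridM => //; apply: rid_comm; exact: cH.
have gTK : generated T `<=` K by exact: generated_min.
have KT : K `<=` generated T.
  move=> k [Hk ck]; have [i Ti] := HT k Hk.
  have [_ /rslope0P] := gTK _ Ti; rewrite lam// (additive_zexp _ gH lam Hz).
  have /rslope0P -> := ck; last exact: cH.
  rewrite thM !cH// => /(_ erefl); rewrite add0r => /eqP.
  rewrite mulf_eq0 (gt_eqF z_gt0) orbF => /eqP i0.
  by move: Ti; rewrite i0 mulg1.
pose B := \bigcup_(k in A') [set rho (k ^ zexp z i)%g | i in [set: int]].
exists B.
  apply: bigcup_finite; first exact: finite_image.
  by move=> k /A'K; exact: finite_conjugates.
have gB := generated_subgroup B.
apply/seteqP; split; last first.
  apply: generated_min => // _ [k kA' [i _ <-]]; exists (k ^ zexp z i)%g => //.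
  by apply: TK; exists k => //; exists i.
have K1 := subgroup1 gK.
have rho1 : rho 1%g = 1%g by apply: thompson_eq => y; rewrite rhoE// th1; case: ifP.
suff KB : generated T `<=` [set k | K k /\ generated B (rho k)].
  by move=> _ [k /KT/KB[_ kB] <-].
apply: generated_min.
  apply/subgroupP; split=> [|k k' [Kk kB] [Kk' kB']|k [Kk kB]].
  - by split=> //; rewrite rho1; exact: (subgroup1 gB).
  - by split; [exact: (subgroupM gK)|rewrite rhoM//; exact: (subgroupM gB)].
  - by split; [exact: (subgroupV gK)|rewrite rhoV//; exact: (subgroupV gB)].
move=> t Tt; split; first exact: TK.
have [k kA' [i _ <-]] := Tt; apply: sub_generated.
by exists k => //; exists i.
Qed.

Definition component_part : set F :=
  [set f | [/\ piecewise H f, rid c f & forall y, ~~ (c < y < d) -> f y = y]].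

Local Notation p i := (ev (zexp z i) x).

(** Such an element fixes all the dyadic points [p i], so that it can be cut
    there into finitely many pieces, which are conjugate by powers of [z] to
    elements supported in the fundamental domain. *)
Lemma component_part_covered : finitely_generated CI ->
  covered (piecewise H) component_part.
Proof.
move=> [B fB CIB]; have gp := piecewise_subgroup gH.
have CIgen f : CI f -> generated B f by rewrite CIB.
pose A := B `|` [set z]; exists A; split.
- by rewrite finite_setU; split=> //; exact: finite_set1.
- move=> f [Bf|->]; last exact: sub_piecewise.
  by have [] : CI f by rewrite CIB; exact: sub_generated.
have gA := generated_subgroup A.
have zA i : generated A (zexp z i) by apply: (zexp_in _ gA); apply: sub_generated; right.
have pcd i : c < p i < d by exact: H_cd.
have pD1 i : fixes D1 (p i) by exact: H_D1.
have pD i : dyadic (p i) by exact: th_dyadic.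
have pS i : p (i + 1) = ev (zexp z i) x' by rewrite zexpS.
have [c0 d1] := component_01 cdH.
have step m j f : piecewise H f ->
    (forall y, ~~ (p j <= y <= p (j + m%:Z)) -> f y = y) -> generated A f.
  elim: m j f => [|m IH] j f pf fo.
    rewrite addr0 in fo; rewrite (_ : f = 1%g); first exact: (subgroup1 gA).
    apply: th_eq1 => y; have [->|yp] := eqVneq y (p j); last first.
      by apply: fo; rewrite -eq_le eq_sym.
    apply: contrapT => /eqP fy; have := fo (f (p j)).
    by rewrite -eq_le eq_sym fy => /(_ isT)/th_inj/eqP; rewrite (negbTE fy).
  have cf : rid c f.
    exists ((c + p j) / 2); first by case/andP: (pcd j); lra.
    by move=> y yc; apply: fo; case/andP: (pcd j); move: yc; lra.
  have fp i : f (p i) = p i by exact: (level_piecewise L0 cdH pf cf).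
  have lej : p j <= p (j + 1) by apply: zi_le; rewrite lerDl.
  have p0 i : 0 <= p i by case/andP: (pcd i) => /ltW/(le_trans c0).
  have p1 i : p i <= 1 by case/andP: (pcd i) => _ /ltW/le_trans; exact.
  pose g : F := cut (p j) (p (j + 1)) f.
  have gE y : g y = if p j <= y <= p (j + 1) then f y else y by exact: cutE.
  have pg : piecewise H g by exact: cut_piecewise.
  have gA' : generated A g.
    have -> : g = ((g ^ zexp z j) ^ zexp z (- j))%g by rewrite -conjgM -zexpD subrr conjg1.
    apply: (subgroupJ gA) => //; apply: (generatedS (A := B)); first by move=> ? ?; left.
    apply: CIgen; split.
      by apply: (subgroupJ gp) => //; exact: sub_piecewise.
    move=> y yI; rewrite thJ gE pS !th_le (negbTE yI); exact: thK.
  rewrite -[f](mulVKg g); apply: (subgroupM gA) => //; apply: (IH (j + 1)).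
    by apply: (subgroupM gp) => //; exact: (subgroupV gp).
  move=> y yo; rewrite thM (_ : f y = g y) ?thK// gE; case: ifPn => // yj.
  apply: fo; move: yo yj; rewrite PoszS [m%:Z + 1]addrC addrA.
  by rewrite !negb_and -!ltNge => /orP[y1|->]; rewrite ?orbT// => /orP[->//|y2]; move: y1 y2; lra.
move=> f [pf cf fo].
have fd : ev f d = d by apply: fo; rewrite ltxx andbF.
have [b0 cb0 fb0] := cf; have [b1 b1d fb1] := lid_d pf cf fd.
have [i ib] := z_up b1d; have [j jb] := z_down cb0.
pose i' := Num.max i j.
have i'E : i' = j + (absz (i' - j)%R)%:Z.
  by rewrite gez0_abs ?subr_ge0 ?le_max ?lexx ?orbT// addrC subrK.
apply: (step (absz (i' - j)%R) j) => // y; rewrite -i'E negb_and -!ltNge => /orP[yj|iy].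
  have [cy|yc] := leP c y; first by apply: fb0; rewrite cy (ltW (lt_trans yj jb)).
  by apply: fo; rewrite negb_and -!leNgt (ltW yc).
have [dy|yd] := leP d y; first by apply: fo; rewrite negb_and -!leNgt dy orbT.
apply: fb1; rewrite (ltW yd) andbT; apply: le_trans (ltW ib) (le_trans _ (ltW iy)).
by apply: zi_le; rewrite le_max lexx.
Qed.

End FundamentalDomain.

(** * Finite generation of the closure *)

Section FiniteGeneration.
Variable R : realType.
Local Notation F := (thompson R).
Implicit Types (f g h : F) (H : set F) (x y c d : R) (n : nat).

Lemma component_covered H n c d : subgroup H -> derived_series H n.+1 `<=` [set 1%g] ->
  (forall K : set F, subgroup K -> derived_series K n `<=` [set 1%g] ->
     finitely_generated K -> finitely_generated (piecewise K)) ->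
  finitely_generated H -> component H c d ->
  covered (piecewise H) (component_part H c d).
Proof.
move=> gH Hn IH fgH cdH; have L0 : level H H _ := derived_level 0 gH.
have [_ cH _ mv] := cdH.
have [D1fix|/existsNP[y /not_implyP[ycd yN]]] :=
    pselect (forall y, c < y < d -> fixes (derived_series H 1) y).
  apply: covered1 => f [pf cf fo]; apply: th_eq1 => y.
  have [ycd|/fo//] := boolP (c < y < d).
  by apply: (level_piecewise L0 cdH pf cf); split=> //; exact: D1fix.
have [x xD [xcd xD1]] := component_dyadic gH Hn cdH ycd yN.
have lam : additive_on H (rslope c : F -> int).
  by move=> f g _ Hg; apply: rslopeM; exact: cH.
have [|z Hz [z0 zdiv]] := least_positive gH lam.
  have [h Hh hx] := mv x xcd; exists h => // /rslope0P ch; apply: hx.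
  by apply: (level_rid L0 cdH Hh) => //; apply: ch; exact: cH.
apply: (component_part_covered gH cdH xD xcd xD1 Hz z0).
rewrite -(piecewise_domain_group gH cdH xD xcd xD1 Hz z0); apply: IH.
- exact: (domain_group_subgroup gH cdH xD xcd xD1 Hz z0).
- exact: (domain_group_solvable gH Hn cdH xD xcd xD1 Hz z0).
- exact: (domain_group_fg gH cdH xD xcd xD1 Hz z0 zdiv).
Qed.

(** By induction on the number of components on which an element is not yet
    known to be trivial: the slope at the left end of the next component is a
    homomorphism to the integers, and an element of its kernel is the product
    of its restriction to this component and of an element trivial on it. *)
Lemma components_covered H n (r s : seq R) : subgroup H ->
  derived_series H n `<=` [set 1%g] ->
  (forall c d, component H c d -> covered (piecewise H) (component_part H c d)) ->
  (forall c d, component H c d -> (c \in s) || (c \in r)) ->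
  covered (piecewise H)
    [set f | piecewise H f /\ forall c d, component H c d -> c \in s ->
       forall x, c < x < d -> f x = x].
Proof.
move=> gH Hn cov; have gp := piecewise_subgroup gH.
elim: r s => [|c r IH] s sr.
  apply: covered1 => f [pf fs]; apply: th_eq1 => x.
  have [xH|/component_exists[//|c [d [cdH xcd]]]] := pselect (fixes H x).
    exact: piecewise_fix pf xH.
  by apply: (fs c d cdH) xcd; have := sr c d cdH; rewrite in_nil orbF.
have sr' c' d' : component H c' d' -> (c' \in c :: s) || (c' \in r).
  by move=> /sr; rewrite !inE; case: (c' == c); rewrite ?orbT.
have [[d cdH]|nc] := pselect (exists d, component H c d); last first.
  apply: covered_sub (IH _ sr') => f [pf fs]; split=> // c' d' cdH'.
  rewrite inE => /orP[/eqP e|]; last exact: fs.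
  by case: nc; exists d'; rewrite -e.
have [cd cH dH _] := cdH.
have pfix f y : piecewise H f -> fixes H y -> f y = y by exact: piecewise_fix.
apply: (@covered_ker _ _ _ (rslope c : F -> int)).
- apply/subgroupP; split=> [|f g [pf fs] [pg gs]|f [pf fs]]; split.
  + exact: (subgroup1 gp).
  + by [].
  + exact: (subgroupM gp).
  + by move=> c' d' cdH' c's x xcd; rewrite thM (gs c' d')// (fs c' d').
  + exact: (subgroupV gp).
  + by move=> c' d' cdH' c's x xcd; apply: th_fixV; exact: (fs c' d').
- by move=> f [].
- by move=> f g _ [pg _]; apply: rslopeM; exact: pfix.
apply: (covered_mul (cov c d cdH) (IH _ sr')) => f [[pf fs] f0].
have fc := pfix f c pf cH; have fd := pfix f d pf dH.
have cf : rid c f by apply/rslope0P.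
have L0 : level H H _ := derived_level 0 gH.
have df : lid d f.
  have [//|[b bd fb]] := lgerm_dich fd.
  have [y ycd yD] := component_fixed (k := 0) gH Hn cdH.
  have [w Hw /andP[bw wd]] := component_up gH cdH ycd bd.
  case: (fb (w y)); first by rewrite wd ltW.
  apply: (level_piecewise L0 cdH pf cf); split.
    by rewrite wd andbT -(cH w Hw) th_lt; case/andP: ycd.
  exact: (fixes_norm (normalizes_derived (k := 1) gH) Hw).
have [b cb fb] := cf; have [e ed fe] := df.
(* The middle of the component keeps the two cuts in order. *)
pose m := (c + d) / 2.
have [a aD /andP[ca ab]] : exists2 a, dyadic a & c < a < Num.min b m.
  by apply: dyadic_between; rewrite lt_min cb /m; lra.
have [a' a'D /andP[ea' a'd]] : exists2 a', dyadic a' & Num.max e m < a' < d.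
  by apply: dyadic_between; rewrite gt_max ed /m; lra.
move: ab ea'; rewrite lt_min gt_max => /andP[ab am] /andP[ea' ma'].
have aa' : a <= a' by exact: ltW (lt_trans am ma').
have fa : ev f a = a by apply: fb; rewrite !ltW.
have fa' : ev f a' = a' by apply: fe; rewrite !ltW.
have [c0 d1] := component_01 cdH.
have a0 : 0 <= a by exact: le_trans c0 (ltW ca).
have a1 : a' <= 1 by exact: le_trans (ltW a'd) d1.
pose g : F := cut a a' f.
have gE y : g y = if a <= y <= a' then ev f y else y by exact: cutE.
have pg : piecewise H g by exact: cut_piecewise.
have gf y : c < y < d -> g y = ev f y.
  move=> /andP[cy yd]; rewrite gE; case: ifPn => //.
  rewrite negb_and -!ltNge => /orP[ya|ay].
    by rewrite fb// (ltW cy) (ltW (lt_trans ya ab)).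
  by rewrite fe// (ltW yd) (ltW (lt_trans ea' ay)).
exists g, (g^-1 * f)%g; split; last by rewrite mulVKg.
  split=> //; last first.
    move=> y yo; rewrite gE ifN//; apply: contra yo => /andP[ay ya].
    by rewrite (lt_le_trans ca ay) (le_lt_trans ya a'd).
  exists a => // y /andP[cy ya]; rewrite gE; case: ifP => // /andP[ay _].
  by have -> : y = a; [apply/eqP; rewrite eq_le ya|].
split; first by apply: (subgroupM gp) => //; exact: (subgroupV gp).
move=> c' d' cdH'; rewrite inE => /orP[/eqP e'|c's] x xcd; rewrite thM.
  rewrite e' in cdH' xcd; rewrite -(component_right_eq cdH cdH') in xcd.
  by rewrite -gf// thK.
rewrite (fs c' d')//; apply: th_fixV; rewrite gE; case: ifP => // _.
exact: (fs c' d').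
Qed.

Lemma piecewise_fg n H : subgroup H -> derived_series H n `<=` [set 1%g] ->
  finitely_generated H -> finitely_generated (piecewise H).
Proof.
elim: n H => [|n IH] H gH Hn fgH; have gp := piecewise_subgroup gH.
  by apply: covered_fg => //; apply: covered1; exact: (derived_piecewise1 gH Hn).
apply: covered_fg => //.
have /finite_seqP[r rE] := finite_components gH Hn fgH.
have cov c d : component H c d -> covered (piecewise H) (component_part H c d).
  exact: (component_covered gH Hn IH fgH).
have rP c d : component H c d -> (c \in [::]) || (c \in r).
  by move=> cdH; have : [set` r] c; [rewrite -rE; exists d|].
apply: covered_sub (components_covered gH Hn cov rP) => f pf; split=> //.
Qed.

End FiniteGeneration.

Theorem theorem1p7 (R : realType) (n : nat) (H : set (thompson R))
    (hH : solvable_of_length H n) :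
  [/\ infinite_set [set thompson_orbit H x | x in @dyadic01 R],
      solvable_of_length (thompson_closure H) n
    & finitely_generated H -> finitely_generated (thompson_closure H)].
Proof.
have [gH Hn _] := hH; rewrite (thompson_closureE gH); split.
- exact: infinite_orbits hH.
- exact: piecewise_solvable.
- by apply: (@piecewise_fg R n H gH); rewrite Hn.
Qed.
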